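(* Let $g_0(t) = 2^{1/4} e^{-\pi t^2}$ be the normalized standard Gaussian and, for $\alpha,\beta>0$, let $\Lambda_{(\alpha,\beta)} = \alpha\mathbb{Z}\times\beta\mathbb{Z}$. Denote by $A(\alpha,\beta)$ the optimal lower frame bound of the Gabor system $\mathcal{G}(g_0,\Lambda_{(\alpha,\beta)})$, and by $$\widetilde{B}(\alpha,\beta) = \sum_{\lambda^\circ\in\Lambda_{(\alpha,\beta)}^\circ} |V_{g_0}g_0(\lambda^\circ)|, \qquad \Lambda_{(\alpha,\beta)}^\circ = \tfrac{1}{\beta}\mathbb{Z}\times\tfrac{1}{\alpha}\mathbb{Z},$$ the (re-normalized) Tolimieri and Orr bound. Then, for all $\alpha,\beta>0$ with $(\alpha\beta)^{-1}=2$, the following implication holds: $$\widetilde{B}\left(\tfrac{t}{\sqrt{2}},\tfrac{t}{\sqrt{2}}\right) \leq \widetilde{B}(t\alpha,t\beta) \quad \text{for all } t\in\mathbb{R}_+ \quad\Longrightarrow\quad A\left(\tfrac{1}{\sqrt{2}},\tfrac{1}{\sqrt{2}}\right) \geq A(\alpha,\beta).$$ In each case (that is, in each of the two inequalities), equality holds only if $\alpha=\beta=\tfrac{1}{\sqrt{2}}$.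
   Context: $\mathbb{R}_+$ denotes the positive real numbers. For $f,g\in L^2(\mathbb{R})$, the inner product is $\langle f,g\rangle=\int_{\mathbb{R}} f(t)\overline{g(t)}\,dt$, and the short-time Fourier transform of $f$ with window $g$ is $$V_g f(x,\omega)=\int_{\mathbb{R}} f(t)\,\overline{g(t-x)}\,e^{-2\pi i\omega t}\,dt,\qquad x,\omega\in\mathbb{R}.$$ For $\lambda=(x,\omega)\in\mathbb{R}^2$ the time-frequency shift is $\pi(\lambda)g(t)=e^{2\pi i\omega t}g(t-x)$, so that $V_gf(\lambda)=\langle f,\pi(\lambda)g\rangle$. For a lattice $\Lambda\subset\mathbb{R}^2$, the Gabor system generated by $g$ and $\Lambda$ is $\mathcal{G}(g,\Lambda)=\{\pi(\lambda)g \mid \lambda\in\Lambda\}$. The optimal lower frame bound $A$ and the optimal upper frame bound $B$ of $\mathcal{G}(g,\Lambda)$ are the tightest possible constants (largest $A$, smallest $B$) in the frame inequality $$A\|f\|_2^2\le\sum_{\lambda\in\Lambda}|\langle f,\pi(\lambda)g\rangle|^2\le B\|f\|_2^2\qquad\text{for all } f\in L^2(\mathbb{R}).$$ The function $\widetilde{B}(\alpha,\beta)$ is defined by the stated series for all $\alpha,\beta>0$, with no constraint on $\alpha\beta$. *)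

(* Defs.v *)
From HB Require Import structures.
From mathcomp Require Import all_boot all_order all_algebra.
From mathcomp Require Import complex.
From mathcomp Require Import all_classical all_reals all_analysis.

Set Implicit Arguments.
Unset Strict Implicit.
Unset Printing Implicit Defensive.

Import Order.TTheory GRing.Theory Num.Theory.
Import numFieldNormedType.Exports.

Local Open Scope classical_set_scope.
Local Open Scope ring_scope.

Section Gabor.
Context {R : realType}.

Notation mu := (@lebesgue_measure R).

Definition cabs (z : R[i]) : R := ComplexField.Normc.normc z.

Definition cis (theta : R) : R[i] := Complex (cos theta) (sin theta).

(* The components are integrated separately; as with [Rintegral], the value is
   meaningful only when both components are integrable. *)
Definition cintegral (f : R -> R[i]) : R[i] :=
  Complex (\int[mu]_t complex.Re (f t)) (\int[mu]_t complex.Im (f t)).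

Definition L2normsq (f : R -> R[i]) : \bar R :=
  (\int[mu]_t ((cabs (f t)) ^+ 2)%:E)%E.

(* Representatives of the elements of L^2(R).  Measurability is Borel; every
   a.e.-class of Lebesgue measurable functions has a Borel representative. *)
Definition inL2 (f : R -> R[i]) : Prop :=
  [/\ measurable_fun setT (fun t : R => complex.Re (f t)),
      measurable_fun setT (fun t : R => complex.Im (f t)) &
      (L2normsq f < +oo)%E].

Definition inner (f g : R -> R[i]) : R[i] :=
  cintegral (fun t => f t * conjc (g t)).

Definition stft (g f : R -> R[i]) (l : R * R) : R[i] :=
  cintegral (fun t => f t * conjc (g (t - l.1)) * cis (- (2 * pi * l.2 * t))).

Definition tfshift (l : R * R) (g : R -> R[i]) : R -> R[i] :=
  fun t => cis (2 * pi * l.2 * t) * g (t - l.1).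

Definition rect_lattice (a b : R) : set (R * R) :=
  [set l | exists j k : int, l = (a * j%:~R, b * k%:~R)].

Definition adjoint_lattice (a b : R) : set (R * R) :=
  rect_lattice b^-1 a^-1.

Definition frame_sum (g : R -> R[i]) (L : set (R * R)) (f : R -> R[i]) :
    \bar R :=
  (\esum_(l in L) ((cabs (inner f (tfshift l g))) ^+ 2)%:E)%E.

Definition is_lower_frame_bound (g : R -> R[i]) (L : set (R * R)) (A : R) :
    Prop :=
  forall f, inL2 f -> (A%:E * L2normsq f <= frame_sum g L f)%E.

(* The set of lower frame bounds is closed, so its supremum is the largest one. *)
Definition opt_lower_frame_bound (g : R -> R[i]) (L : set (R * R)) : \bar R :=
  ereal_sup [set A%:E | A in is_lower_frame_bound g L].

Definition g0 (t : R) : R[i] :=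
  real_complex R ((2 `^ 4^-1) * expR (- (pi * t ^+ 2))).

Definition Aopt (a b : R) : \bar R :=
  opt_lower_frame_bound g0 (rect_lattice a b).

Definition Btilde (a b : R) : \bar R :=
  (\esum_(l in adjoint_lattice a b) (cabs (stft g0 g0 l))%:E)%E.

End Gabor.

(* Main.v *)
Require Import Defs.
From mathcomp Require Import all_boot all_order all_algebra.
From mathcomp Require Import complex.
From mathcomp Require Import all_classical all_reals all_analysis.
From mathcomp Require Import measurable_realfun.
From mathcomp Require Import ring lra zify.

Set Implicit Arguments.
Unset Strict Implicit.
Unset Printing Implicit Defensive.

Import Order.TTheory GRing.Theory Num.Theory.
Import numFieldNormedType.Exports.

Local Open Scope classical_set_scope.
Local Open Scope ring_scope.

(** Put s = 2 alpha^2, so that beta = 1 / (2 alpha), and let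
      theta u x = sum_k exp(- pi u k^2) cos(2 pi k x)  (k over the integers),
      theta3 u = theta u 0,  theta4 u = theta u (1/2).
    Both sides of the statement are products of such values, and both are
    decided by the behaviour of these products under s -> 1/s.

    The Tolimieri-Orr bound.  The ambiguity function of the Gaussian is
    |V g g (x, w)| = exp(- pi (x^2 + w^2) / 2) ([stft_gauss]), whence, with
    c = t^-2, Btilde (t alpha) (t beta) = theta3 (c s) theta3 (c / s)
    ([BtildeE]).  By Poisson summation E u = log theta3 (e^u) + u / 4 is even.
    Writing theta3 as a sum of functions that are log-convex in u shows that
    E is strictly convex on a half-line that contains 0 in its interior.  An
    even function with this property satisfies E (v + u) + E (v - u) > 2 E v
    for all v and all u <> 0 ([even_convex]), although nothing is known about
    its convexity far to the left.  So the bound at the square lattice is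
    strictly the smallest ([theta3_mul_lt]).

    The lower frame bound.  It is at least 2 theta4 1 ^ 2 for the square
    lattice and at most 2 theta4 s theta4 (1/s) in general.  For f continuous
    of bounded support and T = 2 alpha = 1 / beta, Parseval on one period
    turns the sum over the frequencies into the integral of the square of a
    periodization; the sum over the translations is then a Gaussian sum,
    because a product of two translated Gaussians is a Gaussian in the
    midpoint times a Gaussian in the distance.  The result
    ([gabor_energyE]) is
      sum_l |<f, pi(l) g>|^2 = T int_0^T sqrt 2 G(x / alpha)
          (sum_(m, n) f(x + m T) f(x + n T) exp(- pi s (m - n)^2)) dx
    with G y = sum_k exp(- pi s (y + k)^2).  The inner form is a Toeplitz
    form with symbol theta s, hence lies between the extreme values of
    theta s times sum_m f(x + m T)^2 ([gform_bounds]), and G itself is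
    theta (1/s) / sqrt s by Poisson summation.  For s = 1 the minimum of
    theta 1 is theta4 1 ([theta4_1_min]), which gives the lower estimate; it
    extends from f to all of L2 by density and the Bessel bound
    ([gabor_energy_lower]).  The upper estimate holds for every s: copies of
    a narrow bump at alpha / 2 with alternating signs approach the value of
    both symbols at 1/2 ([lower_bound_le]).  Finally
    theta4 s theta4 (1/s) < theta4 1 ^ 2 unless s = 1 ([theta4_mul_lt]),
    since u -> log (theta4 (e^u) theta4 (e^-u)) is even and strictly concave
    on a half-line around 0.

    Complex f reduce to their real and imaginary parts, because the mixed
    terms at the frequencies k and - k cancel ([inner_energy]). *)

(** Natural subtraction truncates, so this is the distance of i and j. *)
Notation ndist i j := (i - j + (j - i))%N (only parsing).

(** * Cesaro means of Toeplitz sums *)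

Section Toeplitz.
Context {R : realType}.
Implicit Types (d : R ^nat) (l L : R).

Lemma toeplitz_sum d n :
  \sum_(i < n) \sum_(j < n) d (ndist i j) =
  2 * (\sum_(m < n) series d m.+1) - n%:R * d 0%N.
Proof.
elim: n => [|n IH]; first by rewrite !big_ord0 mulr0 mul0r subr0.
rewrite big_ord_recr /= [X in _ + X]big_ord_recr /= subnn addn0.
under eq_bigr do rewrite big_ord_recr /=.
rewrite big_split /= IH [in RHS]big_ord_recr /=.
have E1 : \sum_(i < n) d (i - n + (n - i))%N = series d n.+1 - d 0%N.
  rewrite /series /= big_mkord big_ord_recl /= addrC addKr.
  rewrite [RHS](reindex_inj rev_ord_inj) /=; apply: eq_bigr => i _.
  by congr d; rewrite /bump /=; have := ltn_ord i; lia.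
have E2 : \sum_(i < n) d (n - i + (i - n))%N = series d n.+1 - d 0%N.
  by rewrite -E1; apply: eq_bigr => i _; rewrite addnC.
by rewrite E1 E2 -natr1; ring.
Qed.

(** Both the Fejer means and the energy of alternating signs are averages of a
    Toeplitz matrix: each distance k > 0 occurs about 2 n times, so Cesaro
    applies to the partial sums. *)
Lemma toeplitz_mean d l : series d @ \oo --> l ->
  (n.+1%:R^-1 * \sum_(i < n.+1) \sum_(j < n.+1) d (ndist i j))
    @[n --> \oo] --> 2 * l - d 0%N.
Proof.
move=> dl.
have H : (fun n => series d n.+1) @ \oo --> l by rewrite (cvg_shiftS (series d)).
have /= := cesaro H.
rewrite /arithmetic_mean /= => H2.
rewrite [X in X @ _ --> _](_ : _ = fun n =>
   2 * (n.+1%:R^-1 * series (fun m => series d m.+1) n.+1) - d 0%N); last first.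
  apply/funext => n; rewrite toeplitz_sum mulrBr mulKf ?pnatr_eq0//.
  by rewrite mulrCA [in RHS]/series /= big_mkord.
apply: cvgB; last exact: cvg_cst.
by apply: cvgM; [exact: cvg_cst|exact: H2].
Qed.

(** The Tauberian converse: for nonnegative terms the Cesaro means dominate
    any fixed partial sum in the limit, so the series is bounded. This is what
    turns convergence of Fejer means into convergence of the Parseval series.
    *)
Lemma toeplitz_mean_inv d L : (forall n, 0 <= d n) ->
  (n.+1%:R^-1 * \sum_(i < n.+1) \sum_(j < n.+1) d (ndist i j))
    @[n --> \oo] --> L ->
  series d @ \oo --> (L + d 0%N) / 2.
Proof.
move=> d0 HL.
have nd : nondecreasing_seq (series d) by exact: nondecreasing_series.
(* If some partial sum exceeded this, the means would eventually exceed L. *)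
pose K := (L + 1 + d 0%N).
have bnd m : series d m <= K.
  rewrite leNgt; apply/negP => Km.
  have Kge : 0 <= series d m by rewrite /series /=; apply: sumr_ge0.
  have cH : (n.+1%:R^-1 : R) @[n --> \oo] --> 0 by exact: cvg_harmonic.
  have : (fun n => n.+1%:R^-1 * (2 * ((n.+1 - m)%N%:R * series d m)) - d 0%N) @ \oo
     --> 2 * series d m - d 0%N.
    apply: cvgB; last exact: cvg_cst.
    apply: cvg_trans; last first.
      have : (fun n => 2 * series d m - n.+1%:R^-1 * (m%:R * 2 * series d m)) @ \oo
         --> 2 * series d m - 0 * (m%:R * 2 * series d m).
        by apply: cvgB; [exact: cvg_cst|apply: cvgMl; exact: cH].
      by rewrite mul0r subr0; apply.
    apply: near_eq_cvg; near=> n.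
    have mn : (m <= n)%N by near: n; exact: nbhs_infty_ge.
    rewrite natrB; last by rewrite leqW.
    rewrite -[X in X - _](mulKf (_ : n.+1%:R != 0)) ?pnatr_eq0//.
    ring.
  move=> H1.
  have : 2 * series d m - d 0%N <= L.
    apply: (ler_cvg_to H1 HL).
    near=> n.
    rewrite toeplitz_sum mulrBr mulKf ?pnatr_eq0// lerD2r.
    rewrite ler_wpM2l ?invr_ge0// ler_wpM2l//.
    have mn : (m <= n)%N by near: n; exact: nbhs_infty_ge.
    have <- : \sum_(i < n.+1 | (m <= i)%N) series d m = (n.+1 - m)%N%:R * series d m.
      by rewrite -(@big_geq_mkord _ _ _ m n.+1 predT (fun=> series d m)) sumr_const_nat mulr_natl.
    rewrite [leRHS](bigID (fun i : 'I_n.+1 => (m <= i)%N)) /=.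
    rewrite -[leLHS]addr0; apply: lerD.
      by apply: ler_sum => i mi; apply: nd; exact: leqW.
    by apply: sumr_ge0 => i _; rewrite /series /= sumr_ge0.
  rewrite leNgt; move/negP; apply; apply: lt_le_trans (_ : 2 * K - d 0%N <= _).
    rewrite /K; have := d0 0%N.
    have L0 : 0 <= L.
      apply: (cvgr_to_ge HL); apply: nearW => n.
      rewrite mulr_ge0 ?invr_ge0//; apply: sumr_ge0 => i _; exact: sumr_ge0.
    lra.
  by rewrite lerD2r ler_pM2l// ltW.
have cv : cvgn (series d).
  by apply: nondecreasing_is_cvgn => //; exists K => _ [m _ <-].
have := toeplitz_mean cv => /(cvg_unique _ HL) -> //.
by rewrite subrK mulrC mulKf.
Unshelve. all: by end_near.
Qed.

End Toeplitz.

(** * Continuity and integration on intervals *)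

Section ContinuityTools.
Context {R : realType}.
Notation mu := (@lebesgue_measure R).

Implicit Types (f g h : R -> R) (a : R).

Lemma ct_add f g a : continuous_at a f -> continuous_at a g ->
  continuous_at a (fun x => f x + g x).
Proof. exact: cvgD. Qed.

Lemma ct_opp f a : continuous_at a f -> continuous_at a (fun x => - f x).
Proof. exact: cvgN. Qed.

Lemma ct_mul f g a : continuous_at a f -> continuous_at a g ->
  continuous_at a (fun x => f x * g x).
Proof. exact: cvgM. Qed.

Lemma ct_norm f a : continuous_at a f -> continuous_at a (fun x => `|f x|).
Proof. exact: cvg_norm. Qed.

Lemma ct_cst (c : R) a : continuous_at a (fun=> c).
Proof. exact: cvg_cst. Qed.

Lemma ct_id a : continuous_at a (fun x : R => x).
Proof. exact: cvg_id. Qed.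

Lemma ct_comp h f a : continuous h -> continuous_at a f ->
  continuous_at a (fun x => h (f x)).
Proof.
by move=> ch cf; apply: (@continuous_cvg _ _ _ _ _ f h _ (ch (f a)) cf).
Qed.

Lemma ct_sqr f a : continuous_at a f -> continuous_at a (fun x => f x ^+ 2).
Proof. by move=> cf; exact: ct_mul. Qed.

Lemma ct_sum (I : Type) (s : seq I) (P : pred I) (f : I -> R -> R) a :
  (forall i, continuous_at a (f i)) ->
  continuous_at a (fun x => \sum_(i <- s | P i) f i x).
Proof.
move=> fa; elim: s => [|i s IH].
  by under eq_fun do rewrite big_nil; exact: cvg_cst.
under eq_fun do rewrite big_cons.
by case: ifP => _ //; apply: ct_add.
Qed.

Lemma integrable_itv (f : R -> R) (a b : R) :
  continuous f -> mu.-integrable `[a, b] (EFin \o f).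
Proof.
move=> cf; apply: continuous_compact_integrable; first exact: segment_compact.
exact: continuous_subspaceT.
Qed.

Lemma Rintegral_sum d (U : measurableType d) (nu : {measure set U -> \bar R})
    (D : set U) (I : Type) (s : seq I) (f : I -> U -> R) :
  measurable D -> (forall i, nu.-integrable D (EFin \o f i)) ->
  \int[nu]_(x in D) (\sum_(i <- s) f i x) = \sum_(i <- s) \int[nu]_(x in D) f i x.
Proof.
move=> mD fi; rewrite /Rintegral.
under eq_integral do rewrite -sumEFin.
rewrite (integral_sum mD fi) /= -[LHS]/(fine _).
by under eq_bigr do rewrite -(fineK (integrable_fin_num mD (fi _))); rewrite sumEFin.
Qed.

Lemma fine_mu_itv (a b : R) : a <= b -> fine (mu `[a, b]) = b - a.
Proof.
by move=> ab; rewrite lebesgue_measure_itv /= lte_fin; case: ltgtP ab => //= ->; rewrite subrr.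
Qed.

End ContinuityTools.

(** Continuity of expressions built from sums, products, trigonometric
    functions and the continuous functions of the context. *)
Ltac cts_step :=
  lazymatch goal with
  | |- continuous_at _ (fun x => x) => exact: ct_id
  | |- continuous_at _ (fun x => Algebra.add (@?f x) (@?g x)) => apply: (@ct_add _ f g)
  | |- continuous_at _ (fun x => Algebra.opp (@?f x)) => apply: (@ct_opp _ f)
  | |- continuous_at _ (fun x => GRing.mul (@?f x) (@?g x)) => apply: (@ct_mul _ f g)
  | |- continuous_at _ (fun x => cos (@?f x)) => apply: (@ct_comp _ _ f _ (@continuous_cos _))
  | |- continuous_at _ (fun x => sin (@?f x)) => apply: (@ct_comp _ _ f _ (@continuous_sin _))
  | |- continuous_at _ (fun x => expR (@?f x)) => apply: (@ct_comp _ _ f _ (@continuous_expR _))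
  | |- continuous_at _ (fun x => (@?f x) ^+ 2) => apply: (@ct_sqr _ f)
  | |- continuous_at _ (fun x => Num.norm (@?f x)) => apply: (@ct_norm _ f)
  | |- continuous_at _ (fun x => bigop _ _ _) => apply: ct_sum; let i := fresh in move=> i
  | H : continuous ?h |- continuous_at _ (fun x => ?h (@?g x)) => apply: (@ct_comp _ h g _ H)
  | H : forall i, continuous (?h i) |- continuous_at _ (fun x => ?h ?j (@?g x)) =>
       apply: (@ct_comp _ (h j) g _ (H j))
  | |- continuous_at _ _ => exact: ct_cst
  end.
Ltac cts := lazymatch goal with |- continuous_at _ _ => idtac | |- _ => let y := fresh in move=> y end; lazy beta; repeat (cts_step; lazy beta).

(** * The Fejer kernel *)

Section Fejer.
Context {R : realType}.
Notation mu := (@lebesgue_measure R).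
Implicit Types (n : nat) (u x y T : R).

Lemma cos_distn (i j : nat) (a : R) :
  cos (i%:R * a) * cos (j%:R * a) + sin (i%:R * a) * sin (j%:R * a) =
  cos ((ndist i j)%:R * a).
Proof.
rewrite -cosB -mulrBl; case: (leqP j i) => ij.
  by move: (ij); rewrite -subn_eq0 => /eqP ->; rewrite addn0 natrB.
rewrite (_ : (i - j)%N = 0%N) ?add0n; last by apply/eqP; rewrite subn_eq0 ltnW.
by rewrite natrB ?(ltnW ij)// -cosN -mulNr opprB.
Qed.

(** The kernel as a square of a modulus, which makes its positivity evident.
    *)
Definition fejer n u : R := n.+1%:R^-1 *
  ((\sum_(i < n.+1) cos (i%:R * (2 * pi * u))) ^+ 2 +
   (\sum_(i < n.+1) sin (i%:R * (2 * pi * u))) ^+ 2).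

Lemma fejer_ge0 n u : 0 <= fejer n u.
Proof. by rewrite mulr_ge0 ?invr_ge0// addr_ge0// sqr_ge0. Qed.

(** The square of the modulus of a trigonometric polynomial is the Toeplitz
    form of its coefficients. *)
Lemma trig_square_sum (a : nat -> R) n v :
  (\sum_(i < n) a i * cos (i%:R * v)) ^+ 2 +
  (\sum_(i < n) a i * sin (i%:R * v)) ^+ 2 =
  \sum_(i < n) \sum_(j < n) a i * a j * cos ((ndist i j)%:R * v).
Proof.
rewrite !expr2 !big_distrlr /= -big_split /=; apply: eq_bigr => i _.
rewrite -big_split /=; apply: eq_bigr => j _.
by rewrite -cos_distn; ring.
Qed.

Lemma fejerE n u : fejer n u = n.+1%:R^-1 *
  \sum_(i < n.+1) \sum_(j < n.+1) cos ((ndist i j)%:R * (2 * pi * u)).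
Proof.
rewrite /fejer; congr *%R.
have := trig_square_sum (fun=> 1) n.+1 (2 * pi * u).
under eq_bigr do rewrite mul1r.
under [X in _ + X ^+2 = _ -> _]eq_bigr do rewrite mul1r.
move=> ->; apply: eq_bigr => i _; apply: eq_bigr => j _.
by rewrite !mul1r.
Qed.

Lemma periodicDint (f : R -> R) (k : nat) (p : int) (v : R) : periodic f (pi *+ 2) ->
  f (k%:R * (2 * pi * (v + p%:~R))) = f (k%:R * (2 * pi * v)).
Proof.
move=> pf; have per (m : nat) (w : R) : f (w + m%:R * (2 * pi)) = f w.
  by rewrite mulr_natl -(periodicn pf m w) mulr_natl.
case: p => m.
  rewrite -(per (k * m)%N (k%:R * (2 * pi * v))); congr f.
  by rewrite natrM -pmulrn; ring.
rewrite -(per (k * m.+1)%N (k%:R * (2 * pi * (v + _)))); congr f.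
by rewrite natrM NegzE mulrNz -pmulrn; ring.
Qed.

Lemma cosDint (k : nat) (p : int) (v : R) :
  cos (k%:R * (2 * pi * (v + p%:~R))) = cos (k%:R * (2 * pi * v)).
Proof. exact/periodicDint/cosD2pi. Qed.

Lemma sinDint (k : nat) (p : int) (v : R) :
  sin (k%:R * (2 * pi * (v + p%:~R))) = sin (k%:R * (2 * pi * v)).
Proof. exact/periodicDint/sinD2pi. Qed.

Lemma fejerDint n u (p : int) : fejer n (u + p%:~R) = fejer n u.
Proof.
rewrite !fejerE; congr *%R; apply: eq_bigr => i _; apply: eq_bigr => j _.
exact: cosDint.
Qed.

Lemma continuous_fejer n : continuous (fejer n).
Proof. by rewrite /fejer; cts. Qed.

(** Multiplied by the sine of half the step, the sum telescopes. *)
Lemma sum_cos_bound n (v : R) : `|sin v * \sum_(i < n) cos (i%:R * (2 * v))| <= 1.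
Proof.
have -> : sin v * \sum_(i < n) cos (i%:R * (2 * v)) =
    (sin ((2 * n%:R - 1) * v) + sin v) / 2.
  elim: n => [|n IH].
    by rewrite big_ord0 (_ : (2 * 0 - 1) * v = - v) ?sinN; [lra|ring].
  rewrite big_ord_recr /= mulrDr IH.
  have -> : (2 * n.+1%:R - 1) * v = n%:R * (2 * v) + v by rewrite -natr1; ring.
  have -> : (2 * n%:R - 1) * v = n%:R * (2 * v) - v by ring.
  rewrite sinB sinD; lra.
rewrite ler_norml.
have := sin_le1 ((2 * n%:R - 1) * v); have := sin_geN1 ((2 * n%:R - 1) * v).
have := sin_le1 v; have := sin_geN1 v; lra.
Qed.

Lemma sum_sin_bound n (v : R) : `|sin v * \sum_(i < n) sin (i%:R * (2 * v))| <= 1.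
Proof.
have -> : sin v * \sum_(i < n) sin (i%:R * (2 * v)) =
    (cos v - cos ((2 * n%:R - 1) * v)) / 2.
  elim: n => [|n IH].
    by rewrite big_ord0 (_ : (2 * 0 - 1) * v = - v) ?cosN; [lra|ring].
  rewrite big_ord_recr /= mulrDr IH.
  have -> : (2 * n.+1%:R - 1) * v = n%:R * (2 * v) + v by rewrite -natr1; ring.
  have -> : (2 * n%:R - 1) * v = n%:R * (2 * v) - v by ring.
  rewrite cosB cosD; lra.
rewrite ler_norml.
have := cos_le1 ((2 * n%:R - 1) * v); have := cos_geN1 ((2 * n%:R - 1) * v).
have := cos_le1 v; have := cos_geN1 v; lra.
Qed.

(** Away from the integers the kernel is O(1/n) uniformly. *)
Lemma fejer_bound n u : sin (pi * u) ^+ 2 * fejer n u <= 2 * n.+1%:R^-1.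
Proof.
rewrite /fejer mulrCA mulrC ler_pM2r ?invr_gt0// mulrDr -!exprMn.
have sq (z : R) : `|z| <= 1 -> z ^+ 2 <= 1 by move=> /ler_normlP[]; nra.
have /sq := sum_cos_bound n.+1 (pi * u); have /sq := sum_sin_bound n.+1 (pi * u).
rewrite !mulrA => h1 h2.
by rewrite (_ : 2 = 1 + 1 :> R)//; apply: lerD.
Qed.

Lemma integral_cos_period T (k : nat) x : 0 < T ->
  \int[mu]_(y in `[0, T]) cos (k%:R * (2 * pi * ((x - y) / T))) =
  if k == 0%N then T else 0.
Proof.
move=> T0; case: ifPn => [/eqP ->|k0].
  under eq_Rintegral do rewrite mul0r cos0.
  by rewrite Rintegral_cst//= fine_mu_itv ?ltW// subr0 mul1r.
have c0 : k%:R * (2 * pi) / T != 0.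
  by rewrite !mulf_neq0 ?invr_neq0 ?pnatr_eq0 ?(gt_eqF T0)// gt_eqF// pi_gt0.
set c := k%:R * (2 * pi) / T in c0.
pose F y := - c^-1 * sin (k%:R * (2 * pi * ((x - y) / T))).
have dF y : is_derive y 1 F (cos (k%:R * (2 * pi * ((x - y) / T)))).
  apply: is_derive_eq.
  have p0 : pi != 0 :> R by rewrite gt_eqF// pi_gt0.
  rewrite /GRing.scale /= /c; move: (pi) p0 => p p0; field.
  by rewrite gt_eqF// p0 pnatr_eq0.
have FTC : (\int[mu]_(y in `[0%R, T]) (cos (k%:R * (2 * pi * ((x - y) / T))))%:E =
   (F T)%:E - (F 0)%:E)%E.
  apply: continuous_FTC2 => //.
  - by apply: continuous_subspaceT; cts.
  - have cF : continuous F by rewrite /F; cts.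
    split => [y _|  | ]; first by have [] := dF y.
      by apply: cvg_at_right_filter; exact: cF.
    by apply: cvg_at_left_filter; exact: cF.
  - by move=> y _; rewrite derive1E; have [_ ->] := dF y.
rewrite /Rintegral FTC /= /F subr0 (_ : (x - T) / T = x / T + (-1)%:~R); last first.
  by rewrite mulrBl divff ?gt_eqF.
by rewrite sinDint subrr.
Qed.

End Fejer.

(** * Convergence of Fejer means *)

Section FejerLimit.
Context {R : realType}.
Notation mu := (@lebesgue_measure R).
Implicit Types (n : nat) (x y T : R) (h : R -> R).

Lemma continuous_bounded_itv h (a b : R) : a <= b -> continuous h ->
  exists2 M : R, 0 <= M & forall y, y \in `[a, b] -> `|h y| <= M.
Proof.
move=> ab ch.
have [|c _ hc] := @EVT_max R (fun y => `|h y|) a b ab.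
  by apply: continuous_subspaceT; cts.
by exists `|h c|.
Qed.

Lemma integral_fejer n x T : 0 < T ->
  \int[mu]_(y in `[0, T]) fejer n ((x - y) / T) = T.
Proof.
move=> T0.
under eq_Rintegral do rewrite fejerE.
rewrite RintegralZl//; last first.
  by apply: integrable_itv; cts.
rewrite Rintegral_sum//; last first.
  by move=> i; apply: integrable_itv; cts.
under eq_bigr => i _.
  rewrite Rintegral_sum//; last first.
    by move=> j; apply: integrable_itv; cts.
  under eq_bigr => j _ do rewrite integral_cos_period//.
  rewrite (bigD1 i) //= subnn addn0 eqxx big1 ?addr0; last first.
    move=> j ji; case: ifP => //; rewrite addn_eq0 !subn_eq0 -eqn_leq => /eqP ij.
    by move: ji; rewrite -val_eqE /= ij eqxx.
  over.
by rewrite sumr_const card_ord -(mulr_natl T n.+1) mulKf// pnatr_eq0.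
Qed.

(** The sine is increasing up to 1/2 and symmetric around it; this bounds it
    from below on the complement of a neighbourhood of the integers. *)
Lemma sin_sqr_lb (v d : R) : 0 < d -> d <= `|v| -> `|v| <= 1 - d ->
  sin (pi * d) ^+ 2 <= sin (pi * v) ^+ 2.
Proof.
move=> d0 dv vd.
have -> : sin (pi * v) ^+ 2 = sin (pi * `|v|) ^+ 2.
  by case: (ger0P v) => _ //; rewrite mulrN sinN sqrrN.
have p0 := @pi_gt0 R.
have key w : d <= w -> w <= 2^-1 -> sin (pi * d) ^+ 2 <= sin (pi * w) ^+ 2.
  move=> dw w2.
  have d2 : d <= 2^-1 by exact: le_trans w2.
  have sd : 0 <= sin (pi * d) by apply: sin_ge0_pi; nra.
  rewrite ler_sqr ?nnegrE//; last by apply: sin_ge0_pi; nra.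
  rewrite leNgt ltr_sin -?leNgt ?in_itv /=; first by rewrite ler_pM2l.
    apply/andP; split; nra.
  apply/andP; split; nra.
case: (lerP `|v| 2^-1) => v2; first exact: key.
have -> : sin (pi * `|v|) = sin (pi * (1 - `|v|)).
  by rewrite mulrBr mulr1 sinB sinpi cospi; ring.
apply: key; lra.
Qed.

(** The kernel has mean 1 over a period and concentrates at x. Only interior
    points are used, since h need not be periodic and its Fejer means may have
    other limits at 0 and T. *)
Lemma fejer_cvg h x T : 0 < x -> x < T -> continuous h ->
  (fun n => \int[mu]_(y in `[0, T]) (h y * fejer n ((x - y) / T))) @ \oo
    --> T * h x.
Proof.
move=> x0 xT ch; have T0 : 0 < T by exact: lt_trans xT.
have [M M0 hM] : exists2 M : R, 0 <= M & forall y, y \in `[0, T] -> `|h y - h x| <= M.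
  by apply: (@continuous_bounded_itv (fun y => h y - h x)) => //; [exact: ltW|cts].
have cf n : continuous (fun y => fejer n ((x - y) / T)).
  by move=> y; apply: (@ct_comp _ (fejer n) (fun y => (x - y) / T) _ (@continuous_fejer _ n)); cts.
apply/cvgrPdist_le => e e0.
have e2 : 0 < e / (2 * T) by rewrite divr_gt0// mulr_gt0.
have /cvgrPdist_lt /(_ _ e2) /nbhs_ballP [d /= d0 hd] := ch x.
(* The distance from (x - y) / T to the integers is at least this when |x - y|
   >= d and y lies in [0, T]. *)
pose d' := Num.min (d / T) (Num.min (x / T) (1 - x / T)).
have d'0 : 0 < d' by rewrite !lt_min !divr_gt0//= subr_gt0 ltr_pdivrMr// mul1r.
have d'1 : d' <= x / T by rewrite /d' !ge_min lexx orbT.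
have d'2 : d' <= 1 - x / T by rewrite /d' !ge_min lexx !orbT.
have d'3 : d' <= d / T by rewrite /d' !ge_min lexx.
have s0 : 0 < sin (pi * d') ^+ 2.
  rewrite exprn_gt0// sin_gt0_pi//; have := @pi_gt0 R; nra.
pose C := T * (M * (2 / sin (pi * d') ^+ 2)).
have pw n y : y \in `[0, T] -> `|(h y - h x) * fejer n ((x - y) / T)| <=
    e / (2 * T) * fejer n ((x - y) / T) + M * (2 / sin (pi * d') ^+ 2) * n.+1%:R^-1.
  move=> yT; rewrite normrM (ger0_norm (fejer_ge0 _ _)).
  have := hM y yT; move: yT; rewrite in_itv /= => /andP[y0 yT] hyM.
  have f0 := fejer_ge0 n ((x - y) / T).
  have B0 : 0 <= M * (2 / sin (pi * d') ^+ 2) * n.+1%:R^-1.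
    by rewrite divr_ge0// mulr_ge0// divr_ge0// ltW.
  case: (ltP `|x - y| d) => xyd.
    rewrite -[leLHS]addr0; apply: lerD => //; apply: ler_wpM2r => //.
    by rewrite distrC ltW//; apply: hd.
  rewrite -[leLHS]add0r; apply: lerD; first by rewrite mulr_ge0// ltW.
  rewrite -mulrA; apply: ler_pM => //.
  have dv : d' <= `|(x - y) / T|.
    rewrite normrM normfV (gtr0_norm T0); apply: le_trans d'3 _.
    by rewrite ler_pM2r ?invr_gt0.
  have vd : `|(x - y) / T| <= 1 - d'.
    have xT' : x / T * T = x by rewrite divfK ?gt_eqF.
    have Ti : 0 < T^-1 by rewrite invr_gt0.
    have TT : T / T = 1 by rewrite divff ?gt_eqF.
    by rewrite ler_norml mulrBl; apply/andP; split; nra.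
  have := fejer_bound n ((x - y) / T); have := sin_sqr_lb d'0 dv vd => h1 h2.
  rewrite mulrAC ler_pdivlMr// mulrC; apply: le_trans h2.
  exact: ler_wpM2r.
have main n : `|T * h x - \int[mu]_(y in `[0, T]) (h y * fejer n ((x - y) / T))| <=
    e / 2 + C * n.+1%:R^-1.
  have cg : continuous (fun y => (h y - h x) * fejer n ((x - y) / T)) by move=> y; cts; exact: cf.
  have -> : T * h x - \int[mu]_(y in `[0, T]) (h y * fejer n ((x - y) / T)) =
     - \int[mu]_(y in `[0, T]) ((h y - h x) * fejer n ((x - y) / T)).
    under [in RHS]eq_Rintegral do rewrite mulrBl.
    rewrite RintegralB//; last 2 first.
      by apply: (@integrable_itv R (fun y => h y * fejer n ((x - y) / T))); move=> y; cts; exact: cf.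
      by apply: (@integrable_itv R (fun y => h x * fejer n ((x - y) / T))); move=> y; cts; exact: cf.
    rewrite RintegralZl//; last exact: integrable_itv.
    by rewrite integral_fejer// opprB (mulrC T).
  rewrite normrN; apply: le_trans (le_normr_Rintegral _ (integrable_itv _ _ cg)) _ => //.
  have cb : continuous (fun y => e / (2 * T) * fejer n ((x - y) / T)) by move=> y; cts; exact: cf.
  apply: (@le_trans _ _ (\int[mu]_(y in `[0, T]) (e / (2 * T) * fejer n ((x - y) / T) + M * (2 / sin (pi * d') ^+ 2) * n.+1%:R^-1))).
    apply: le_Rintegral => //.
    - by apply: integrable_itv => y; exact: ct_norm.
    - by apply: integrable_itv => y; apply: ct_add; [exact: cb|exact: ct_cst].
    - by move=> y yT; apply: pw.
  rewrite RintegralD//; last 2 first.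
    exact: (integrable_itv _ _ cb).
    by apply: (@integrable_itv R (fun=> M * (2 / sin (pi * d') ^+ 2) * n.+1%:R^-1)); exact: cst_continuous.
  rewrite [X in X + _]RintegralZl//; last exact: (integrable_itv _ _ (cf n)).
  rewrite integral_fejer// Rintegral_cst//= fine_mu_itv ?(ltW T0)// subr0.
  apply: lerD; last by rewrite /C le_eqVlt; apply/orP; left; apply/eqP; ring.
  rewrite le_eqVlt; apply/orP; left; apply/eqP; field; by rewrite gt_eqF.
have : (fun n => C * (n.+1%:R^-1 : R)) @ \oo --> C * 0.
  by apply: cvgM; [exact: cvg_cst|exact: cvg_harmonic].
rewrite mulr0 => /cvgrPdist_le /(_ _ (divr_gt0 e0 (ltr0Sn _ 1))) hC.
near=> n.
apply: le_trans (main n) _.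
rewrite [leRHS](splitr e) lerD2l.
have : `|0 - C * n.+1%:R^-1| <= e / 2 by near: n.
by rewrite sub0r normrN => /(le_trans (ler_norm _)).
Unshelve. all: by end_near.
Qed.

End FejerLimit.

(** * Parseval for continuous functions *)

Section Parseval.
Context {R : realType}.
Notation mu := (@lebesgue_measure R).
Implicit Types (n k : nat) (x y T : R) (h : R -> R).

Lemma integral_fejer_expand (D : set (measurableTypeR R)) h n x T : measurable D ->
  (forall k, mu.-integrable D (EFin \o (fun y => h y * cos (k%:R * (2 * pi * ((x - y) / T)))))) ->
  \int[mu]_(y in D) (h y * fejer n ((x - y) / T)) =
  n.+1%:R^-1 * \sum_(i < n.+1) \sum_(j < n.+1)
    \int[mu]_(y in D) (h y * cos ((ndist i j)%:R * (2 * pi * ((x - y) / T)))).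
Proof.
move=> mD ih.
have E y : h y * fejer n ((x - y) / T) = n.+1%:R^-1 * (\sum_(i < n.+1) \sum_(j < n.+1)
    (h y * cos ((ndist i j)%:R * (2 * pi * ((x - y) / T))))).
  rewrite fejerE mulrCA; congr *%R; rewrite mulr_sumr; apply: eq_bigr => i _.
  by rewrite mulr_sumr.
under eq_Rintegral do rewrite E.
have isum i : mu.-integrable D (EFin \o (fun y => \sum_(j < n.+1)
    (h y * cos ((ndist i j)%:R * (2 * pi * ((x - y) / T)))))).
  rewrite /comp; under eq_fun do rewrite -sumEFin.
  by apply: integrable_sum => // j _; exact: ih.
rewrite RintegralZl//; last first.
  rewrite /comp; under eq_fun do rewrite -sumEFin.
  by apply: integrable_sum => // i _; exact: isum.
congr *%R; rewrite Rintegral_sum//; apply: eq_bigr => i _.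
by rewrite Rintegral_sum.
Qed.

Definition fcos T h k := \int[mu]_(y in `[0, T]) (h y * cos (k%:R * (2 * pi * (y / T)))).
Definition fsin T h k := \int[mu]_(y in `[0, T]) (h y * sin (k%:R * (2 * pi * (y / T)))).

Lemma integral_mul_cosB T h k x : continuous h ->
  \int[mu]_(y in `[0, T]) (h y * cos (k%:R * (2 * pi * ((x - y) / T)))) =
  cos (k%:R * (2 * pi * (x / T))) * fcos T h k +
  sin (k%:R * (2 * pi * (x / T))) * fsin T h k.
Proof.
move=> ch.
have E y : h y * cos (k%:R * (2 * pi * ((x - y) / T))) =
   cos (k%:R * (2 * pi * (x / T))) * (h y * cos (k%:R * (2 * pi * (y / T)))) +
   sin (k%:R * (2 * pi * (x / T))) * (h y * sin (k%:R * (2 * pi * (y / T)))).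
  have -> : k%:R * (2 * pi * ((x - y) / T)) =
     k%:R * (2 * pi * (x / T)) - k%:R * (2 * pi * (y / T)) by ring.
  rewrite cosB; ring.
under eq_Rintegral do rewrite E.
have i1 : mu.-integrable `[0, T] (EFin \o (fun y => h y * cos (k%:R * (2 * pi * (y / T))))).
  by apply: integrable_itv; cts.
have i2 : mu.-integrable `[0, T] (EFin \o (fun y => h y * sin (k%:R * (2 * pi * (y / T))))).
  by apply: integrable_itv; cts.
rewrite RintegralD//; last 2 first.
  apply: integrable_itv; cts.
  apply: integrable_itv; cts.
by rewrite !RintegralZl.
Qed.

Lemma fejer_conv_expand T h n x : continuous h ->
  \int[mu]_(y in `[0, T]) (h y * fejer n ((x - y) / T)) =
  n.+1%:R^-1 * \sum_(i < n.+1) \sum_(j < n.+1)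
   (cos ((ndist i j)%:R * (2 * pi * (x / T))) * fcos T h (ndist i j) +
    sin ((ndist i j)%:R * (2 * pi * (x / T))) * fsin T h (ndist i j)).
Proof.
move=> ch; rewrite integral_fejer_expand//; last first.
  by move=> k; apply: integrable_itv; cts.
congr *%R; apply: eq_bigr => i _; apply: eq_bigr => j _.
exact: integral_mul_cosB.
Qed.

(** Integrating h against its Fejer mean expresses the energy as a Cesaro mean
    of squared Fourier coefficients, by the addition formula for the cosine.
    *)
Lemma fejer_energy T h n : continuous h ->
  \int[mu]_(x in `[0, T]) (h x * \int[mu]_(y in `[0, T]) (h y * fejer n ((x - y) / T))) =
  n.+1%:R^-1 * \sum_(i < n.+1) \sum_(j < n.+1)
   (fcos T h (ndist i j) ^+ 2 + fsin T h (ndist i j) ^+ 2).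
Proof.
move=> ch.
have E x : h x * \int[mu]_(y in `[0, T]) (h y * fejer n ((x - y) / T)) =
  n.+1%:R^-1 * (\sum_(i < n.+1) \sum_(j < n.+1)
   ((h x * cos ((ndist i j)%:R * (2 * pi * (x / T)))) * fcos T h (ndist i j) +
    (h x * sin ((ndist i j)%:R * (2 * pi * (x / T)))) * fsin T h (ndist i j))).
  rewrite fejer_conv_expand// mulrCA; congr *%R; rewrite mulr_sumr; apply: eq_bigr => i _.
  by rewrite mulr_sumr; apply: eq_bigr => j _; rewrite mulrDr !mulrA.
under eq_Rintegral do rewrite E.
rewrite RintegralZl//; last by apply: integrable_itv; cts.
congr *%R; rewrite Rintegral_sum//; last by move=> i; apply: integrable_itv; cts.
apply: eq_bigr => i _; rewrite Rintegral_sum//; last by move=> j; apply: integrable_itv; cts.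
apply: eq_bigr => j _; set k := (_ + _)%N.
have i1 : mu.-integrable `[0, T] (EFin \o (fun y => h y * cos (k%:R * (2 * pi * (y / T))))).
  by apply: integrable_itv; cts.
have i2 : mu.-integrable `[0, T] (EFin \o (fun y => h y * sin (k%:R * (2 * pi * (y / T))))).
  by apply: integrable_itv; cts.
rewrite RintegralD//; last 2 first.
  apply: integrable_itv; cts.
  apply: integrable_itv; cts.
by rewrite !RintegralZr// !expr2.
Qed.

(** The terms are nonnegative, so it suffices to know the limit of their
    Cesaro means; that limit is the integral of h times the limit of its Fejer
    means, computed by dominated convergence. Frequencies run over the
    naturals: hence the halves and the correction at 0. *)
Theorem parseval T h : 0 < T -> continuous h ->
  series (fun k => fcos T h k ^+ 2 + fsin T h k ^+ 2) @ \oo -->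
  (T * \int[mu]_(x in `[0, T]) (h x ^+ 2) + fcos T h 0 ^+ 2 + fsin T h 0 ^+ 2) / 2.
Proof.
move=> T0 ch; rewrite -addrA.
apply: (@toeplitz_mean_inv _ (fun k => fcos T h k ^+ 2 + fsin T h k ^+ 2)).
  by move=> k; rewrite addr_ge0// sqr_ge0.
under eq_fun do rewrite -fejer_energy//.
pose G n x := \int[mu]_(y in `[0, T]) (h y * fejer n ((x - y) / T)).
have cG n : continuous (G n).
  have -> : G n = fun x => n.+1%:R^-1 * \sum_(i < n.+1) \sum_(j < n.+1)
   (cos ((ndist i j)%:R * (2 * pi * (x / T))) * fcos T h (ndist i j) +
    sin ((ndist i j)%:R * (2 * pi * (x / T))) * fsin T h (ndist i j)).
    by apply/funext => x; exact: fejer_conv_expand.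
  cts.
have [M M0 hM] := continuous_bounded_itv (ltW T0) ch.
have GM n x : `|G n x| <= M * T.
  have cf : continuous (fun y => fejer n ((x - y) / T)).
    by move=> y; apply: (@ct_comp _ (fejer n) (fun y => (x - y) / T) _ (@continuous_fejer _ n)); cts.
  have chf : continuous (fun y => h y * fejer n ((x - y) / T)) by move=> y; cts; exact: cf.
  apply: le_trans (le_normr_Rintegral _ (integrable_itv _ _ chf)) _ => //.
  rewrite -[X in _ <= _ * X](integral_fejer n x T0) -RintegralZl//; last exact: (integrable_itv _ _ cf).
  apply: le_Rintegral => //.
  - by apply: integrable_itv => y; exact: ct_norm.
  - by apply: integrable_itv => y; cts; exact: cf.
  - by move=> y yT; rewrite normrM (ger0_norm (fejer_ge0 _ _)) ler_wpM2r ?fejer_ge0//; exact: hM.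
(* The endpoints, where the Fejer means need not converge to T h, are removed.
   *)
have oc (g : R -> R) : continuous g ->
    \int[mu]_(x in `[0, T]) g x = \int[mu]_(x in `]0, T[) g x.
  move=> cg; rewrite -[LHS]Rintegral_itv_obnd_cbnd ?Rintegral_itv_bndo_bndc//.
    by apply: integrableS (integrable_itv 0 T cg) => // z /=; rewrite !in_itv /= => /andP[/ltW -> /ltW ->].
  by apply: integrableS (integrable_itv 0 T cg) => // z /=; rewrite !in_itv /= => /andP[/ltW -> ->].
rewrite -RintegralZl//; last by apply: integrable_itv; cts.
rewrite oc; last by cts.
have chG n : continuous (fun x => h x * G n x) by cts.
have -> : (fun n => \int[mu]_(x in `[0, T]) (h x * \int[mu]_(y in `[0, T]) (h y * fejer n ((x - y) / T)))) =
    (fun n => \int[mu]_(x in `]0, T[) (h x * G n x)).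
  by apply/funext => n; exact: (oc _ (chG n)).
have ioo (g : R -> R) : continuous g -> mu.-integrable `]0, T[ (EFin \o g).
  by move=> cg; apply: integrableS (integrable_itv 0 T cg) => // z /=; rewrite !in_itv /= => /andP[/ltW -> /ltW ->].
have : (\int[mu]_(x in `]0%R, T[) (h x * G n x)%:E)%E @[n --> \oo] -->
       (\int[mu]_(x in `]0%R, T[) (T * h x ^+ 2)%:E)%E.
  apply: (@dominated_cvg _ _ _ mu _ _ _ _ (fun=> (M * (M * T))%:E)) => //.
  - by move=> n; apply/measurable_EFinP/measurable_funTS; exact: continuous_measurable_fun.
  - move=> x /=; rewrite in_itv /= => /andP[x0 xT].
    apply: cvg_EFin; first exact: nearW.
    have := @fejer_cvg R h x T x0 xT ch => H.
    rewrite [X in _ --> X](_ : _ = h x * (T * h x)); last by rewrite expr2; ring.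
    by apply: cvgM; [exact: cvg_cst|exact: H].
  - by apply: (ioo (fun=> M * (M * T))); exact: cst_continuous.
  - move=> n x; rewrite /= in_itv /= => /andP[x0 xT].
    rewrite lee_fin normrM ler_pM//; apply: hM.
    by rewrite in_itv /= !ltW.
rewrite -[X in _ --> X -> _]fineK; first by move/fine_cvg.
have := ioo (fun x => T * h x ^+ 2) => /(_ _)/(integrable_fin_num _) H.
by apply: H => //; cts.
Qed.

End Parseval.

(** * The Fourier transform of a Gaussian *)

Section GaussFourier.
Context {R : realType}.
Notation mu := (@lebesgue_measure R).
Implicit Types (s c w phase x : R).

Definition gauss s x : R := expR (- (pi * s * x ^+ 2)).

Lemma gauss_gt0 s x : 0 < gauss s x. Proof. exact: expR_gt0. Qed.

Lemma gauss_ge0 s x : 0 <= gauss s x. Proof. exact: expR_ge0. Qed.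

Lemma gaussN s x : gauss s (- x) = gauss s x. Proof. by rewrite /gauss sqrrN. Qed.

Lemma continuous_gauss s : continuous (gauss s).
Proof. by rewrite /gauss; cts. Qed.

Lemma gaussE s c x : 0 < s ->
  gauss s (x - c) = (Num.sqrt s)^-1 * normal_pdf c (Num.sqrt (2 * pi * s)^-1) x.
Proof.
move=> s0; have p0 := @pi_gt0 R.
have ps0 : 0 < (2 * pi * s)^-1 by rewrite invr_gt0 !mulr_gt0.
rewrite /normal_pdf ifF; last by rewrite gt_eqF ?sqrtr_gt0.
rewrite /normal_peak /normal_fun.
rewrite sqr_sqrtr ?ltW// /gauss.
have -> : (2 * pi * s)^-1 * pi *+ 2 = s^-1 
  by rewrite mulr2n; move: (pi) p0 => p p0; field; rewrite !gt_eqF.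
rewrite sqrtrV ?ltW// invrK mulrA mulVf ?mul1r ?gt_eqF ?sqrtr_gt0//.
congr expR; rewrite mulr2n mulNr; congr (- _); move: (pi) p0 => p p0; field.
by rewrite !gt_eqF.
Qed.

Lemma integrable_gauss s c : 0 < s ->
  mu.-integrable setT (EFin \o (fun x => gauss s (x - c))).
Proof.
move=> s0; have p0 := @pi_gt0 R.
rewrite (_ : _ \o _ = fun x => ((Num.sqrt s)^-1)%:E * (normal_pdf c (Num.sqrt (2 * pi * s)^-1) x)%:E)%E.
  by apply: integrableZl => //; exact: integrable_normal_pdf.
by apply/funext => x /=; rewrite gaussE.
Qed.

Lemma integral_gauss s c : 0 < s ->
  \int[mu]_x gauss s (x - c) = (Num.sqrt s)^-1.
Proof.
move=> s0; have p0 := @pi_gt0 R.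
under eq_Rintegral do rewrite gaussE//.
rewrite RintegralZl//; last exact: integrable_normal_pdf.
by rewrite /Rintegral integral_normal_pdf ?mulr1// gt_eqF// sqrtr_gt0 invr_gt0 !mulr_gt0.
Qed.

Lemma norm_mul_gauss s x : 0 < s -> `|x| * gauss s x <= (1 + 2 / (pi * s)) * gauss (s / 2) x.
Proof.
move=> s0; have p0 := @pi_gt0 R.
have -> : gauss s x = gauss (s / 2) x * gauss (s / 2) x.
  by rewrite /gauss -expRD; congr expR; lra.
rewrite mulrA ler_pM2r ?gauss_gt0// /gauss expRN ler_pdivrMr ?expR_gt0//.
set a := pi * (s / 2) * x ^+ 2.
have a1 : 1 + a <= expR a by exact: expR_ge1Dx.
have C1 : 0 <= 1 + 2 / (pi * s) by rewrite addr_ge0// divr_ge0// ltW// mulr_gt0.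
apply: le_trans (ler_wpM2l C1 a1).
have -> : (1 + 2 / (pi * s)) * (1 + a) = 1 + x ^+ 2 + (2 / (pi * s) + a).
  by rewrite /a; move: (pi) p0 => p p0; field; rewrite !gt_eqF.
have b0 : 0 <= 2 / (pi * s) + a.
  apply: addr_ge0; first by rewrite divr_ge0// ltW// mulr_gt0.
  by apply: mulr_ge0 (sqr_ge0 _); rewrite mulr_ge0 ?divr_ge0 ?(ltW s0) ?(ltW p0).
have x2 : `|x| ^+ 2 = x ^+ 2 by rewrite real_normK ?num_real.
have := normr_ge0 x; nra.
Qed.

Lemma integrable_gauss_le s c (f : R -> R) (C : R) : 0 < s -> continuous f ->
  (forall x, `|f x| <= C * gauss s (x - c)) -> mu.-integrable setT (EFin \o f).
Proof.
move=> s0 cf fC.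
have H : mu.-integrable setT (EFin \o (fun x => C * gauss s (x - c))).
  rewrite (_ : _ \o _ = fun x => (C%:E * (gauss s (x - c))%:E)%E)//.
  by apply: integrableZl => //; exact: integrable_gauss.
apply: le_integrable H => //.
  by apply/measurable_EFinP; exact: continuous_measurable_fun.
by move=> x _ /=; rewrite lee_fin (le_trans (fC x))// ler_norm.
Qed.

Lemma gauss_le_half s x : 0 < s -> gauss s x <= gauss (s / 2) x.
Proof.
move=> s0; rewrite ler_expR lerN2; have := @pi_gt0 R; have := sqr_ge0 x.
move: (x ^+ 2) (pi) => y p y0 p0; have := mulr_ge0 (ltW p0) (mulr_ge0 (ltW s0) y0); nra.
Qed.

Lemma gauss_le_exp s c (b : bool) : 0 < s ->
  \forall n \near \oo, gauss s ((-1) ^+ b * n.+1%:R - c) <= expR (- n%:R).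
Proof.
move=> s0; have p0 := @pi_gt0 R; near=> n.
rewrite ler_expR lerN2.
have n1 : 2 * `|c| < n%:R by near: n; exact: nbhs_infty_gtr.
have n2 : 4 / (pi * s) < n%:R by near: n; exact: nbhs_infty_gtr.
have nn : n.+1%:R = n%:R + 1 :> R by rewrite natr1.
have n0 : 0 <= n%:R :> R by [].
have ps : 0 < pi * s by exact: mulr_gt0.
have h1 : 4 < n%:R * (pi * s) by rewrite -ltr_pdivrMr.
have h2 : n%:R / 2 <= `|(-1) ^+ b * n.+1%:R - c|.
  apply: le_trans (lerB_normD _ _); rewrite normrN normrM normr_sign mul1r ger0_norm//; lra.
have h3 : (n%:R / 2) ^+ 2 <= ((-1) ^+ b * n.+1%:R - c) ^+ 2.
  by rewrite -[leRHS]real_normK ?num_real// ler_sqr ?nnegrE// divr_ge0.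
apply: le_trans (ler_wpM2l (ltW ps) h3); nra.
Unshelve. all: by end_near.
Qed.

(** The fundamental theorem of calculus on [-n, n]; the boundary terms vanish
    as n grows. *)
Lemma integral_derive_gauss (f f' : R -> R) s C C' c : 0 < s ->
  (forall x, is_derive x 1 f (f' x)) -> continuous f' ->
  (forall x, `|f' x| <= C' * gauss s (x - c)) -> (forall x, `|f x| <= C * gauss s (x - c)) ->
  \int[mu]_x f' x = 0.
Proof.
move=> s0 df cf' f'C fC.
have if' := integrable_gauss_le s0 cf' f'C.
have cf : continuous f.
  by move=> x; apply/differentiable_continuous/derivable1_diffP; have [] := df x.
have C0 : 0 <= C.
  by rewrite -(pmulr_lge0 _ (gauss_gt0 s (0 - c))); exact: le_trans (fC 0).
have FTC n : (\int[mu]_(x in `[(- n.+1%:R)%R, n.+1%:R]) (f' x)%:E = (f n.+1%:R)%:E - (f (- n.+1%:R))%:E)%E.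
  apply: continuous_FTC2.
  - by rewrite (@lt_trans _ _ 0)// ?oppr_lt0.
  - exact: continuous_subspaceT.
  - split => [y _|  | ]; first by have [] := df y.
      by apply: cvg_at_right_filter; exact: cf.
    by apply: cvg_at_left_filter; exact: cf.
  - by move=> y _; rewrite derive1E; have [_ ->] := df y.
have L1 : (\int[mu]_x ((f' \_ `[(- n.+1%:R)%R, n.+1%:R]) x)%:E)%E @[n --> \oo] --> (\int[mu]_x (f' x)%:E)%E.
  apply: (@dominated_cvg _ _ _ mu setT _ _ _ (fun x => `|f' x|%:E)) => //.
  - move=> n; apply/measurable_EFinP; apply/(measurable_restrictT _ _).1 => //.
    by apply: measurable_funTS; exact: continuous_measurable_fun.
  - move=> x _; apply: cvg_near_cst; near=> n.
    rewrite patchE mem_set//= in_itv /= -ler_norml.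
    have : `|x| < n%:R by near: n; exact: nbhs_infty_gtr.
    by move=> /ltW/le_trans; apply; rewrite ler_nat.
  - by apply: integrable_abse if'.
  - by move=> n x _; rewrite lee_fin patchE; case: ifPn => //; rewrite normr0.
have L2 (b : bool) : f ((-1) ^+ b * n.+1%:R) @[n --> \oo] --> 0.
  apply: norm_cvg0.
  have H : (fun n : nat => C * expR (- n%:R)) @ \oo --> C * 0.
    by apply: cvgM; [exact: cvg_cst|exact: cvgn_expR].
  rewrite mulr0 in H.
  apply: (@squeeze_cvgr _ _ _ _ (cst 0) (fun n : nat => C * expR (- n%:R))) => //; last exact: cvg_cst.
  near=> n; rewrite normr_ge0 /=; apply: le_trans (fC _) _.
  by apply: ler_wpM2l => //; near: n; exact: gauss_le_exp.
have L3 : ((f n.+1%:R)%:E - (f (- n.+1%:R))%:E)%E @[n --> \oo] --> (0%:E : \bar R).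
  have := cvgB (L2 false) (L2 true); rewrite subr0 => L.
  under eq_fun do rewrite -EFinB.
  apply: cvg_EFin; first exact: nearW.
  move: L; rewrite /=.
  suff -> : (fun n : nat => f ((-1) ^+ 0 * n.+1%:R)) - (fun n : nat => f ((-1) ^+ 1 * n.+1%:R)) =
    (fine \o (fun x : nat => (f x.+1%:R - f (- x.+1%:R))%:E)) by apply.
  by apply/funext => n; rewrite /= [LHS]/(_ - _) expr0 expr1 mul1r mulN1r.
have L4 : (fun n => \int[mu]_x ((f' \_ `[(- n.+1%:R)%R, n.+1%:R]) x)%:E)%E =
          (fun n => (f n.+1%:R)%:E - (f (- n.+1%:R))%:E)%E.
  apply/funext => n; rewrite -FTC [RHS]integral_mkcond; apply: eq_integral => x _.
  by rewrite !patchE; case: ifP.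
rewrite L4 in L1.
by rewrite /Rintegral; have -> := cvg_unique _ L1 L3.
Unshelve. all: by end_near.
Qed.

Section ft.
Variables (s c phase : R).
Hypothesis s0 : 0 < s.

Let f w x := gauss s (x - c) * cos (2 * pi * w * (x - c) + phase).
Let g w x := gauss s (x - c) * sin (2 * pi * w * (x - c) + phase).
Let J w := \int[mu]_x f w x.
Let d w x := - (2 * pi * (x - c)) * g w x.

Let cf w : continuous (f w).
Proof. by rewrite /f /gauss; cts. Qed.
Let cg w : continuous (g w).
Proof. by rewrite /g /gauss; cts. Qed.
Let cd w : continuous (d w).
Proof. by rewrite /d /g /gauss; cts. Qed.

Let f_le w x : `|f w x| <= 1 * gauss s (x - c).
Proof.
by rewrite /f /g normrM mulrC (ger0_norm (gauss_ge0 _ _)) ler_wpM2r ?gauss_ge0 ?cos_max.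
Qed.
Let g_le w x : `|g w x| <= 1 * gauss s (x - c).
Proof.
by rewrite /f /g normrM mulrC (ger0_norm (gauss_ge0 _ _)) ler_wpM2r ?gauss_ge0 ?sin_max.
Qed.

Let K := 2 * pi * (1 + 2 / (pi * s)).

Let d_le w x : `|d w x| <= K * gauss (s / 2) (x - c).
Proof.
have p0 := @pi_gt0 R.
rewrite normrM normrN normrM ger0_norm ?mulr_ge0 ?(ltW p0)//.
rewrite -mulrA /K -[leRHS]mulrA ler_pM2l ?mulr_gt0//.
apply: le_trans (norm_mul_gauss (x - c) s0); rewrite ler_wpM2l//.
by have := g_le w x; rewrite mul1r.
Qed.

Let s20 : 0 < s / 2. Proof. by rewrite divr_gt0. Qed.

Let df w x : is_derive w 1 (f ^~ x) (d w x).
Proof.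
rewrite /f /d /g.
apply: is_derive_eq.
by rewrite /GRing.scale /=; ring.
Qed.

Let dJ w : is_derive w 1 J (\int[mu]_x d w x).
Proof.
have H := @differentiation_under_integral R _ _ mu f setT measurableT w (w - 1) (w + 1).
have H' := @derivable_under_integral R _ _ mu f setT measurableT w (w - 1) (w + 1).
have Iw : (`](w - 1), (w + 1)[%classic) w by rewrite /= in_itv /= ltrBlDr ltrDl ltr01.
have if_ x : mu.-integrable setT (EFin \o f x).
  exact: (integrable_gauss_le s0 (@cf x) (@f_le x)).
have iG : mu.-integrable setT (EFin \o (fun x => K * gauss (s / 2) (x - c))).
  rewrite (_ : _ \o _ = fun x => (K%:E * (gauss (s / 2) (x - c))%:E)%E)//.
  by apply: integrableZl => //; exact: integrable_gauss.
have K0 : 0 <= K by have p0 := @pi_gt0 R; rewrite mulr_ge0 ?addr_ge0 ?divr_ge0 ?mulr_ge0 ?ltW.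
have d1E x y : partial1of2 f x y = d x y.
  by rewrite /partial1of2 derive1E; have [_ ->] := df x y.
have e1 : forall x y : R, (`](w - 1), (w + 1)[%classic) x -> setT y -> derivable (f ^~ y) x 1.
  by move=> x y _ _; have [] := df x y.
have e2 : forall x y : R, (`](w - 1), (w + 1)[%classic) x -> setT y -> `|partial1of2 f x y| <= K * gauss (s / 2) (y - c).
  by move=> x y _ _; rewrite d1E.
have e3 : forall y, 0 <= K * gauss (s / 2) (y - c) by move=> y; rewrite mulr_ge0// gauss_ge0.
split; first exact: (H' Iw (fun x _ => if_ x) e1 _ e3 iG e2).
rewrite -derive1E (H Iw (fun x _ => if_ x) e1 _ e3 iG e2).
by apply: eq_Rintegral => x _; rewrite d1E.
Qed.

Let dg w x : is_derive x 1 (g w) (s * d w x + 2 * pi * w * f w x).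
Proof.
rewrite /f /d /g /gauss.
apply: is_derive_eq.
by rewrite /GRing.scale /=; ring.
Qed.

Let ode w : \int[mu]_x d w x = - (2 * pi * w / s) * J w.
Proof.
have id : mu.-integrable setT (EFin \o d w) by exact: (integrable_gauss_le s20 (@cd w) (@d_le w)).
have if_ : mu.-integrable setT (EFin \o f w) by exact: (integrable_gauss_le s0 (@cf w) (@f_le w)).
have := @integral_derive_gauss (g w) (fun x => s * d w x + 2 * pi * w * f w x) (s / 2)
  1 (s * K + `|2 * pi * w|) c s20 (dg w) _ _ _.
have -> : \int[mu]_x (s * d w x + 2 * pi * w * f w x) = s * \int[mu]_x d w x + 2 * pi * w * J w.
  rewrite RintegralD//=; last 2 first.
    by rewrite /comp; under eq_fun do rewrite EFinM; exact: integrableZl.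
    by rewrite /comp; under eq_fun do rewrite EFinM; exact: integrableZl.
  by rewrite !RintegralZl.
move=> H; have : s * \int[mu]_x d w x + 2 * pi * w * J w = 0.
  apply: H.
  - move=> x; apply: ct_add; apply: ct_mul; try exact: ct_cst; [exact: cd|exact: cf].
  - move=> x; apply: le_trans (ler_normD _ _) _; rewrite [leRHS]mulrDl; apply: lerD; first by rewrite normrM (gtr0_norm s0) -mulrA ler_pM2l.
    rewrite [leLHS]normrM ler_wpM2l//; apply: le_trans (f_le w x) _.
    by rewrite mul1r gauss_le_half.
  - by move=> x; apply: le_trans (g_le w x) _; rewrite !mul1r gauss_le_half.
move=> E; apply: (mulfI (lt0r_neq0 s0)).
move: E => /eqP; rewrite addr_eq0 => /eqP ->.
by field; exact: lt0r_neq0.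
Qed.

(** As a function of w the integral satisfies J' = - (2 pi w / s) J, by
    differentiation under the integral and integration by parts. The centre
    and the phase encode translations of the Gaussian and the choice between
    sine and cosine. *)
Lemma gauss_ft w : \int[mu]_x (gauss s (x - c) * cos (2 * pi * w * (x - c) + phase)) =
  cos phase * ((Num.sqrt s)^-1 * gauss s^-1 w).
Proof.
pose H w := J w * expR (pi / s * w ^+ 2).
have dH x : is_derive x 1 H 0.
  have := dJ x; rewrite ode => dJx.
  rewrite /H; apply: is_derive_eq.
  by rewrite /GRing.scale /=; ring.
have := is_derive_0_is_cst w 0 dH.
rewrite /H expr0n /= mulr0 expR0 mulr1 => HH.
have J0 : J 0 = cos phase * (Num.sqrt s)^-1.
  rewrite /J /f.
  under eq_Rintegral do rewrite mulr0 mul0r add0r mulrC.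
  by rewrite RintegralZl ?integral_gauss//; exact: integrable_gauss.
rewrite mulrA -J0 -HH -[RHS]mulrA /gauss -expRD.
have -> : pi / s * w ^+ 2 + - (pi * s^-1 * w ^+ 2) = 0 by ring.
by rewrite expR0 mulr1.
Qed.

End ft.
End GaussFourier.

(** * Dominated series and sums over the integers *)

Section SeriesTools.
Context {R : realType}.
Notation mu := (@lebesgue_measure R).
Implicit Types a M : R ^nat.

Lemma dominated_series_cvg a M : (forall k, `|a k| <= M k) ->
  cvgn (series M) -> cvgn (series a).
Proof.
move=> aM cM; apply: normed_cvg; apply: series_le_cvg cM => k /=; [exact: normr_ge0|exact: le_trans (aM k)|exact: aM].
Qed.

Lemma series_tail a M N : (forall k, `|a k| <= M k) -> cvgn (series M) ->
  `|limn (series a) - series a N| <= limn (series M) - series M N.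
Proof.
move=> aM cM; have ca := dominated_series_cvg aM cM.
have ndM : nondecreasing_seq (series M).
  by apply: nondecreasing_series => k _ _; exact: le_trans (aM k).
have H : (fun n => `|series a n - series a N|) @ \oo --> `|limn (series a) - series a N|.
  by apply: cvg_norm; apply: cvgB => //; exact: cvg_cst.
apply: (cvgr_to_le H); near=> n.
have Nn : (N <= n)%N by near: n; exact: nbhs_infty_ge.
apply: (@le_trans _ _ (series M n - series M N)); last first.
  by rewrite lerD2r; exact: nondecreasing_cvgn_le.
rewrite !sub_series_geq//; apply: le_trans (ler_norm_sum _ _ _) _.
exact: ler_sum.
Unshelve. all: by end_near.
Qed.

(** Dominated convergence for series, along an arbitrary filter. *)
Lemma tannery (T : Type) (F : set_system T) (FF : ProperFilter F)
   (u : nat -> T -> R) (l : R ^nat) M :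
  (forall k, u k @ F --> l k) -> (\forall x \near F, forall k, `|u k x| <= M k) ->
  cvgn (series M) ->
  (fun x => limn (series (fun k => u k x))) @ F --> limn (series l).
Proof.
move=> ul uM cM.
have lM k : `|l k| <= M k.
  have H : (fun x => `|u k x|) @ F --> `|l k| by exact: cvg_norm.
  by apply: (cvgr_to_le H); apply: filterS uM => x; apply.
apply/cvgrPdist_le => e e0.
have e3 : 0 < e / 3 by rewrite divr_gt0.
have [N HN] : exists N, limn (series M) - series M N <= e / 3.
  have /cvgrPdist_le /(_ _ e3) [N _ HN] := cM.
  by exists N; apply: le_trans (HN N (leqnn N)); exact: ler_norm.
have /cvgrPdist_le /(_ _ e3) HS : (fun x => series (fun k => u k x) N) @ F --> series l N.
  rewrite /series /=; elim: N {HN} => [|N IH].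
    rewrite big_geq//; under eq_fun do rewrite big_geq//; exact: cvg_cst.
  rewrite big_nat_recr//=; under eq_fun do rewrite big_nat_recr//=.
  exact: cvgD.
near=> x.
have h1 := series_tail N lM cM.
have h2 : `|limn (series (fun k => u k x)) - series (fun k => u k x) N| <=
    limn (series M) - series M N.
  by apply: series_tail => //; near: x.
have h3 : `|series l N - series (fun k => u k x) N| <= e / 3 by near: x.
rewrite (_ : _ - _ = (limn (series l) - series l N) +
  (series l N - series (fun k => u k x) N) -
  (limn (series (fun k => u k x)) - series (fun k => u k x) N)); last by ring.
apply: le_trans (ler_normB _ _) _.
apply: le_trans (lerD (ler_normD _ _) (lexx _)) _.
lra.
Unshelve. all: by end_near.
Qed.

Lemma nneseries_cvg_series a (l : R) : (forall n, 0 <= a n) ->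
  (\sum_(n <oo) (a n)%:E = l%:E)%E -> series a @ \oo --> l.
Proof.
move=> a0 al.
have : (fun n => \sum_(0 <= i < n) (a i)%:E)%E @ \oo --> l%:E.
  by rewrite -al; apply: is_cvg_nneseries => n _ _; rewrite lee_fin.
move/fine_cvg.
suff -> : fine \o (fun n => \sum_(0 <= i < n) (a i)%:E)%E = series a by apply.
by apply/funext => n; rewrite /= sumEFin.
Qed.

Lemma series_nneseries a (l : R) : (forall n, 0 <= a n) -> series a @ \oo --> l ->
  (\sum_(n <oo) (a n)%:E = l%:E)%E.
Proof.
move=> a0 al; apply/cvg_lim => //.
under eq_fun do rewrite sumEFin.
by apply: cvg_EFin; [exact: nearW|exact: al].
Qed.

(** Enumerates 0, -1, 1, -2, 2 and so on: the partial sums of odd length 2 n +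
    1 range over the integers from - n to n. *)
Definition zenum (n : nat) : int := if odd n then Negz n./2 else Posz n./2.

Lemma zenum_bij : set_bij [set: nat] [set: int] zenum.
Proof.
split=> //.
  move=> m n _ _; rewrite /zenum; case: ifPn => om; case: ifPn => on // [] h.
    by rewrite -[m]odd_double_half -[n]odd_double_half h om on.
  by rewrite -[m]odd_double_half -[n]odd_double_half h (negbTE om) (negbTE on).
move=> [m|m] _; [exists m.*2|exists m.*2.+1] => //.
  by rewrite /zenum odd_double doubleK.
by rewrite /zenum /= odd_double /= uphalf_double.
Qed.

Lemma zenum_inj : injective zenum.
Proof. by move=> m n; have [_ _ H] := zenum_bij; apply: (let: And3 _ i _ := zenum_bij in i); rewrite inE. Qed.

Lemma zenum_surj p : exists n, zenum n = p.
Proof. by have [_ _ /(_ p I)[n _ <-]] := zenum_bij; exists n. Qed.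

Lemma zenum_ge n : n%:R <= 2 * `|(zenum n)%:~R| :> R.
Proof.
rewrite -intr_norm /zenum -{1}[n]odd_double_half; case: ifPn => o.
  rewrite (_ : `|Negz n./2| = n./2.+1%:Z)// -pmulrn -natr1.
  by rewrite add1n -natr1 -muln2 natrM; lra.
by rewrite (_ : `|Posz n./2| = n./2%:Z)// -pmulrn add0n -muln2 natrM mulrC.
Qed.

Lemma integral_itv_shift (F : R -> R) (c a b : R) : a <= b -> continuous F ->
  (\int[mu]_(x in `[(a + c)%R, (b + c)%R]) (F x)%:E = \int[mu]_(x in `[a, b]) (F (x + c))%:E)%E.
Proof.
move=> ab cF.
have d1 : (fun x : R => x + c)^`()%classic = fun=> 1.
  apply/funext => x; rewrite derive1E.
  have [_ ->] // : is_derive x (1 : R) (fun x : R => x + c) 1.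
  by apply: is_derive_eq; rewrite addr0.
have theta : continuous (fun x : R => x + c) by cts.
rewrite (@integration_by_substitution_increasing _ (fun x => x + c) F a b)//.
- by apply: eq_integral => x _; rewrite d1 /= mulr1.
- by move=> x y _ _; rewrite ltrD2r.
- by rewrite d1 => x _; exact: cvg_cst.
- by rewrite d1; exact: is_cvg_cst.
- by rewrite d1; exact: is_cvg_cst.
- split => [y _|  | ]; first exact: derivableD.
    by apply: cvg_at_right_filter; exact: theta.
  by apply: cvg_at_left_filter; exact: theta.
- exact: continuous_subspaceT.
Qed.

Lemma integral_unfold (F : R -> R) : continuous F -> (forall x, 0 <= F x) ->
  (\int[mu]_x (F x)%:E = \sum_(n <oo) \int[mu]_(x in `[0%R, 1%R]) (F (x + (zenum n)%:~R))%:E)%E.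
Proof.
move=> cF F0.
have mF D : measurable_fun D (EFin \o F).
  by apply/measurable_EFinP/measurable_funTS; exact: continuous_measurable_fun.
pose I n := `[(zenum n)%:~R, (zenum n + 1)%:~R[%classic : set R.
have HT : setT = \bigcup_n I n.
  apply/esym/seteqP; split=> // x _.
  have [n zn] := zenum_surj (Num.floor x); exists n => //.
  by rewrite /I /= in_itv /= zn floor_itv.
rewrite [LHS](_ : _ = \int[mu]_(x in \bigcup_n I n) (F x)%:E)%E; last by rewrite -HT.
rewrite ge0_integral_bigcup//=; first last.
- apply/trivIsetP => m n _ _ mn; rewrite -subset0 => x [].
  rewrite /I /= !in_itv /= => /floor_def h1 /floor_def h2.
  by move/eqP: mn; apply; apply: zenum_inj; rewrite -h1 -h2.
- by move=> x _; rewrite lee_fin.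
- exact: mF.
- by move=> k; exact: measurable_itv.
apply: eq_eseriesr => n _.
rewrite /I integral_itv_bndo_bndc//.
rewrite -(integral_itv_shift (zenum n)%:~R ler01 cF) add0r.
by rewrite intrD addrC.
Qed.

End SeriesTools.

(** * Poisson summation for Gaussians *)

Section Poisson.
Context {R : realType}.
Notation mu := (@lebesgue_measure R).
Implicit Types (s c t x : R).

(** The ratio of a geometric series that dominates all Gaussian sums below;
    the factor 4 absorbs that [zenum] n is only of size n / 2. *)
Definition gratio s : R := expR (- (pi * s / 4)).

Lemma gratio_gt0 s : 0 < gratio s. Proof. exact: expR_gt0. Qed.

Lemma gratio_lt1 s : 0 < s -> gratio s < 1.
Proof.
move=> s0; rewrite /gratio expRN invf_lt1 ?expR_gt0// expR_gt1.
by rewrite divr_gt0// mulr_gt0// pi_gt0.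
Qed.

Lemma cvg_series_gratio s (B : R) : 0 < s -> cvgn (series (fun n => B * gratio s ^+ n)).
Proof.
move=> s0; apply: (@is_cvg_geometric_series R B (gratio s)).
by rewrite ger0_norm ?gratio_lt1// ltW// gratio_gt0.
Qed.

Lemma gauss_zenum_le s x n : 0 < s ->
  gauss s (x + (zenum n)%:~R) <= expR (pi * s * x ^+ 2) * gratio s ^+ n.
Proof.
move=> s0; rewrite -expRM_natl -expRD ler_expR.
have p0 := @pi_gt0 R.
have h1 := @zenum_ge R n.
have h2 : `|(zenum n)%:~R| <= (zenum n)%:~R ^+ 2 :> R.
  rewrite -[leRHS]real_normK ?num_real// -intr_norm.
  case: `|zenum n| (normr_ge0 (zenum n)) => // m _; case: m => [|m]; first by rewrite expr2 mulr0.
  by rewrite expr2 ler_pMr ?ltr0z// -[1]/(1%:~R) ler_int.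
have h3 : 0 <= (2 * x + (zenum n)%:~R) ^+ 2 by exact: sqr_ge0.
move: (zenum n)%:~R h1 h2 h3 => z h1 h2 h3.
have : n%:R / 4 - x ^+ 2 <= (x + z) ^+ 2 by nra.
move/(ler_wpM2l (ltW (mulr_gt0 p0 s0))).
move: (pi) => p; lra.
Qed.

Lemma gauss_nat_le s (k : nat) : 0 < s -> gauss s k%:R <= gratio s ^+ k.
Proof.
move=> s0; rewrite /gauss /gratio -expRM_natl ler_expR mulrN lerN2.
have p0 := @pi_gt0 R.
have -> : k%:R * (pi * s / 4) = pi * s * (k%:R / 4) by ring.
rewrite ler_pM2l ?mulr_gt0//.
case: k => [|k]; first by rewrite mul0r sqr_ge0.
have : 1 <= k.+1%:R :> R by rewrite ler1n.
nra.
Qed.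

Definition gsum s x : R := limn (series (fun n => gauss s (x + (zenum n)%:~R))).

Lemma gsum_cvg s x : 0 < s -> series (fun n => gauss s (x + (zenum n)%:~R)) @ \oo --> gsum s x.
Proof.
move=> s0; apply: (@dominated_series_cvg _ _ (fun n => expR (pi * s * x ^+ 2) * gratio s ^+ n)).
  by move=> k; rewrite ger0_norm ?gauss_ge0// gauss_zenum_le.
exact: cvg_series_gratio.
Qed.

(** The series over the integers, folded onto the naturals by parity; the
    constant term is counted twice by the factor 2. *)
Definition theta s x : R := 2 * limn (series (fun k => gauss s k%:R * cos (k%:R * (2 * pi * x)))) - 1.

Lemma theta_term_le s x (k : nat) : 0 < s ->
  `|gauss s k%:R * cos (k%:R * (2 * pi * x))| <= 1 * gratio s ^+ k.
Proof.
move=> s0; rewrite normrM ger0_norm ?gauss_ge0// mulrC.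
by rewrite ler_pM ?gauss_ge0 ?cos_max ?gauss_nat_le.
Qed.

Lemma theta_cvg s x : 0 < s ->
  series (fun k => gauss s k%:R * cos (k%:R * (2 * pi * x))) @ \oo --> (theta s x + 1) / 2.
Proof.
move=> s0; have -> : (theta s x + 1) / 2 = limn (series (fun k => gauss s k%:R * cos (k%:R * (2 * pi * x)))).
  by rewrite /theta; lra.
apply: (@dominated_series_cvg _ _ (fun n => 1 * gratio s ^+ n)).
  by move=> k; exact: theta_term_le.
exact: cvg_series_gratio.
Qed.

(** Integrate the Gaussian against the Fejer kernel centred at 1/2. Over the
    line, [gauss_ft] turns the kernel into Cesaro means of the right-hand
    side; unfolded to one period, each translate converges by [fejer_cvg] and
    the sum by [tannery]. The centre c moves the point 1/2 to t, so that the
    convergence is only needed at an interior point. *)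
Theorem poisson s t : 0 < s -> gsum s t = (Num.sqrt s)^-1 * theta s^-1 t.
Proof.
(* The Gaussian is centred at c so that its value at 1/2 is the value at t of
   the centred one. *)
move=> s0; pose c := 2^-1 - t.
have si0 : 0 < s^-1 by rewrite invr_gt0.
pose K n y : R := fejer n ((2^-1 - y) / 1).
have cK n : continuous (K n).
  by move=> y; apply: (@ct_comp _ (fejer n) (fun y => (2^-1 - y) / 1) _ (@continuous_fejer _ n)); cts.
have K0 n y : 0 <= K n y by exact: fejer_ge0.
pose F n y := gauss s (y - c) * K n y.
have cgc : continuous (fun y => gauss s (y - c)) by rewrite /gauss; cts.
have cF n : continuous (F n) by move=> y; apply: ct_mul; [exact: cgc|exact: cK].
have F0 n y : 0 <= F n y by rewrite mulr_ge0 ?gauss_ge0.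
have icos k : mu.-integrable setT (EFin \o (fun y => gauss s (y - c) * cos (k%:R * (2 * pi * ((2^-1 - y) / 1))))).
  apply: (@integrable_gauss_le _ s c _ 1 s0).
    by rewrite /gauss; cts.
  move=> y; rewrite normrM ger0_norm ?gauss_ge0// mulrC.
  by rewrite ler_wpM2r ?gauss_ge0// cos_max.
pose d k := gauss s^-1 k%:R * cos (k%:R * (2 * pi * t)).
have EL n : \int[mu]_y F n y = (Num.sqrt s)^-1 *
   (n.+1%:R^-1 * \sum_(i < n.+1) \sum_(j < n.+1) d (ndist i j)).
  rewrite /F integral_fejer_expand// mulrCA; congr *%R.
  rewrite mulr_sumr; apply: eq_bigr => i _; rewrite mulr_sumr; apply: eq_bigr => j _.
  set k := (_ + _)%N.
  have E y : gauss s (y - c) * cos (k%:R * (2 * pi * ((2^-1 - y) / 1))) =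
     gauss s (y - c) * cos (2 * pi * k%:R * (y - c) + (- (k%:R * (2 * pi * t)))).
    rewrite -[cos (k%:R * _)]cosN; congr (_ * cos _).
    by rewrite /c divr1; ring.
  under eq_Rintegral do rewrite E.
  by rewrite gauss_ft// cosN mulrC /d -!mulrA.
have L1 : (fun n => \int[mu]_y F n y) @ \oo --> (Num.sqrt s)^-1 * theta s^-1 t.
  under eq_fun do rewrite EL.
  apply: cvgM; first exact: cvg_cst.
  have <- : 2 * ((theta s^-1 t + 1) / 2) - d 0%N = theta s^-1 t.
    by rewrite /d mul0r cos0 /gauss expr0n /= mulr0 oppr0 expR0; lra.
  exact: (toeplitz_mean (@theta_cvg _ t si0)).
pose a n p := \int[mu]_(y in `[0, 1]) (gauss s (y + (zenum p)%:~R - c) * K n y).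
have ca n p : continuous (fun y : R => gauss s (y + (zenum p)%:~R - c) * K n y).
  by move=> y; apply: ct_mul; [rewrite /gauss; cts|exact: cK].
have a0 n p : 0 <= a n p by apply: Rintegral_ge0 => y _; rewrite mulr_ge0 ?gauss_ge0.
have ER n : series (a n) @ \oo --> \int[mu]_y F n y.
  apply: nneseries_cvg_series => //.
  have iF : mu.-integrable setT (EFin \o F n).
    have [M M0 hM] := @continuous_bounded_itv R (K n) 0 1 ler01 (cK n).
    apply: (@integrable_gauss_le _ s c _ n.+1%:R s0) => //.
    move=> y; rewrite normrM ger0_norm ?gauss_ge0// mulrC ler_wpM2r ?gauss_ge0// ger0_norm//.
    rewrite /K fejerE ler_pdivrMl// -natrM.
    apply: (@le_trans _ _ (\sum_(i < n.+1) \sum_(j < n.+1) 1)).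
      by apply: ler_sum => i _; apply: ler_sum => j _; exact: cos_le1.
    by rewrite !sumr_const card_ord -mulrnA.
  rewrite /Rintegral fineK; last exact: (integrable_fin_num _ iF).
  rewrite (integral_unfold (cF n) (F0 n)).
  apply: eq_eseriesr => p _.
  rewrite /a /Rintegral fineK; last exact: (integrable_fin_num _ (integrable_itv _ _ (ca n p))).
  apply: eq_integral => y _; congr (_%:E); rewrite /F; congr *%R.
  rewrite /K -(fejerDint n _ (- zenum p)); congr fejer.
  by rewrite rmorphN /= !divr1; ring.
have L2 : (fun n => limn (series (a n))) @ \oo --> gsum s t.
  pose B := expR (pi * s * (1 + `|c|) ^+ 2).
  have -> : gsum s t = limn (series (fun p => 1 * gauss s (2^-1 + (zenum p)%:~R - c))).
    congr (limn (series _)); apply/funext => p.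
    by rewrite mul1r /c; congr gauss; ring.
  apply: (@tannery _ _ _ _ (fun p n => a n p) _ (fun n => B * gratio s ^+ n)) => //.
  - move=> p; apply: (@fejer_cvg R (fun y => gauss s (y + (zenum p)%:~R - c)) 2^-1 1); [lra|lra|].
    by rewrite /gauss; cts.
  - apply: nearW => n p; rewrite ger0_norm//.
    rewrite -[X in _ <= X]mulr1 -(integral_fejer n 2^-1 (@ltr01 R)).
    rewrite -RintegralZl//; last exact: (integrable_itv _ _ (cK n)).
    apply: le_Rintegral => //.
    + exact: (integrable_itv _ _ (ca n p)).
    + apply: (@integrable_itv _ (fun y => B * gratio s ^+ p * K n y)).
      by move=> y; apply: ct_mul; [exact: ct_cst|exact: cK].
    + move=> y; rewrite /= in_itv /= => /andP[y0 y1]; apply: ler_wpM2r => //.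
      rewrite (_ : y + _ - c = (y - c) + (zenum p)%:~R); last by ring.
      apply: le_trans (gauss_zenum_le _ _ s0) _.
      rewrite ler_wpM2r ?exprn_ge0 ?(ltW (gratio_gt0 s))//.
      rewrite /B ler_expR ler_pM2l ?mulr_gt0 ?pi_gt0//.
      rewrite -[leLHS]real_normK ?num_real// ler_sqr ?nnegrE ?addr_ge0//.
      by apply: le_trans (ler_normB _ _) _; rewrite lerD2r ger0_norm.
  - exact: cvg_series_gratio.
have L3 : (fun n => limn (series (a n))) = (fun n => \int[mu]_y F n y).
  by apply/funext => n; apply/cvg_lim => //; exact: ER.
by rewrite L3 in L2; exact: (cvg_unique _ L2 L1).
Qed.

End Poisson.

(** * The theta values at 0 and 1/2 *)

Section ThetaValues.
Context {R : realType}.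
Implicit Types (s x : R) (v w : R ^nat).

Lemma zenum_uphalf n : `|(zenum n)%:~R| = (uphalf n)%:R :> R.
Proof.
rewrite -intr_norm /zenum uphalf_half; case: ifPn => o.
  by rewrite (_ : `|Negz n./2| = n./2.+1%:Z)// -pmulrn add1n.
by rewrite (_ : `|Posz n./2| = n./2%:Z)// -pmulrn add0n.
Qed.

Lemma series_uphalf v n : series (fun k => v (uphalf k)) n.*2.+1 = 2 * series v n.+1 - v 0%N.
Proof.
elim: n => [|n IH]; first by rewrite /series /= !big_nat1; ring.
rewrite doubleS seriesSr seriesSr IH.
rewrite [in RHS]seriesSr /= doubleK uphalf_double; ring.
Qed.

Lemma series_half w n : series (fun k => w k./2) n.*2 = 2 * series w n.
Proof.
elim: n => [|n IH]; first by rewrite /series /= !big_geq// mulr0.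
by rewrite doubleS seriesSr seriesSr IH [in RHS]seriesSr /= uphalf_double doubleK; ring.
Qed.

Lemma cvg_subseq_double (T : topologicalType) (u : nat -> T) (l : T) (b : bool) : u @ \oo --> l ->
  (fun n => u (b + n.*2)%N) @ \oo --> l.
Proof.
move=> ul; apply: cvg_comp ul; apply/cvgnyPge => A; near=> n.
apply: leq_trans (leq_addl _ _); rewrite -addnn; apply: leq_trans (leq_addl _ _).
by near: n; exact: nbhs_infty_ge.
Unshelve. all: by end_near.
Qed.

Lemma gsum_cs0 s : 0 < s -> gsum s 0 = theta s 0.
Proof.
move=> s0.
pose v (k : nat) := gauss s k%:R * cos (k%:R * (2 * pi * 0)).
have E : (fun n => gauss s (0 + (zenum n)%:~R)) = (fun n => v (uphalf n)).
  apply/funext => n; rewrite /v mulr0 mulr0 cos0 mulr1 add0r.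
  by rewrite -zenum_uphalf /gauss real_normK ?num_real.
have H := gsum_cvg (x := 0) s0.
rewrite E in H.
have H1 := cvg_subseq_double true H.
have /= H2 := theta_cvg (x := 0) s0.
have H3 : (fun n => 2 * series v n.+1 - v 0%N) @ \oo --> 2 * ((theta s 0 + 1) / 2) - v 0%N.
  apply: cvgB; last exact: cvg_cst.
  apply: cvgM; first exact: cvg_cst.
  by rewrite (cvg_shiftS (series v)); exact: H2.
have E2 : (fun n => series (fun k => v (uphalf k)) (true + n.*2)%N) = (fun n => 2 * series v n.+1 - v 0%N).
  by apply/funext => n; rewrite add1n series_uphalf.
rewrite E2 in H1; rewrite (cvg_unique _ H1 H3) // /v /gauss mul0r cos0 expr0n /= mulr0 oppr0 expR0.
lra.
Qed.

Definition theta3 s := theta s 0.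
Definition theta4 s := theta s 2^-1.

Lemma theta3_inv s : 0 < s -> theta3 s = (Num.sqrt s)^-1 * theta3 s^-1.
Proof. by move=> s0; rewrite /theta3 -gsum_cs0// poisson. Qed.

Definition half_term s : R ^nat := fun k => gauss s (2^-1 + k%:R).

(** Reflection pairs the translates at 1/2 + k and - (1/2 + k), which are
    neighbours in the enumeration. *)
Lemma gsum_half_cvg s : 0 < s -> series (half_term s) @ \oo --> gsum s 2^-1 / 2.
Proof.
move=> s0; have H := gsum_cvg (x := 2^-1) s0.
have E : (fun n => gauss s (2^-1 + (zenum n)%:~R)) = (fun n => half_term s n./2).
  apply/funext => n; rewrite /zenum /half_term; case: ifP => _ //.
  have -> : 2^-1 + (Negz n./2)%:~R = - (2^-1 + n./2%:R) :> R.
    by rewrite NegzE mulrNz -pmulrn -[n./2.+1%:R]natr1; lra.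
  exact: gaussN.
rewrite E in H.
have H1 := cvg_subseq_double false H.
rewrite /= in H1.
have E2 : (fun n => series (half_term s) n) = (fun n => 2^-1 * series (fun k => half_term s k./2) (0 + n.*2)%N).
  by apply/funext => n; rewrite add0n series_half mulKf.
rewrite [X in X @ _ --> _]E2 mulrC; apply: cvgM; [exact: cvg_cst|exact: H1].
Qed.

Lemma gsum_half_gt0 s : 0 < s -> 0 < gsum s 2^-1.
Proof.
move=> s0; suff : 0 < gsum s 2^-1 / 2 by lra.
have <- : limn (series (half_term s)) = gsum s 2^-1 / 2 by apply/cvg_lim => //; exact: gsum_half_cvg.
apply: lt_le_trans (_ : series (half_term s) 1 <= _).
  by rewrite /series /= big_nat1 gauss_gt0.
apply: nondecreasing_cvgn_le; last by apply/cvg_ex; eexists; exact: (gsum_half_cvg s0).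
by apply: nondecreasing_series => k _ _; exact: gauss_ge0.
Qed.

Lemma theta4_inv s : 0 < s -> theta4 s^-1 = Num.sqrt s * gsum s 2^-1.
Proof.
by move=> s0; rewrite poisson// mulrA divff ?mul1r// gt_eqF// sqrtr_gt0.
Qed.

(** The alternating series is, by Poisson, a sum of positive terms. *)
Lemma theta4_gt0 s : 0 < s -> 0 < theta4 s.
Proof.
by move=> s0; rewrite -[s]invrK theta4_inv ?invr_gt0// mulr_gt0 ?sqrtr_gt0 ?gsum_half_gt0 ?invr_gt0.
Qed.

Lemma theta_le_theta3 s x : 0 < s -> theta s x <= theta3 s.
Proof.
move=> s0; rewrite /theta3 /theta lerD2r ler_pM2l//.
apply: lim_series_le.
- by apply/cvg_ex; eexists; exact: (theta_cvg (x := x) s0).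
- by apply/cvg_ex; eexists; exact: (theta_cvg (x := 0) s0).
- by move=> k; rewrite ler_wpM2l ?gauss_ge0// mulr0 mulr0 cos0 cos_le1.
Qed.

Lemma sin_natmul_le (k : nat) (y : R) : `|sin (k%:R * y)| <= k%:R * `|sin y|.
Proof.
elim: k => [|k IH]; first by rewrite !mul0r sin0 normr0.
rewrite -natr1 mulrDl mul1r sinD mulrDl mul1r.
apply: le_trans (ler_normD _ _) _; apply: lerD; rewrite normrM.
  by apply: le_trans IH; rewrite ler_piMr ?cos_max.
by rewrite ler_piMl ?cos_max.
Qed.

(** Half-angle form of |sin (k z)| <= k |sin z|. *)
Lemma onecos_natmul_le (k : nat) (y : R) : 1 - cos (k%:R * y) <= k%:R ^+ 2 * (1 - cos y).
Proof.
have half z : 1 - cos z = 2 * sin (z / 2) ^+ 2 :> R.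
  have {1}-> : z = z / 2 + z / 2 by lra.
  by rewrite cosD -!expr2 cos2sin2; lra.
rewrite !half -mulrA [leRHS]mulrCA ler_pM2l// -exprMn.
rewrite -[leLHS]real_normK ?num_real// -[leRHS]real_normK ?num_real//.
rewrite ler_sqr ?nnegrE// normrM normr_nat.
exact: sin_natmul_le.
Qed.

Lemma cos_natpi (k : nat) (y : R) : cos (y + k%:R * pi) = (-1) ^+ k * cos y.
Proof.
elim: k => [|k IH]; first by rewrite mul0r addr0 mul1r.
by rewrite -natr1 mulrDl mul1r addrA cosDpi IH exprS mulN1r mulNr.
Qed.

Lemma pow4_bound k : (k.+2 ^ 2 * 2 ^ k.+1 <= 4 ^ (k.+2 ^ 2 - 1))%N.
Proof.
have -> : (k.+2 ^ 2 - 1 = k.+1 + (k.+1 + k.+1 * k.+1))%N by rewrite -mulnn; lia.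
rewrite expnD expnD (_ : 4 = 2 * 2)%N// !expnMn.
have h m : (m < 2 ^ m)%N by exact: ltn_expl.
have ka : (k.+2 <= 2 ^ k.+1)%N by exact: h.
have a0 : (0 < 2 ^ k.+1)%N by rewrite expn_gt0.
have b0 : (0 < 2 ^ (k.+1 * k.+1))%N by rewrite expn_gt0.
rewrite -mulnn; apply: leq_mul; first exact: leq_mul.
by rewrite -mulnA leq_pmulr// !muln_gt0 a0 b0.
Qed.

(** Write 2 pi x = pi + y and q = exp(- pi) <= 1/4. The k-th term of the
    difference is q (1 - cos y) for k = 1 and at least - k^2 q^(k^2) (1 - cos
    y) for k >= 2, where k^2 q^(k^2 - 1) <= 2^-(k - 1); these weights sum to
    1, so the first term dominates. *)
Lemma theta4_1_min x : theta4 1 <= theta 1 x.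
Proof.
have s1 : 0 < 1 :> R by [].
pose y : R := 2 * pi * x - pi.
pose q (k : nat) : R := gauss 1 k%:R.
pose a (k : nat) := q k * cos (k%:R * (2 * pi * x)) - q k * cos (k%:R * (2 * pi * 2^-1)).
(* A minorant whose partial sums are explicit: 1 - 1/2 - 1/4 - ..., up to the
   factor q (1 - cos y). *)
pose b (k : nat) : R := q 1%N * (1 - cos y) * (if k is j.+1 then (if j is i.+1 then - (2^-1 ^+ i.+1) else 1) else 0).
have ca : series a @ \oo --> (theta 1 x + 1) / 2 - (theta4 1 + 1) / 2.
  have -> : series a = series (fun k => q k * cos (k%:R * (2 * pi * x))) \- series (fun k => q k * cos (k%:R * (2 * pi * 2^-1))).
    by apply/funext => n; rewrite /series /= -sumrB.
  by apply: cvgB; exact: theta_cvg.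
suff : 0 <= (theta 1 x + 1) / 2 - (theta4 1 + 1) / 2 by lra.
have aE k : a k = (-1) ^+ k * q k * (cos (k%:R * y) - 1).
  rewrite /a (_ : 2 * pi * x = y + pi); last by rewrite /y; ring.
  rewrite [k%:R * (y + pi)]mulrDr cos_natpi (_ : k%:R * (2 * pi * 2^-1) = 0 + k%:R * pi); last by field.
  by rewrite cos_natpi cos0; ring.
have C0 : 0 <= 1 - cos y by rewrite subr_ge0 cos_le1.
have q0 k : 0 < q k by exact: gauss_gt0.
have qk k : k.+2%:R ^+ 2 * q k.+2 <= q 1%N * 2^-1 ^+ k.+1.
  rewrite /q /gauss !mulr1 expr1n mulr1.
  have e4 : 4 <= expR pi :> R.
    have := @expR_ge1Dx R 1; have : expR 1 ^+ 2 <= expR pi :> R.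
      by rewrite -expRM_natl mulr1 ler_expR pi_ge2.
    have := expR_gt0 (1 : R); nra.
  have E1 : expR (- (pi * k.+2%:R ^+ 2)) = expR (- pi) * (expR pi ^- (k.+2 ^ 2 - 1)) :> R.
    rewrite -expRM_natl -expRN -expRD; congr expR.
    rewrite natrB ?sqrn_gt0// natrX; ring.
  rewrite E1 mulrCA ler_pM2l ?expR_gt0// exprVn.
  rewrite ler_pdivrMr ?exprn_gt0 ?expR_gt0// mulrC ler_pdivlMr ?exprn_gt0//.
  apply: le_trans (_ : 4 ^+ (k.+2 ^ 2 - 1) <= _).
    by rewrite -!natrX -natrM ler_nat pow4_bound.
  by apply: lerXn2r => //; rewrite nnegrE ?expR_ge0.
have ab k : b k <= a k.
  rewrite aE /b; case: k => [|[|k]].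
  - by rewrite mulr0 mul0r cos0 subrr mulr0.
  - by rewrite mulr1 expr1 mul1r; lra.
  have h1 := onecos_natmul_le k.+2 y.
  have h2 : 0 <= 1 - cos (k.+2%:R * y) by rewrite subr_ge0 cos_le1.
  have h3 : q k.+2 * (1 - cos (k.+2%:R * y)) <= q 1%N * (1 - cos y) * 2^-1 ^+ k.+1.
    apply: le_trans (_ : q k.+2 * (k.+2%:R ^+ 2 * (1 - cos y)) <= _); first by rewrite ler_pM2l.
    by have := ler_wpM2r C0 (qk k); lra.
  rewrite mulrN.
  have : `|(-1) ^+ k.+2 * q k.+2 * (cos (k.+2%:R * y) - 1)| <= q 1%N * (1 - cos y) * 2^-1 ^+ k.+1.
    by rewrite normrM normrM normr_sign mul1r (ger0_norm (ltW (q0 _))) distrC (ger0_norm h2).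
  by rewrite ler_norml => /andP[].
have cb : forall n, series b n.+2 = q 1%N * (1 - cos y) * 2^-1 ^+ n.
  elim => [|n IH]; first by rewrite /series /= big_nat_recr//= big_nat1 /b mulr0 add0r expr0.
  by rewrite seriesSr IH /b exprS; lra.
apply: (cvgr_to_ge ca); near=> n.
have : (2 <= n)%N by near: n; exact: nbhs_infty_ge.
move=> n2; rewrite -(subnK n2) addn2.
apply: (@le_trans _ _ (series b (n - 2).+2)).
  by rewrite cb mulr_ge0 ?mulr_ge0 ?(ltW (q0 _))// exprn_ge0// invr_ge0.
by apply: ler_sum => k _; exact: ab.
Unshelve. all: by end_near.
Qed.

End ThetaValues.

(** * Even functions that are strictly convex on a half-line *)

Section ChordConvexity.
Context {R : realType}.
Implicit Types (E f : R -> R) (l : R).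

(** Convexity on the half-line from l, by chords: in this form it passes to
    sums of series. *)
Definition wconvex l f := forall a b t : R, l <= a -> a < b -> 0 < t -> t < 1 ->
  f (t * a + (1 - t) * b) <= t * f a + (1 - t) * f b.
Definition sconvex l f := forall a b t : R, l <= a -> a < b -> 0 < t -> t < 1 ->
  f (t * a + (1 - t) * b) < t * f a + (1 - t) * f b.

Lemma sconvexW l f : sconvex l f -> wconvex l f.
Proof. by move=> H a b t la ab t0 t1; exact/ltW/H. Qed.

Lemma sconvex_lt l f p q r : sconvex l f -> l <= p -> p < q -> q < r -> f p <= f q ->
  f q < f r.
Proof.
move=> cf lp pq qr fpq.
have pr : 0 < r - p by rewrite subr_gt0 (lt_trans pq).
pose t := (r - q) / (r - p).
have t0 : 0 < t by rewrite divr_gt0// subr_gt0.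
have t1 : t < 1 by rewrite ltr_pdivrMr// mul1r ltrD2l ltrN2.
have tE : t * (r - p) = r - q by rewrite divfK// gt_eqF.
have := cf p r t lp (lt_trans pq qr) t0 t1.
have -> : t * p + (1 - t) * r = q.
  have -> : t * p + (1 - t) * r = r - t * (r - p) by ring.
  by rewrite tE; ring.
nra.
Qed.

(** Evenness and convexity on [-d, d] make E increasing on [0, d], and
    convexity to the right propagates this to all positive arguments. If v - u
    >= - d the claim is convexity at the midpoint; if not, reflect v - u to u
    - v and combine the midpoint u of u - v and u + v with E v < E u. *)
Lemma even_convex E d : 0 < d -> (forall x, E (- x) = E x) -> sconvex (- d) E ->
  forall v u, u != 0 -> 2 * E v < E (v + u) + E (v - u).
Proof.
move=> d0 evE cE.
have mono a b : 0 <= a -> a < b -> E a < E b.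
  have small p q : 0 < p -> p <= d -> p < q -> E p < E q.
    move=> p0 pd pq; apply: (sconvex_lt cE _ _ pq (p := - p)); [by rewrite lerN2|lra|].
    by rewrite evE.
  move=> a0 ab.
  case: (ltP 0 a) => [a0'|a0']; last first.
    have -> : a = 0 by apply/eqP; rewrite eq_le a0 a0'.
    have b0 : 0 < b by exact: le_lt_trans ab.
    (* The midpoint 0 of - h and h gives E 0 < E h by evenness. *)
    pose h := Num.min b d.
    have h0 : 0 < h by rewrite lt_min b0 d0.
    have hb : h <= b by rewrite ge_min lexx.
    have hd : h <= d by rewrite ge_min lexx orbT.
    have h1 : E 0 < E h.
      have := cE (- h) h 2^-1.
      rewrite lerN2 hd evE => /(_ isT) H.
      have -> : 0 = 2^-1 * (- h) + (1 - 2^-1) * h by lra.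
      have := H; lra.
    move: hb; rewrite le_eqVlt => /orP[/eqP<-//|hb].
    exact: lt_trans h1 (small _ _ h0 hd hb).
  case: (leP a d) => ad; first exact: small.
  apply: (sconvex_lt cE _ ad ab); first lra.
  exact/ltW/small.
have main v u : 0 <= v -> 0 < u -> 2 * E v < E (v + u) + E (v - u).
  move=> v0 u0; case: (leP (- d) (v - u)) => vu.
    have := cE (v - u) (v + u) 2^-1 vu.
    have -> : 2^-1 * (v - u) + (1 - 2^-1) * (v + u) = v by lra.
    move=> H; have : v - u < v + u by lra.
    move/H; lra.
  have -> : E (v - u) = E (u - v) by rewrite -evE opprB.
  case: (ltP 0 v) => v0'.
    have H1 := cE (u - v) (u + v) 2^-1.
    have E1 : 2^-1 * (u - v) + (1 - 2^-1) * (u + v) = u by lra.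
    rewrite E1 in H1.
    have H2 := mono v u v0.
    have : v < u by lra.
    move/H2 => H3.
    have := H1; rewrite [u + v]addrC; lra.
  have -> : v = 0 by apply/eqP; rewrite eq_le v0 v0'.
  rewrite add0r subr0; have := mono 0 u (lexx 0) u0; lra.
move=> v u u0.
have main2 w z : 0 <= w -> z != 0 -> 2 * E w < E (w + z) + E (w - z).
  move=> w0 z0; case: (ltP 0 z) => zz0; first exact: main.
  have := main w (- z) w0; rewrite oppr_gt0 lt_neqAle z0 zz0 => /(_ isT).
  by rewrite opprK addrC.
case: (leP 0 v) => v0; first exact: main2.
have := main2 (- v) u; rewrite oppr_ge0 (ltW v0) => /(_ isT u0).
rewrite evE -[E (- v + u)]evE -[E (- v - u)]evE !opprD !opprK; lra.
Qed.

Lemma sconvex_d1 l f f' : (forall x : R, is_derive x 1 f (f' x)) ->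
  (forall x y, l <= x -> x < y -> f' x < f' y) -> sconvex l f.
Proof.
move=> df f'm a b t la ab t0 t1; set c := _ + _.
have ac : a < c by rewrite /c; nra.
have cb : c < b by rewrite /c; nra.
have cf : continuous f.
  by move=> x; apply/differentiable_continuous/derivable1_diffP; have [] := df x.
have [x xac fac] := MVT ac (fun x _ => df x) (continuous_subspaceT cf).
have [y ycb fcb] := MVT cb (fun x _ => df x) (continuous_subspaceT cf).
move: xac ycb; rewrite !in_itv /= => /andP[ax xc] /andP[cy yb].
have := f'm x y (ltW (le_lt_trans la ax)) (lt_trans xc cy) => xy.
have E1 : c - a = (1 - t) * (b - a) by rewrite /c; ring.
have E2 : b - c = t * (b - a) by rewrite /c; ring.
have E3 : t * f a + (1 - t) * f b - f c = (1 - t) * (f b - f c) - t * (f c - f a) by ring.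
rewrite -subr_gt0 E3 fac fcb E1 E2.
have -> : (1 - t) * (f' y * (t * (b - a))) - t * (f' x * ((1 - t) * (b - a))) =
   t * (1 - t) * (b - a) * (f' y - f' x) by ring.
by rewrite !mulr_gt0// subr_gt0.
Qed.

Lemma sconvex_d2 l f f' f'' : (forall x : R, is_derive x 1 f (f' x)) ->
  (forall x : R, is_derive x 1 f' (f'' x)) ->
  (forall x, l <= x -> 0 < f'' x) -> sconvex l f.
Proof.
move=> df df' f''0; apply: (sconvex_d1 df) => x y lx xy.
have cf' : continuous f'.
  by move=> z; apply/differentiable_continuous/derivable1_diffP; have [] := df' z.
have [z zxy E] := MVT xy (fun z _ => df' z) (continuous_subspaceT cf').
rewrite -subr_gt0 E mulr_gt0 ?subr_gt0// f''0//.
by move: zxy; rewrite in_itv /= => /andP[/ltW/(le_trans lx)].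
Qed.

Lemma series_convex l (f : nat -> R -> R) (S : R -> R) :
  (forall k, wconvex l (f k)) -> (forall u, series (f ^~ u) @ \oo --> S u) ->
  wconvex l S.
Proof.
move=> cf fS a b t la ab t0 t1; set c := _ + _.
rewrite -subr_ge0.
have H : series (fun k => t * f k a + (1 - t) * f k b - f k c) @ \oo -->
     t * S a + (1 - t) * S b - S c.
  rewrite (_ : series _ = fun n => t * series (f ^~ a) n + (1 - t) * series (f ^~ b) n - series (f ^~ c) n); last first.
    by apply/funext => n; rewrite /series /= !mulr_sumr -big_split /= -sumrB.
  by apply: cvgB; [apply: cvgD; apply: cvgM; (exact: cvg_cst || exact: fS)|exact: fS].
apply: (cvgr_to_ge H); apply: nearW => n.
by apply: sumr_ge0 => k _; rewrite subr_ge0; exact: cf.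
Qed.

Lemma series_sconvex l (f : nat -> R -> R) (S : R -> R) :
  sconvex l (f 0%N) -> (forall k, wconvex l (f k)) ->
  (forall u, series (f ^~ u) @ \oo --> S u) -> sconvex l S.
Proof.
move=> sf cf fS a b t la ab t0 t1.
have fS' u : series ((fun k => f k.+1) ^~ u) @ \oo --> S u - f 0%N u.
  rewrite (_ : series _ = fun n => series (f ^~ u) n.+1 - f 0%N u).
    apply: cvgB; last exact: cvg_cst.
    by rewrite (cvg_shiftS (series (f ^~ u))); exact: fS.
  by apply/funext => n; rewrite /series /= big_nat_recl//= addrC addKr.
have := @series_convex l (fun k => f k.+1) (fun u => S u - f 0%N u) (fun k => cf k.+1) fS' a b t la ab t0 t1.
have := sf a b t la ab t0 t1.
set c := _ + _; lra.
Qed.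

End ChordConvexity.

(** * Convexity of powers of the nome *)

Section PhiFunctions.
Context {R : realType}.
Implicit Types (n u w c : R).

(** X = - log q for the nome q = exp(- pi e^u), and [qpow] n is q^n; the
    letters X and q keep this meaning below. *)
Definition nlogq u : R := pi * expR u.
Definition qpow n u : R := expR (- (n * nlogq u)).

Lemma nlogq_gt0 u : 0 < nlogq u. Proof. by rewrite mulr_gt0 ?pi_gt0 ?expR_gt0. Qed.

(** The half-line of convexity must contain 0 in its interior; - 1/20 leaves
    room for this while keeping the nome small enough for all estimates below,
    even with only pi >= 2. *)
Lemma nlogq_ge u : - 20^-1 <= u -> 19 / 10 <= nlogq u.
Proof.
move=> u0; have h1 : 1 + - 20^-1 <= expR u.
  by apply: le_trans (expR_ge1Dx _) _; rewrite ler_expR.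
have := @pi_ge2 R; rewrite /nlogq; nra.
Qed.

Lemma nlogq_lt u v : u < v -> nlogq u < nlogq v.
Proof. by move=> uv; rewrite /nlogq ltr_pM2l ?pi_gt0// ltr_expR. Qed.

Lemma qpow_gt0 n u : 0 < qpow n u. Proof. exact: expR_gt0. Qed.

Lemma is_derive_nlogq u : is_derive u 1 nlogq (nlogq u).
Proof. by rewrite /nlogq; apply: is_derive_eq; rewrite /GRing.scale /=; ring. Qed.

Lemma is_derive_qpow n u : is_derive u 1 (qpow n) (- (n * nlogq u) * qpow n u).
Proof. by rewrite /qpow /nlogq; apply: is_derive_eq; rewrite /GRing.scale /=; ring. Qed.

Lemma is_derive2_qpow n u : is_derive u 1 (fun u => - (n * nlogq u) * qpow n u)
  (((n * nlogq u) ^+ 2 - n * nlogq u) * qpow n u).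
Proof. by rewrite /qpow /nlogq; apply: is_derive_eq; rewrite /GRing.scale /=; ring. Qed.

(** Four squarings of 1 + x <= exp x at x = 19/160. *)
Lemma expR19 : 59 / 10 <= expR (19 / 10) :> R.
Proof.
have -> : 19 / 10 = 2 * (2 * (2 * (2 * (19 / 160)))) :> R by lra.
have h0 := @expR_ge1Dx R (19 / 160).
have sq (a b : R) (x : R) : 0 <= a -> a <= expR x -> b <= a ^+ 2 -> b <= expR (2 * x).
  move=> a0 ax ba; rewrite expRM_natl; apply: le_trans ba _.
  by rewrite ler_sqr ?nnegrE ?expR_ge0.
apply: (sq (243 / 100)); [lra| |lra].
apply: (sq (156 / 100)); [lra| |lra].
apply: (sq (125 / 100)); [lra| |lra].
apply: (sq (1 + 19 / 160)); [lra|exact: h0|lra].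
Qed.

Lemma qpow_nat_le (m : nat) u : - 20^-1 <= u -> qpow m%:R u * (59 / 10) ^+ m <= 1.
Proof.
move=> u0; rewrite /qpow expRN mulrC ler_pdivrMr ?expR_gt0// mul1r expRM_natl.
apply: lerXn2r; rewrite ?nnegrE ?expR_ge0//.
by apply: le_trans expR19 _; rewrite ler_expR nlogq_ge.
Qed.

Lemma qpowD n c u : qpow (n + c) u = qpow n u * qpow c u.
Proof. by rewrite /qpow -expRD; congr expR; ring. Qed.

Lemma qpow_convex n : 1 <= n -> sconvex (- 20^-1) (qpow n).
Proof.
move=> n1; apply: (sconvex_d2 (is_derive_qpow n) (is_derive2_qpow n)) => x /nlogq_ge hx.
have hz : 19 / 10 <= n * nlogq x by nra.
rewrite mulr_gt0 ?qpow_gt0//; move: (n * nlogq x) hz => z hz; nra.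
Qed.

Lemma nlogq_convex : sconvex (- 20^-1) nlogq.
Proof. by apply: (sconvex_d2 is_derive_nlogq is_derive_nlogq) => x _; exact: nlogq_gt0. Qed.

(** With z = m X the second derivative of the logarithm has the sign of w e^z
    (z - 1) - 2, which increases in z; the hypothesis implies this condition
    at the left end. The proof compares first derivatives at two points
    instead of differentiating twice. *)
Lemma logconvex_convex (m : nat) w : 0 < w -> 2 < w * (59 / 10) ^+ m * (m%:R * (19 / 10) - 1) ->
  (0 < m)%N ->
  sconvex (- 20^-1) (fun u => ln (w + 2 * qpow m%:R u)).
Proof.
move=> w0 wm m0.
have p0 u : 0 < w + 2 * qpow m%:R u by have := qpow_gt0 m%:R u; lra.
pose f' u := (w + 2 * qpow m%:R u)^-1 * (2 * (- (m%:R * nlogq u) * qpow m%:R u)).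
apply: (@sconvex_d1 _ _ _ f') => [u|x y lx xy].
  have d1 := is_derive1_ln (p0 u).
  have d2 : is_derive u 1 (fun u => w + 2 * qpow m%:R u) (2 * (- (m%:R * nlogq u) * qpow m%:R u)).
    have := is_derive_qpow m%:R u => d; apply: is_derive_eq; rewrite /GRing.scale /=; ring.
  rewrite /f'.
  have := @is_derive1_comp R (@ln R) (fun u => w + 2 * qpow m%:R u) u _ _ d1 d2.
  by apply.
rewrite /f'; set z1 := m%:R * nlogq x; set z2 := m%:R * nlogq y.
have m1 : 1 <= m%:R :> R by rewrite ler1n.
have mm : 0 < m%:R :> R by rewrite ltr0n.
have z12 : z1 < z2 by rewrite /z1 /z2 ltr_pM2l// nlogq_lt.
have z1l : m%:R * (19 / 10) <= z1 by rewrite ler_pM2l// nlogq_ge.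
rewrite /qpow -/z1 -/z2.
set A := expR (- z1).
have A0 : 0 < A by exact: expR_gt0.
have A1 : A * (59 / 10) ^+ m <= 1 by exact: qpow_nat_le.
set D := expR (- (z2 - z1)).
have -> : expR (- z2) = A * D by rewrite /A /D -expRD; congr expR; ring.
have D0 : 0 < D by exact: expR_gt0.
have d0 : 0 < z2 - z1 by rewrite subr_gt0.
have D1 : D * (1 + (z2 - z1)) <= 1.
  by rewrite /D expRN mulrC ler_pdivrMr ?expR_gt0// mul1r expR_ge1Dx.
(* This is positivity of the second derivative at z1; convexity between z1 and
   z2 follows from 1 + x <= exp x. *)
have key : 2 * A < w * (z1 - 1).
  have P0 : 0 < (59 / 10) ^+ m :> R by rewrite exprn_gt0//; lra.
  rewrite -(ltr_pM2r P0); apply: le_lt_trans (_ : 2 < _); first by rewrite -mulrA; lra.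
  have wP : 0 < w * (59 / 10) ^+ m by rewrite mulr_gt0.
  apply: lt_le_trans wm _; rewrite [leRHS]mulrAC ler_pM2l//; lra.
have k1 : w * (z2 * D) + 2 * A * D * (z2 - z1) < w * z1.
  have : w * z1 * (D * (1 + (z2 - z1))) <= w * z1 by rewrite ler_piMr// mulr_ge0 ?(ltW w0)//; lra.
  have := ltr_pM2r (mulr_gt0 D0 d0) (2 * A) (w * (z1 - 1)); rewrite key => /esym; nra.
have P1 : 0 < w + 2 * A by lra.
have P2 : 0 < w + 2 * (A * D) by rewrite addr_gt0 ?mulr_gt0.
rewrite -subr_gt0.
have -> : (w + 2 * (A * D))^-1 * (2 * (- z2 * (A * D))) - (w + 2 * A)^-1 * (2 * (- z1 * A)) =
   2 * A * (w * z1 - (w * (z2 * D) + 2 * A * D * (z2 - z1))) / ((w + 2 * A) * (w + 2 * (A * D))).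
  by move: (z1) (z2) (A) (D) P1 P2 => y1 y2 B F P1 P2; field; rewrite !gt_eqF.
by rewrite divr_gt0 ?mulr_gt0// subr_gt0.
Qed.

End PhiFunctions.

(** * Theta values at 0: the strict inequality *)

Section ThetaConvex.
Context {R : realType}.
Implicit Types (u : R).

Lemma gauss_qpow (k : nat) u : gauss (expR u) k%:R = qpow (k ^ 2)%:R u.
Proof. by rewrite /gauss /qpow /nlogq natrX; congr expR; ring. Qed.

Lemma sqrt_expR u : Num.sqrt (expR u) = expR (u / 2).
Proof.
have -> : expR u = expR (u / 2) ^+ 2 by rewrite -expRM_natl; congr expR; lra.
by rewrite sqrtr_sqr ger0_norm ?expR_ge0.
Qed.

Lemma series_geom_half n : series (fun k => 2^-1 ^+ k.+1 : R) n = 1 - 2^-1 ^+ n.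
Proof.
elim: n => [|n IH]; first by rewrite /series /= big_geq// expr0 subrr.
by rewrite seriesSr IH exprS; lra.
Qed.

Lemma cvg_half_pow : (fun n => (2^-1 ^+ n : R)) @ \oo --> (0 : R).
Proof. by apply: cvg_expr; rewrite ger0_norm; lra. Qed.

(** The constant term 1 of theta3 is distributed as sum_k 2^-(k+1) over the
    other terms: exp(- n X) alone is log-concave in u, its logarithm being - n
    pi e^u, but on the half-line it becomes log-convex after adding such a
    constant. *)
Definition t3term (k : nat) u : R := 2^-1 ^+ k.+1 + 2 * qpow (k.+1 ^ 2)%:R u.

Lemma t3term_gt0 k u : 0 < t3term k u.
Proof. by rewrite /t3term addr_gt0 ?mulr_gt0 ?qpow_gt0// exprn_gt0// invr_gt0. Qed.

Lemma t3term_cvg u : series (t3term ^~ u) @ \oo --> theta3 (expR u).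
Proof.
have H := theta_cvg (x := 0) (expR_gt0 u).
rewrite (_ : series _ = fun n => (1 - 2^-1 ^+ n) +
    2 * (series (fun k => gauss (expR u) k%:R * cos (k%:R * (2 * pi * 0))) n.+1 - 1)); last first.
  apply/funext => n; rewrite -series_geom_half /series /= big_split /=; congr (_ + _).
  rewrite big_nat_recl//= mul0r cos0 mulr1 gauss_qpow /qpow mul0r oppr0 expR0 addrC addKr.
  rewrite mulr_sumr; apply: eq_bigr => k _.
  by rewrite mulr0 mulr0 cos0 mulr1 gauss_qpow.
have -> : theta3 (expR u) = (1 - 0) + 2 * ((theta (expR u) 0 + 1) / 2 - 1).
  by rewrite /theta3; lra.
apply: cvgD; first by apply: cvgB; [exact: cvg_cst|exact: cvg_half_pow].
apply: cvgM; first exact: cvg_cst.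
apply: cvgB; last exact: cvg_cst.
by rewrite (cvg_shiftS (series (fun k => gauss (expR u) k%:R * cos (k%:R * (2 * pi * 0))))).
Qed.

Lemma expR_conv (t x y : R) : 0 < t -> t < 1 ->
  expR (t * x + (1 - t) * y) <= t * expR x + (1 - t) * expR y.
Proof.
move=> t0 t1; set m := _ + _.
have h z : expR m * (1 + (z - m)) <= expR z.
  have -> : expR z = expR m * expR (z - m) by rewrite -expRD; congr expR; ring.
  by rewrite ler_pM2l ?expR_gt0// expR_ge1Dx.
have h1 := h x; have h2 := h y.
have t1' : 0 < 1 - t by rewrite subr_gt0.
have := lerD (ler_wpM2l (ltW t0) h1) (ler_wpM2l (ltW t1') h2).
apply: le_trans; rewrite le_eqVlt; apply/orP; left; apply/eqP; rewrite /m; ring.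
Qed.

Lemma t3term_convex k : sconvex (- 20^-1) (fun u => ln (t3term k u)).
Proof.
apply: logconvex_convex; [by rewrite exprn_gt0// invr_gt0| |by rewrite expn_gt0].
have N : 1 <= (k.+1 ^ 2)%:R :> R by rewrite ler1n expn_gt0.
have Q : 59 / 20 <= 2^-1 ^+ k.+1 * (59 / 10) ^+ (k.+1 ^ 2) :> R.
  apply: le_trans (_ : 2^-1 ^+ k.+1 * (59 / 10) ^+ k.+1 <= _).
    rewrite -exprMn (_ : 2^-1 * (59 / 10) = 59 / 20); last by lra.
    by rewrite exprS ler_peMr ?exprn_ege1//; lra.
  rewrite ler_pM2l ?exprn_gt0 ?invr_gt0//.
  by apply: ler_weXn2l; [lra|rewrite -mulnn; lia].
move: Q; set q := (2^-1 ^+ _ * _) => Q.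
move: N; set n := (_)%:R => N; nra.
Qed.

Lemma convex_addl (p q r x y t z : R) : r < t * p + (1 - t) * q ->
  r + (t * x + (1 - t) * y) * z < t * (p + x * z) + (1 - t) * (q + y * z).
Proof. lra. Qed.

Lemma convex_subl (p q r x y t : R) : r < t * x + (1 - t) * y ->
  r - (t * p + (1 - t) * q) < t * (x - p) + (1 - t) * (y - q).
Proof. lra. Qed.

Lemma theta3_gt0 (s : R) : 0 < s -> 0 < theta3 s.
Proof.
move=> s0; apply: lt_le_trans (theta4_gt0 s0) _; exact: theta_le_theta3.
Qed.

Lemma theta4E (s : R) : theta4 s = theta s 2^-1. Proof. by []. Qed.

Opaque expR ln theta gsum theta3 theta4.

(** A sum of log-convex functions is log-convex: normalize the three sums by
    A, B and the weighted geometric mean of A and B, and apply the convexity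
    of exp termwise. Strictness survives because every difference is positive.
    *)
Lemma theta3_convex : sconvex (- 20^-1) (fun u => ln (theta3 (expR u))).
Proof.
move=> a b t la ab t0 t1; set c := _ + _.
have t1' : 0 < 1 - t by rewrite subr_gt0.
have t3p u : 0 < theta3 (expR u) by rewrite theta3_gt0 ?expR_gt0.
move: (t3p a) (t3p b) (t3p c) (@t3term_cvg a) (@t3term_cvg b) (@t3term_cvg c); clear t3p.
move: (theta3 (expR a)) (theta3 (expR b)) (theta3 (expR c)) => A B C A0 B0 C0 HA HB HC.
pose L : R := t * ln A + (1 - t) * ln B.
pose d k : R := t * (t3term k a / A) + (1 - t) * (t3term k b / B) - t3term k c * expR (- L).
have d0 k : 0 < d k.
  rewrite subr_gt0.
  have := @t3term_convex k a b t la ab t0 t1; rewrite -/c => H.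
  have E u D : 0 < D -> t3term k u / D = expR (ln (t3term k u) - ln D).
    by move=> D0; rewrite expRD expRN !lnK ?posrE ?t3term_gt0.
  rewrite (E a A A0) (E b B B0); apply: lt_le_trans (expR_conv _ _ t0 t1).
  rewrite -[t3term k c](@lnK R) ?posrE ?t3term_gt0// -expRD ltr_expR.
  exact: convex_subl.
have H : series d @ \oo --> t * (A / A) + (1 - t) * (B / B) - C * expR (- L).
  rewrite (_ : series d = fun n => t * (series (t3term ^~ a) n / A) +
     (1 - t) * (series (t3term ^~ b) n / B) - series (t3term ^~ c) n * expR (- L)); last first.
    apply/funext => n; rewrite /series /= !mulr_suml !mulr_sumr -big_split /= -sumrB.
    by apply: eq_bigr.
  by apply: cvgB; [apply: cvgD|]; (try (apply: cvgM; first exact: cvg_cst));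
    apply: cvgMl.
rewrite !divff ?gt_eqF// !mulr1 subrKC in H.
have pos : 0 < 1 - C * expR (- L).
  apply: lt_le_trans (d0 0%N) _.
  apply: (cvgr_to_ge H); near=> n.
  have n0 : (1 <= n)%N by near: n; exact: nbhs_infty_ge.
  rewrite -[n](subnK n0) addn1 /series /= big_nat_recl//= lerDl.
  by apply: sumr_ge0 => k _; exact: ltW.
rewrite -/L -ltr_expR lnK ?posrE//.
by move: pos; rewrite expRN subr_gt0 ltr_pdivrMr ?expR_gt0// mul1r.
Unshelve. all: by end_near.
Qed.

Lemma theta3_log_even u : ln (theta3 (expR u)) + u / 4 = ln (theta3 (expR (- u))) - u / 4.
Proof.
rewrite theta3_inv ?expR_gt0// -expRN sqrt_expR -expRN.
rewrite lnM ?posrE ?expR_gt0 ?theta3_gt0 ?expR_gt0// expRK; lra.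
Qed.

Theorem theta3_mul_lt (c x : R) : 0 < c -> 0 < x -> x != 1 ->
  theta3 c ^+ 2 < theta3 (c * x) * theta3 (c / x).
Proof.
move=> c0 x0 x1.
pose E u := ln (theta3 (expR u)) + u / 4.
have cE : sconvex (- 20^-1) E.
  move=> a b t la ab t0 t1; rewrite /E.
  exact: (convex_addl _ _ _ (@theta3_convex a b t la ab t0 t1)).
have evE u : E (- u) = E u by rewrite /E [RHS]theta3_log_even mulNr.
have u0 : ln x != 0 by apply: contra_neq x1 => h; rewrite -[x]lnK ?posrE// h expR0.
have := @even_convex R E 20^-1 _ evE cE (ln c) (ln x) u0.
have i20 : 0 < 20^-1 :> R by rewrite invr_gt0.
move=> /(_ i20); rewrite /E expRD expRB !lnK ?posrE//.
have p1 : 0 < theta3 (c * x) by rewrite theta3_gt0 ?mulr_gt0.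
have p2 : 0 < theta3 (c / x) by rewrite theta3_gt0 ?divr_gt0.
have p3 := theta3_gt0 c0.
move=> H; rewrite expr2 -ltr_ln ?posrE ?mulr_gt0// !lnM ?posrE//.
move: H.
move: (ln (theta3 c)) (ln (theta3 (c * x))) (ln (theta3 (c / x))) (ln c) (ln x).
move=> *; lra.
Qed.

End ThetaConvex.

(** * Theta values at 1/2: the strict inequality *)

Section Theta4Concave.
Context {R : realType}.
Implicit Types (u : R).

Opaque expR ln theta gsum theta3 theta4.

Lemma pow59_ge (m : nat) : (2 <= m)%N -> 34 <= (59 / 10) ^+ m :> R.
Proof.
move=> m2; apply: (@le_trans _ _ ((59 / 10) ^+ 2)); first by rewrite expr2; lra.
by apply: ler_weXn2l => //; lra.
Qed.

(** The numerical condition of [y4_comb_convex] for the k-th summand. The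
    ratio of consecutive sides grows, so induction from k = 0 works. *)
Lemma y_cond k : 9 / 2 * k.+2%:R ^+ 4 <= 2^-1 ^+ k.+1 * (59 / 10) ^+ (k.+2 ^ 2 - 1) :> R.
Proof.
rewrite exprVn [leRHS]mulrC ler_pdivlMr ?exprn_gt0//.
have -> : (k.+2 ^ 2 - 1 = k.+1 * k.+3)%N by rewrite -mulnn; lia.
elim: k => [|k IH]; first by rewrite mul1n !exprS expr0; lra.
have -> : (k.+2 * k.+4 = k.+1 * k.+3 + (2 * k + 5))%N by lia.
rewrite exprD; apply: le_trans (_ : (9 / 2 * k.+2%:R ^+ 4 * 2 ^+ k.+1) * 34 <= _); last first.
  by apply: ler_pM => //; rewrite ?mulr_ge0 ?exprn_ge0//; apply: pow59_ge; lia.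
rewrite [2 ^+ k.+2]exprS.
have P2 : 0 < 2 ^+ k.+1 :> R by rewrite exprn_gt0.
suff : k.+3%:R ^+ 4 * 2 <= k.+2%:R ^+ 4 * 34 :> R by nra.
have : k.+3%:R <= 3 / 2 * k.+2%:R :> R.
  rewrite -[k.+3%:R]natr1; have : 2 <= k.+2%:R :> R by rewrite ler_nat.
  lra.
move/(lerXn2r 4); rewrite !nnegrE => /(_ _ _)H.
have {}H : k.+3%:R ^+ 4 <= (3 / 2 * k.+2%:R) ^+ 4 :> R by apply: H; rewrite ?mulr_ge0//; lra.
have : (3 / 2 * k.+2%:R) ^+ 4 = 81 / 16 * k.+2%:R ^+ 4 :> R by field.
have : 0 <= k.+2%:R ^+ 4 :> R by rewrite exprn_ge0.
lra.
Qed.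

Lemma z_cond k : 38 / 75 * (k.+1 * k.+2)%:R ^+ 2 * 16 ^+ k.+1 <= (59 / 10) ^+ (k.+1 * k.+2) :> R.
Proof.
elim: k => [|k IH]; first by rewrite mul1n !exprS !expr0; lra.
have -> : (k.+2 * k.+3 = k.+1 * k.+2 + 2 * k.+2)%N by lia.
rewrite exprD.
have P4 : 34 * 34 <= (59 / 10) ^+ (2 * k.+2) :> R.
  rewrite (_ : 2 * k.+2 = 2 + (2 * k + 2))%N; last by lia.
  by rewrite exprD; apply: ler_pM => //; apply: pow59_ge; lia.
apply: le_trans (_ : 38 / 75 * (k.+1 * k.+2)%:R ^+ 2 * 16 ^+ k.+1 * (34 * 34) <= _); last first.
  by apply: ler_pM => //; rewrite ?mulr_ge0 ?exprn_ge0.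
rewrite [16 ^+ k.+2]exprS.
have P2 : 0 < 16 ^+ k.+1 :> R by rewrite exprn_gt0.
have -> : (k.+1 * k.+2 + 2 * k.+2 = k.+3 * k.+2)%N by lia.
suff : (k.+3 * k.+2)%:R ^+ 2 * 16 <= (k.+1 * k.+2)%:R ^+ 2 * (34 * 34) :> R by nra.
rewrite !natrM !exprMn.
have : k.+3%:R <= 3 * k.+1%:R :> R by rewrite -natrM ler_nat; lia.
have : 0 <= k.+3%:R :> R by [].
have : 0 <= k.+2%:R :> R by [].
move: (k.+3%:R) (k.+2%:R) (k.+1%:R) => p q r q0 p0 pr.
have h1 : p ^+ 2 <= 9 * r ^+ 2 by nra.
have h2 : 0 <= q ^+ 2 by exact: sqr_ge0.
have h3 : 0 <= r ^+ 2 by exact: sqr_ge0.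
nra.
Qed.

(** The alternating series 1 - theta4 = 2 sum (-1)^k q^((k+1)^2), with its
    leading term 2 q redistributed as sum_k 2^-k q: each summand 2^-k q
    compensates the later term of the same index, which is concave for odd k.
    *)
Definition y4 (k : nat) u : R := 2^-1 ^+ k * qpow 1 u +
  (2 * (-1) ^+ k * qpow (k.+1 ^ 2)%:R u - (if k == 0%N then 2 * qpow 1 u else 0)).

(** Since q^(m+1) = q q^m and q^m is at most (59/10)^-m, the possibly negative
    second derivative of the last term is dominated by that of c q. *)
Lemma y4_comb_convex (c d : R) (m : nat) : - 2 <= d -> (0 < m)%N ->
  9 / 2 * m.+1%:R ^+ 2 <= c * (59 / 10) ^+ m ->
  sconvex (- 20^-1) (fun u => c * qpow 1 u + d * qpow m.+1%:R u).
Proof.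
move=> d2 m0 cm; set n := m.+1%:R in cm *.
have P0 : 0 < (59 / 10) ^+ m :> R by rewrite exprn_gt0//; lra.
have n1 : 1 <= n by rewrite ler1n.
have c0 : 0 < c by rewrite -(pmulr_lgt0 _ P0); apply: lt_le_trans cm; nra.
apply: (@sconvex_d2 _ _ _ (fun u => c * (- (1 * nlogq u) * qpow 1 u) + d * (- (n * nlogq u) * qpow n u))
   (fun u => c * (((1 * nlogq u) ^+ 2 - 1 * nlogq u) * qpow 1 u) + d * (((n * nlogq u) ^+ 2 - n * nlogq u) * qpow n u))).
- move=> u; have d1 := is_derive_qpow 1 u; have dn := is_derive_qpow n u.
  by apply: is_derive_eq; rewrite /GRing.scale /=; ring.
- move=> u; have d1 := is_derive2_qpow 1 u; have dn := is_derive2_qpow n u.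
  by apply: is_derive_eq; rewrite /GRing.scale /=; ring.
move=> u hu; have Xu := nlogq_ge hu.
have -> : qpow n u = qpow 1 u * qpow m%:R u by rewrite /n -natr1 addrC qpowD.
have p1 := qpow_gt0 1 u; have pm := qpow_gt0 m%:R u.
have pP : qpow m%:R u * (59 / 10) ^+ m <= 1 by exact: qpow_nat_le.
have cp : 9 / 2 * n ^+ 2 * qpow m%:R u <= c.
  apply: le_trans (ler_wpM2r (ltW pm) cm) _.
  by rewrite -mulrA ler_piMr ?(ltW c0)// mulrC.
rewrite mul1r; move: (nlogq u) (qpow 1 u) (qpow m%:R u) Xu p1 pm cp {pP} => x p q Xu p1 pm cp.
have -> : c * ((x ^+ 2 - x) * p) + d * (((n * x) ^+ 2 - n * x) * (p * q)) =
   p * (c * (x ^+ 2 - x) + d * (((n * x) ^+ 2 - n * x) * q)) by ring.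
rewrite mulr_gt0//.
have z1 : 1 < n * x by nra.
have b0 : 0 < ((n * x) ^+ 2 - n * x) * q.
  by rewrite mulr_gt0//; nra.
have h1 : - 2 * (((n * x) ^+ 2 - n * x) * q) <= d * (((n * x) ^+ 2 - n * x) * q).
  by rewrite ler_pM2r.
have x2 : 4 / 9 * x ^+ 2 <= x ^+ 2 - x by nra.
have h2 : (9 / 2 * n ^+ 2 * q) * (4 / 9 * x ^+ 2) <= c * (x ^+ 2 - x).
  apply: ler_pM => //; first by rewrite !mulr_ge0 ?sqr_ge0 ?(ltW pm).
  by rewrite mulr_ge0 ?sqr_ge0.
have h3 : 0 < n * x * q by rewrite !mulr_gt0//; lra.
nra.
Qed.

Lemma y4_convex k : wconvex (- 20^-1) (y4 k).
Proof.
case: k => [|k].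
  have -> : y4 0 = qpow 1 by apply/funext => u; rewrite /y4 /=; ring.
  by apply/sconvexW/qpow_convex.
have -> : y4 k.+1 = fun u => 2^-1 ^+ k.+1 * qpow 1 u + (2 * (-1) ^+ k.+1) * qpow (k.+2 ^ 2 - 1).+1%:R u.
  by apply/funext => u; rewrite /y4 /= subr0 -subSn ?subn1.
apply/sconvexW/y4_comb_convex.
- by rewrite -signr_odd; case: (odd _); lra.
- by rewrite subn_gt0 -mulnn.
rewrite -subSn ?expn_gt0// subn1 /= natrX -exprM; exact: y_cond.
Qed.

Lemma series_geom_half2 n : series (fun k => 2^-1 ^+ k : R) n = 2 - 2 * 2^-1 ^+ n.
Proof.
elim: n => [|n IH]; first by rewrite /series /= big_geq// expr0; lra.
by rewrite seriesSr IH exprS; lra.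
Qed.

Lemma cos_pi_nat (k : nat) : cos (k%:R * (2 * pi * 2^-1)) = (-1) ^+ k :> R.
Proof.
have -> : k%:R * (2 * pi * 2^-1) = 0 + k%:R * pi :> R by field.
by rewrite cos_natpi cos0 mulr1.
Qed.

Lemma y4_cvg u : series (y4 ^~ u) @ \oo --> 1 - theta4 (expR u).
Proof.
have H := theta_cvg (x := 2^-1) (expR_gt0 u).
set g := fun k : nat => _ in H.
rewrite -(cvg_shiftS (series (y4 ^~ u))).
rewrite (_ : (fun n => series (y4 ^~ u) n.+1) = fun n => (- 2 * qpow 1 u) * 2^-1 ^+ n.+1 + (- 2) * (series g n.+2 - 1)); last first.
  apply/funext => n.
  have E : series (fun k : nat => 2 * (-1) ^+ k * qpow (k.+1 ^ 2)%:R u) n.+1 = (- 2) * (series g n.+2 - 1).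
    rewrite [in RHS]/series /= big_nat_recl//= {1}/g mul0r cos0 mulr1 gauss_qpow.
    rewrite /qpow mul0r oppr0 expR0 [1 + _]addrC addrK mulr_sumr /series /=.
    apply: eq_bigr => k _; rewrite /g cos_pi_nat gauss_qpow exprS /qpow; ring.
  rewrite -E /series /= /y4 !big_split /= -mulr_suml.
  have -> : \sum_(0 <= i < n.+1) 2^-1 ^+ i = 2 - 2 * 2^-1 ^+ n.+1 :> R by exact: series_geom_half2.
  have -> : \sum_(0 <= i < n.+1) - (if i == 0%N then 2 * qpow 1 u else 0) = - (2 * qpow 1 u).
    by rewrite big_nat_recl//= big1 ?addr0// => i _; rewrite oppr0.
  ring.
have -> : 1 - theta4 (expR u) = (- 2 * qpow 1 u) * 0 + (- 2) * ((theta (expR u) 2^-1 + 1) / 2 - 1).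
  by rewrite theta4E; move: (theta _ _) => z; lra.
apply: cvgD; apply: cvgM; try exact: cvg_cst.
  by rewrite (cvg_shiftS (fun n => 2^-1 ^+ n : R)); exact: cvg_half_pow.
apply: cvgB; last exact: cvg_cst.
have H1 : (fun n => series g n.+1) @ \oo --> (theta (expR u) 2^-1 + 1) / 2 by rewrite (cvg_shiftS (series g)).
by rewrite (cvg_shiftS (fun n => series g n.+1)).
Qed.

(** By Poisson, theta4 (1/s) = 2 sqrt s e^(- X/4) (1 + Z4), where 1 + Z4 is
    the series of q^(k (k+1)); see [z4_cvg] and [ln_theta4_inv]. *)
Definition Z4 u : R := gsum (expR u) 2^-1 / 2 * expR (nlogq u / 4) - 1.

Lemma z4_cvg u : series (fun k => qpow (k.+1 * k.+2)%:R u) @ \oo --> Z4 u.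
Proof.
have H := gsum_half_cvg (expR_gt0 u).
have E k : qpow (k * k.+1)%:R u = half_term (expR u) k * expR (nlogq u / 4).
  rewrite /half_term /gauss /qpow -expRD /nlogq; congr expR.
  by rewrite natrM -natr1; field.
rewrite (_ : series _ = fun n => series (half_term (expR u)) n.+1 * expR (nlogq u / 4) - 1).
  apply: cvgB; last exact: cvg_cst.
  by apply: cvgMl; rewrite (cvg_shiftS (series (half_term (expR u)))).
apply/funext => n; rewrite {2}/series /= mulr_suml.
under [in RHS]eq_bigr do rewrite -E.
by rewrite big_nat_recl//= mul0n /qpow mul0r oppr0 expR0 addrC addKr.
Qed.

Lemma Z4_ge0 u : 0 <= Z4 u.
Proof.
apply: (cvgr_to_ge (@z4_cvg u)); apply: nearW => n; apply: sumr_ge0 => k _.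
exact/ltW/qpow_gt0.
Qed.

(** The linear term X / 4 is distributed as a geometric series of ratio 1/16
    so that each summand alone is convex. *)
Definition g4 (k : nat) u : R := 15 / 4 * 16^-1 ^+ k.+1 * nlogq u - qpow (k.+1 * k.+2)%:R u.

(** Since e^(n X) >= (59/10)^n (1 + n (X - 19/10)), the second derivative is
    controlled on the whole half-line and not only at its left end. *)
Lemma g4_convex k : sconvex (- 20^-1) (g4 k).
Proof.
rewrite /g4; set w := 15 / 4 * _; set n := (_ * _)%:R.
have wP : 19 / 10 * n ^+ 2 <= w * (59 / 10) ^+ (k.+1 * k.+2).
  have := z_cond k; rewrite -/n /w exprVn.
  have P2 : 0 < 16 ^+ k.+1 :> R by rewrite exprn_gt0.
  have E1 : 16 ^- k.+1 * 16 ^+ k.+1 = 1 :> R by rewrite mulVf// gt_eqF.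
  move=> H; rewrite -(ler_pM2r P2).
  have -> : 15 / 4 / 16 ^+ k.+1 * (59 / 10) ^+ (k.+1 * k.+2) * 16 ^+ k.+1 =
     15 / 4 * (59 / 10) ^+ (k.+1 * k.+2) * (16 ^- k.+1 * 16 ^+ k.+1) :> R by ring.
  rewrite E1; lra.
have n2 : 2 <= n by rewrite ler_nat; lia.
apply: (@sconvex_d2 _ _ _ (fun u => w * nlogq u - (- (n * nlogq u) * qpow n u))
   (fun u => w * nlogq u - ((n * nlogq u) ^+ 2 - n * nlogq u) * qpow n u)).
- move=> u; have d1 := is_derive_nlogq u; have dn := is_derive_qpow n u.
  by apply: is_derive_eq; rewrite /GRing.scale /=; ring.
- move=> u; have d1 := is_derive_nlogq u; have dn := is_derive2_qpow n u.
  by apply: is_derive_eq; rewrite /GRing.scale /=; ring.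
move=> u hu; have Xu := nlogq_ge hu.
have p0 := qpow_gt0 n u.
pose P : R := (59 / 10) ^+ (k.+1 * k.+2).
have P0 : 0 < P by rewrite exprn_gt0//; lra.
have pP : qpow n u * P * (1 + n * (nlogq u - 19 / 10)) <= 1.
  have E1 : qpow n u * expR (n * (19 / 10)) * expR (n * (nlogq u - 19 / 10)) = 1.
    by rewrite /qpow -!expRD -[RHS]expR0; congr expR; ring.
  rewrite -[leRHS]E1; apply: ler_pM => //.
  - by rewrite mulr_ge0 ?(ltW p0) ?(ltW P0).
  - by nra.
  - rewrite ler_pM2l// /n expRM_natl; apply: lerXn2r; rewrite ?nnegrE ?expR_ge0//; exact: expR19.
  - exact: expR_ge1Dx.
have -> : w * nlogq u - ((n * nlogq u) ^+ 2 - n * nlogq u) * qpow n u =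
    nlogq u * (w - (n ^+ 2 * nlogq u - n) * qpow n u) by ring.
rewrite mulr_gt0 ?nlogq_gt0// subr_gt0 -(ltr_pM2r P0).
apply: lt_le_trans (_ : 19 / 10 * n ^+ 2 <= _) => //.
move: (nlogq u) (qpow n u) Xu p0 pP => x p Xu p0 pP.
have h : n ^+ 2 * x - n <= (19 / 10 * n ^+ 2 - n) * (1 + n * (x - 19 / 10)).
  have -> : n ^+ 2 * x - n = (19 / 10 * n ^+ 2 - n) + n ^+ 2 * (x - 19 / 10) by ring.
  have h0 : 0 <= n ^+ 2 * (19 / 10 * n - 2) by rewrite mulr_ge0 ?sqr_ge0//; lra.
  rewrite [leRHS]mulrDr mulr1 lerD2l mulrA ler_wpM2r ?subr_ge0//; lra.
have b0 : 0 < 19 / 10 * n ^+ 2 - n by nra.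
have pP0 : 0 < p * P by rewrite mulr_gt0.
apply: le_lt_trans (_ : 19 / 10 * n ^+ 2 - n < _); last lra.
apply: le_trans (_ : (19 / 10 * n ^+ 2 - n) * (1 + n * (x - 19 / 10)) * (p * P) <= _).
  by rewrite -[leLHS]mulrA ler_pM2r.
by rewrite -[leLHS]mulrA ler_piMr ?(ltW b0)// mulrC.
Qed.

Lemma series_geom16 n : series (fun k => 15 / 4 * 16^-1 ^+ k.+1 : R) n = 4^-1 * (1 - 16^-1 ^+ n).
Proof.
elim: n => [|n IH]; first by rewrite /series /= big_geq// expr0; lra.
by rewrite seriesSr IH exprS; lra.
Qed.

Lemma g4_cvg u : series (g4 ^~ u) @ \oo --> nlogq u / 4 - Z4 u.
Proof.
rewrite (_ : series _ = fun n => (4^-1 * (1 - 16^-1 ^+ n)) * nlogq u - series (fun k => qpow (k.+1 * k.+2)%:R u) n); last first.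
  by apply/funext => n; rewrite -series_geom16 /series /= mulr_suml -sumrB.
have -> : nlogq u / 4 = (4^-1 * (1 - 0)) * nlogq u by rewrite subr0 mulr1 mulrC.
apply: cvgB; last exact: z4_cvg.
apply: cvgMl; apply: cvgM; first exact: cvg_cst.
apply: cvgB; first exact: cvg_cst.
by apply: cvg_expr; rewrite ger0_norm; lra.
Qed.

Lemma nlogq_Z4_convex : sconvex (- 20^-1) (fun u => nlogq u / 4 - Z4 u).
Proof.
apply: (@series_sconvex _ _ g4); first exact: g4_convex.
  by move=> k; exact/sconvexW/g4_convex.
exact: g4_cvg.
Qed.

Lemma Y_convex : wconvex (- 20^-1) (fun u => 1 - theta4 (expR u)).
Proof. by apply: (@series_convex _ _ y4); [exact: y4_convex|exact: y4_cvg]. Qed.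

Lemma ln_tangent (p q : R) : 0 < p -> 0 < q -> ln p <= ln q + (p - q) / q.
Proof.
move=> p0 q0; rewrite -lerBlDl -ln_div ?posrE//.
have -> : p / q = 1 + (p - q) / q by field; rewrite gt_eqF.
apply: le_ln1Dx; rewrite mulrBl divff ?gt_eqF// ltrDr; exact: divr_gt0.
Qed.

Lemma ln_theta4_inv u : ln (theta4 (expR (- u))) = u / 2 + ln 2 + ln (1 + Z4 u) - nlogq u / 4.
Proof.
have t0 := gsum_half_gt0 (expR_gt0 u).
have -> : theta4 (expR (- u)) = expR (u / 2) * 2 * (1 + Z4 u) * expR (- (nlogq u / 4)).
  rewrite expRN theta4_inv ?expR_gt0// sqrt_expR /Z4 addrC subrK expRN.
  by field; rewrite gt_eqF ?expR_gt0.
have z1 : 0 < 1 + Z4 u by have := Z4_ge0 u; lra.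
by rewrite !lnM ?posrE ?mulr_gt0 ?expR_gt0// !expRK.
Qed.

(** Up to affine terms the function is - log (1 - Y) + (X / 4 - log (1 + Z4)).
    The first summand, where Y = 1 - theta4 (e^u), is convex because Y is and
    - log (1 - .) is convex and increasing. For the second, the tangent of the
    logarithm at the middle point bounds the defect of log (1 + Z4) by that of
    Z4, which is smaller than that of X / 4 by [nlogq_Z4_convex]. *)
Lemma theta4_convex (l4 : R -> R) : (forall u, l4 u = ln (theta4 (expR u))) ->
  sconvex (- 20^-1) (fun u => - (l4 u + l4 (- u))).
Proof.
move=> l4E a b t la ab t0 t1; pose c := t * a + (1 - t) * b; rewrite -/c.
have t1' : 0 < 1 - t by rewrite subr_gt0.
have l4N u : l4 (- u) = u / 2 + ln 2 + ln (1 + Z4 u) - nlogq u / 4.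
  by rewrite l4E; exact: ln_theta4_inv.
have la4 := l4E a; have lb4 := l4E b; have lc4 := l4E c.
rewrite (l4N a) (l4N b) (l4N c).
move: (l4 a) (l4 b) (l4 c) la4 lb4 lc4 => Pa' Pb' Pc' la4 lb4 lc4.
have HY := @Y_convex a b t la ab t0 t1.
have HX := @nlogq_convex R a b t la ab t0 t1.
have HW := @nlogq_Z4_convex a b t la ab t0 t1.
rewrite -/c in HY HX HW.
have cE : c / 2 = t * (a / 2) + (1 - t) * (b / 2) by rewrite /c; ring.
have Pa := theta4_gt0 (expR_gt0 a); have Pb := theta4_gt0 (expR_gt0 b); have Pc := theta4_gt0 (expR_gt0 c).
move: (Z4_ge0 a) (Z4_ge0 b) (Z4_ge0 c) => Za Zb Zc.
rewrite cE; clearbody c; clear cE.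
move: (theta4 (expR a)) (theta4 (expR b)) (theta4 (expR c)) HY Pa Pb Pc la4 lb4 lc4 => A B C HY A0 B0 C0 -> -> ->.
move: (Z4 a) (Z4 b) (Z4 c) (nlogq a) (nlogq b) (nlogq c) HX HW Za Zb Zc => za zb zc xa xb xc HX HW za0 zb0 zc0.
have m0 : 0 < t * A + (1 - t) * B by rewrite addr_gt0 ?mulr_gt0.
have h1 : t * ln A + (1 - t) * ln B <= ln C.
  apply: le_trans (_ : ln (t * A + (1 - t) * B) <= _); last first.
    by rewrite ler_ln ?posrE//; lra.
  have hA := ler_wpM2l (ltW t0) (ln_tangent A0 m0).
  have hB := ler_wpM2l (ltW t1') (ln_tangent B0 m0).
  apply: le_trans (lerD hA hB) _.
  rewrite le_eqVlt; apply/orP; left; apply/eqP; move: (ln _) => z; field; exact: lt0r_neq0.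
have zc1 : 0 < 1 + zc by lra.
have h2 : t * ln (1 + za) + (1 - t) * ln (1 + zb) - ln (1 + zc) < (t * xa + (1 - t) * xb - xc) / 4.
  have za1 : 0 < 1 + za by lra.
  have zb1 : 0 < 1 + zb by lra.
  have hA := ler_wpM2l (ltW t0) (ln_tangent za1 zc1).
  have hB := ler_wpM2l (ltW t1') (ln_tangent zb1 zc1).
  have := lerD hA hB.
  have -> : t * (ln (1 + zc) + (1 + za - (1 + zc)) / (1 + zc)) + (1 - t) * (ln (1 + zc) + (1 + zb - (1 + zc)) / (1 + zc))
     = ln (1 + zc) + (t * za + (1 - t) * zb - zc) / (1 + zc).
    by move: (ln _) => z; field; exact: lt0r_neq0.
  move: (ln (1 + za)) (ln (1 + zb)) (ln (1 + zc)) => l1 l2 l3 H.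
  apply: le_lt_trans (_ : (t * za + (1 - t) * zb - zc) / (1 + zc) < _); first lra.
  rewrite ltr_pdivrMr//.
  have e1 : 0 < t * xa + (1 - t) * xb - xc by lra.
  have e2 : t * za + (1 - t) * zb - zc < (t * xa + (1 - t) * xb - xc) / 4 by lra.
  nra.
move: (ln A) (ln B) (ln C) (ln 2) (ln (1 + za)) (ln (1 + zb)) (ln (1 + zc)) h1 h2.
move=> *; lra.
Qed.

Theorem theta4_mul_lt (s : R) : 0 < s -> s != 1 -> theta4 s * theta4 s^-1 < theta4 1 ^+ 2.
Proof.
move=> s0 s1.
have [l4 l4E] : exists f : R -> R, forall u, f u = ln (theta4 (expR u)).
  by exists (fun u => ln (theta4 (expR u))).
have evE u : - (l4 (- u) + l4 (- - u)) = - (l4 u + l4 (- u)).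
  by rewrite opprK addrC.
have u0 : ln s != 0 by apply: contra_neq s1 => h; rewrite -[s]lnK ?posrE// h expR0.
have i20 : 0 < 20^-1 :> R by rewrite invr_gt0.
have := @even_convex R _ 20^-1 i20 evE (theta4_convex l4E) 0 (ln s) u0.
rewrite add0r sub0r oppr0 opprK.
have l0 : l4 0 = ln (theta4 1) by rewrite l4E expR0.
have l1 : l4 (ln s) = ln (theta4 s) by rewrite l4E (lnK s0).
have l2 : l4 (- ln s) = ln (theta4 s^-1) by rewrite l4E expRN (lnK s0).
rewrite l0 l1 l2.
have p1 := theta4_gt0 s0; have p2 : 0 < theta4 s^-1 by rewrite theta4_gt0 ?invr_gt0.
have p3 := @theta4_gt0 R 1 ltr01.
clear l0 l1 l2 evE l4E.
move: (theta4 s) (theta4 s^-1) (theta4 1) p1 p2 p3 => A B C A0 B0 C0.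
move=> H; rewrite expr2 -ltr_ln ?posrE ?mulr_gt0// !lnM ?posrE//; move: H.
move: (ln A) (ln B) (ln C) => *; lra.
Qed.

End Theta4Concave.

(** * The Gaussian Toeplitz form and its symbol *)

Section QuadraticForm.
Context {R : realType}.
Notation mu := (@lebesgue_measure R).
Implicit Types (a : nat -> R) (s L U x : R) (N : nat).

(** The Toeplitz form with symbol [theta] s. *)
Definition gform s N a : R :=
  \sum_(i < N) \sum_(j < N) a i * a j * gauss s (ndist i j)%:R.

Definition trigsq N a x : R :=
  (\sum_(i < N) a i * cos (i%:R * (2 * pi * x))) ^+ 2 +
  (\sum_(i < N) a i * sin (i%:R * (2 * pi * x))) ^+ 2.

Lemma trigsq_ge0 N a x : 0 <= trigsq N a x.
Proof. by rewrite addr_ge0 ?sqr_ge0. Qed.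

Lemma trigsqE N a x : trigsq N a x = \sum_(i < N) \sum_(j < N)
  a i * a j * cos ((ndist i j)%:R * (2 * pi * x)).
Proof. exact: trig_square_sum. Qed.

Lemma trigsqDint N a x (p : int) : trigsq N a (x + p%:~R) = trigsq N a x.
Proof.
rewrite /trigsq; congr (_ ^+ 2 + _ ^+ 2); apply: eq_bigr => i _.
  by rewrite cosDint.
by rewrite sinDint.
Qed.

Lemma continuous_trigsq N a : continuous (trigsq N a).
Proof. by rewrite /trigsq; cts. Qed.

Lemma integral_trigsq N a : \int[mu]_(x in `[0, 1]) trigsq N a x = \sum_(i < N) a i ^+ 2.
Proof.
under eq_Rintegral do rewrite trigsqE.
rewrite Rintegral_sum//; last by move=> i; apply: integrable_itv; cts.
apply: eq_bigr => i _.
rewrite Rintegral_sum//; last by move=> j; apply: integrable_itv; cts.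
have E (j : 'I_N) : \int[mu]_(x in `[0, 1]) (a i * a j * cos ((ndist i j)%:R * (2 * pi * x))) =
    a i * a j * (if (ndist i j) == 0%N then 1 else 0).
  rewrite RintegralZl//; last by apply: integrable_itv; cts.
  congr *%R; rewrite -(integral_cos_period _ 0 ltr01); apply: eq_Rintegral => x _.
  by rewrite sub0r divr1 mulrN mulrN cosN.
under eq_bigr do rewrite E.
rewrite (bigD1 i) //= subnn addn0 eqxx mulr1 big1 ?addr0 ?expr2// => j ji.
case: ifP => //; rewrite ?mulr0// addn_eq0 !subn_eq0 -eqn_leq => /eqP ij.
by move: ji; rewrite -val_eqE /= ij eqxx.
Qed.

Lemma integral_gauss_cos s (k : nat) : 0 < s ->
  \int[mu]_x (gauss s^-1 x * cos (k%:R * (2 * pi * x))) = Num.sqrt s * gauss s k%:R.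
Proof.
move=> s0; have si : 0 < s^-1 by rewrite invr_gt0.
have := @gauss_ft R s^-1 0 0 si k%:R.
rewrite cos0 mul1r invrK sqrtrV ?(ltW s0)// invrK => <-.
apply: eq_Rintegral => x _; rewrite subr0 addr0; congr (_ * cos _); ring.
Qed.

Lemma integrable_gauss_cos s (k : nat) : 0 < s ->
  mu.-integrable setT (EFin \o (fun x => gauss s x * cos (k%:R * (2 * pi * x)))).
Proof.
move=> s0; apply: (@integrable_gauss_le _ s 0 _ 1 s0).
  by rewrite /gauss; cts.
move=> y; rewrite subr0 normrM ger0_norm ?gauss_ge0// mulrC.
by rewrite ler_wpM2r ?gauss_ge0// cos_max.
Qed.

(** The Fourier transform of exp(- pi x^2 / s) produces the entries of the
    form. *)
Lemma gform_integral s N a : 0 < s ->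
  \int[mu]_x (gauss s^-1 x * trigsq N a x) = Num.sqrt s * gform s N a.
Proof.
move=> s0; have si : 0 < s^-1 by rewrite invr_gt0.
have E x : gauss s^-1 x * trigsq N a x = \sum_(i < N) \sum_(j < N)
    a i * a j * (gauss s^-1 x * cos ((ndist i j)%:R * (2 * pi * x))).
  rewrite trigsqE mulr_sumr; apply: eq_bigr => i _; rewrite mulr_sumr.
  by apply: eq_bigr => j _; rewrite mulrCA.
under eq_Rintegral do rewrite E.
have ij i j : mu.-integrable setT (EFin \o (fun x => a i * a j * (gauss s^-1 x * cos ((ndist i j)%:R * (2 * pi * x))))).
  rewrite /comp; under eq_fun do rewrite EFinM.
  by apply: integrableZl => //; exact: integrable_gauss_cos.
rewrite Rintegral_sum//; last first.
  move=> i; rewrite /comp; under eq_fun do rewrite -sumEFin.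
  by apply: integrable_sum => // j _; exact: ij.
rewrite /gform mulr_sumr; apply: eq_bigr => i _.
rewrite Rintegral_sum// mulr_sumr; apply: eq_bigr => j _.
rewrite RintegralZl//; last exact: integrable_gauss_cos.
by rewrite integral_gauss_cos// mulrCA.
Qed.

(** Unfolding the integral over the line to a period, on which the
    trigonometric factor is constant along translates; what remains of the
    Gaussian is its periodization, that is, a multiple of the symbol. *)
Lemma gform_unfold s N a : 0 < s ->
  ((Num.sqrt s * gform s N a)%:E =
  \int[mu]_(x in `[0%R, 1%R]) (Num.sqrt s * theta s x * trigsq N a x)%:E)%E.
Proof.
move=> s0; have si : 0 < s^-1 by rewrite invr_gt0.
have cP := @continuous_trigsq N a.
have cg := @continuous_gauss R s^-1.
have [M M0 hM] := @continuous_bounded_itv R _ 0 1 ler01 cP.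
have PM x : trigsq N a x <= M.
  rewrite -[x](subrK (Num.floor x)%:~R) trigsqDint.
  apply: le_trans (ler_norm _) _; apply: hM; rewrite in_itv /=.
  have /andP[h1 h2] := floor_itv x; rewrite intrD in h2.
  by rewrite subr_ge0 h1 lerBlDl ltW.
have iF : mu.-integrable setT (EFin \o (fun x => gauss s^-1 x * trigsq N a x)).
  apply: (@integrable_gauss_le _ s^-1 0 _ M si).
    by move=> x; apply: ct_mul; [exact: cg|exact: cP].
  move=> x; rewrite subr0 normrM !ger0_norm ?gauss_ge0 ?trigsq_ge0// mulrC.
  by rewrite ler_wpM2r ?gauss_ge0.
rewrite -gform_integral// /Rintegral fineK; last exact: (integrable_fin_num _ iF).
rewrite integral_unfold; last 2 first.
- by move=> x; apply: ct_mul; [exact: cg|exact: cP].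
- by move=> x; rewrite mulr_ge0 ?gauss_ge0 ?trigsq_ge0.
have cgn n : continuous (fun x : R => gauss s^-1 (x + (zenum n)%:~R)) by rewrite /gauss; cts.
have -> : (\sum_(n <oo) \int[mu]_(x in `[0%R, 1%R]) (gauss s^-1 (x + (zenum n)%:~R) * trigsq N a (x + (zenum n)%:~R))%:E =
   \sum_(n <oo) \int[mu]_(x in `[0%R, 1%R]) (gauss s^-1 (x + (zenum n)%:~R) * trigsq N a x)%:E)%E.
  by apply: eq_eseriesr => n _; apply: eq_integral => x _; rewrite trigsqDint.
rewrite -integral_nneseries//; last 2 first.
- move=> n; apply/measurable_EFinP/measurable_funTS.
  by apply: continuous_measurable_fun => x; apply: ct_mul; [exact: cgn|exact: cP].
- by move=> n x _; rewrite lee_fin mulr_ge0 ?gauss_ge0 ?trigsq_ge0.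
apply: eq_integral => x _.
apply: series_nneseries.
  by move=> n; rewrite mulr_ge0 ?gauss_ge0 ?trigsq_ge0.
rewrite (_ : series _ = fun n => series (fun k => gauss s^-1 (x + (zenum k)%:~R)) n * trigsq N a x); last first.
  by apply/funext => n; rewrite /series /= mulr_suml.
apply: cvgMl.
have -> : Num.sqrt s * theta s x = gsum s^-1 x by rewrite (poisson x si) sqrtrV ?(ltW s0)// !invrK.
exact: gsum_cvg.
Qed.

Lemma continuous_theta s : 0 < s -> continuous (theta s).
Proof.
move=> s0 x.
have H : (fun y => limn (series (fun k => gauss s k%:R * cos (k%:R * (2 * pi * y))))) @ x -->
    limn (series (fun k => gauss s k%:R * cos (k%:R * (2 * pi * x)))).
  apply: (@tannery R R (nbhs x) _ (fun k y => gauss s k%:R * cos (k%:R * (2 * pi * y))) _ (fun k => 1 * gratio s ^+ k)).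
  - move=> k; have c : continuous (fun y : R => gauss s k%:R * cos (k%:R * (2 * pi * y))) by cts.
    exact: c.
  - by apply: nearW => y k; exact: theta_term_le.
  - exact: cvg_series_gratio.
by apply: cvgB; [apply: cvgM; [exact: cvg_cst|exact: H]|exact: cvg_cst].
Qed.

(** A form with a symbol lies between the bounds of the symbol times the
    identity. *)
Lemma gform_bounds s L U N a : 0 < s -> (forall x, L <= theta s x) -> (forall x, theta s x <= U) ->
  L * (\sum_(i < N) a i ^+ 2) <= gform s N a <= U * (\sum_(i < N) a i ^+ 2).
Proof.
move=> s0 csL csU.
have cP := @continuous_trigsq N a; have ccs := continuous_theta s0.
have sq0 : 0 < Num.sqrt s by rewrite sqrtr_gt0.
have cF : continuous (fun x => Num.sqrt s * theta s x * trigsq N a x).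
  by move=> x; apply: ct_mul; [apply: ct_mul; [exact: ct_cst|exact: ccs]|exact: cP].
have E : Num.sqrt s * gform s N a = \int[mu]_(x in `[0, 1]) (Num.sqrt s * theta s x * trigsq N a x).
  by rewrite /Rintegral -gform_unfold.
have bnd c : continuous (fun x => Num.sqrt s * c * trigsq N a x).
  by move=> x; apply: ct_mul; [exact: ct_cst|exact: cP].
have IE c : \int[mu]_(x in `[0, 1]) (Num.sqrt s * c * trigsq N a x) = Num.sqrt s * (c * (\sum_(i < N) a i ^+ 2)).
  by rewrite RintegralZl ?integral_trigsq ?mulrA//; exact: (integrable_itv _ _ cP).
rewrite -(ler_pM2l sq0) -IE E -[X in _ && X](ler_pM2l sq0) -IE E.
apply/andP; split; apply: le_Rintegral => //; try exact: (integrable_itv _ _ (bnd _)); try exact: (integrable_itv _ _ cF);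
  by move=> x _; rewrite ler_wpM2r ?trigsq_ge0// ler_pM2l.
Qed.

End QuadraticForm.

(** * Fourier coefficients over the line and over one period *)

Section Unfold.
Context {R : realType}.
Notation mu := (@lebesgue_measure R).
Implicit Types (F h : R -> R) (T a : R) (N k : nat).

Lemma Rintegral_itv_shift F c (a b : R) : a <= b -> continuous F ->
  \int[mu]_(x in `[(a + c), (b + c)]) F x = \int[mu]_(x in `[a, b]) F (x + c).
Proof. by move=> ab cF; rewrite /Rintegral integral_itv_shift. Qed.

Lemma Rintegral_itv_sum F a T N : 0 <= T -> continuous F ->
  \int[mu]_(x in `[a, a + N%:R * T]) F x =
  \sum_(m < N) \int[mu]_(x in `[0, T]) F (x + (a + m%:R * T)).
Proof.
move=> T0 cF; elim: N => [|N IH].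
  by rewrite big_ord0 mul0r addr0 set_itv1 Rintegral_set1.
have TN : 0 <= N%:R * T by rewrite mulr_ge0.
have -> : a + N.+1%:R * T = T + (a + N%:R * T) by rewrite -natr1; ring.
rewrite big_ord_recr /= -IH -[X in _ = _ + X](@Rintegral_itv_shift F (a + N%:R * T) 0 T T0 cF).
rewrite add0r.
have iF u v := @integrable_itv R F u v cF.
have := @Rintegral_itvB R F (BLeft a) (BRight (T + (a + N%:R * T))) (a + N%:R * T) (iF _ _).
rewrite !bnd_simp => /(_ _ _) H.
rewrite -[LHS](subrK (\int[mu]_(x in `[a, a + N%:R * T]) F x)) H; last 2 first.
- by rewrite lerDl.
- by rewrite lerDr.
rewrite addrC; congr (_ + _); apply: Rintegral_itv_obnd_cbnd.
by apply: integrableS (iF (a + N%:R * T) (T + (a + N%:R * T))) => // x /=; rewrite !in_itv /= => /andP[/ltW-> ->].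
Qed.

Lemma Rintegral_support F (D : set R) : (forall x, ~ D x -> F x = 0) ->
  \int[mu]_x F x = \int[mu]_(x in D) F x.
Proof.
move=> F0; rewrite [RHS]Rintegral_mkcond; apply: eq_Rintegral => x _.
by rewrite patchE; case: ifPn => // /negP; rewrite inE => /F0.
Qed.

Definition linecos T F k := \int[mu]_x (F x * cos (k%:R * (2 * pi * (x / T)))).
Definition linesin T F k := \int[mu]_x (F x * sin (k%:R * (2 * pi * (x / T)))).

Definition periodize T a N F x := \sum_(m < N) F (x + (a + m%:R * T)).

Lemma Rintegral_periodize T (A : int) N F e : 0 < T -> continuous F -> continuous e ->
  (forall x (p : int), e (x + p%:~R * T) = e x) ->
  (forall x, ~ `[A%:~R * T, A%:~R * T + N%:R * T]%classic x -> F x = 0) ->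
  \int[mu]_x (F x * e x) = \int[mu]_(x in `[0, T]) (periodize T (A%:~R * T) N F x * e x).
Proof.
move=> T0 cF ce eT F0.
rewrite (@Rintegral_support _ `[A%:~R * T, A%:~R * T + N%:R * T]); last by move=> x /F0 ->; rewrite mul0r.
rewrite (@Rintegral_itv_sum (fun x => F x * e x) _ _ _ (ltW T0)); last by cts.
rewrite /periodize; under [in RHS]eq_Rintegral do rewrite mulr_suml.
rewrite Rintegral_sum//; last first.
  by move=> m; apply: integrable_itv; cts.
apply: eq_bigr => m _; apply: eq_Rintegral => y _; congr *%R.
by rewrite -mulrDl -(eT y (A + m%:Z)) intrD.
Qed.

Lemma linecos_periodize T (A : int) N F k : 0 < T -> continuous F ->
  (forall x, ~ `[A%:~R * T, A%:~R * T + N%:R * T]%classic x -> F x = 0) ->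
  linecos T F k = fcos T (periodize T (A%:~R * T) N F) k.
Proof.
move=> T0 cF; apply: Rintegral_periodize => //; first by cts.
by move=> x p; rewrite (mulrDl x) mulfK ?gt_eqF// cosDint.
Qed.

Lemma linesin_periodize T (A : int) N F k : 0 < T -> continuous F ->
  (forall x, ~ `[A%:~R * T, A%:~R * T + N%:R * T]%classic x -> F x = 0) ->
  linesin T F k = fsin T (periodize T (A%:~R * T) N F) k.
Proof.
move=> T0 cF; apply: Rintegral_periodize => //; first by cts.
by move=> x p; rewrite (mulrDl x) mulfK ?gt_eqF// sinDint.
Qed.

Lemma continuous_periodize T a N F : continuous F -> continuous (periodize T a N F).
Proof. by move=> cF; rewrite /periodize; cts. Qed.

Lemma nneseries_subseq (u : R ^nat) (l : R) : (forall n, 0 <= u n) ->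
  (fun n => series u n.*2.+1) @ \oo --> l -> (\sum_(n <oo) (u n)%:E = l%:E)%E.
Proof.
move=> u0 ul.
have c : cvgn (fun n => \sum_(0 <= i < n) (u i)%:E)%E.
  by apply: is_cvg_nneseries => n _ _; rewrite lee_fin.
have := cvg_subseq_double true c; rewrite /=; under eq_fun do rewrite add1n sumEFin.
by move/cvg_unique; apply => //; apply: cvg_EFin; [exact: nearW|exact: ul].
Qed.

(** The sum over k runs over all integer frequencies, of absolute value
    [uphalf] k. *)
Lemma parseval_support T (A : int) N F : 0 < T -> continuous F ->
  (forall x, ~ `[A%:~R * T, A%:~R * T + N%:R * T]%classic x -> F x = 0) ->
  (\sum_(k <oo) (linecos T F (uphalf k) ^+ 2 + linesin T F (uphalf k) ^+ 2)%:E =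
  (T * \int[mu]_(x in `[0%R, T]) (periodize T (A%:~R * T) N F x ^+ 2)%R)%:E)%E.
Proof.
move=> T0 cF F0.
set h := periodize T (A%:~R * T) N F.
have ch : continuous h by exact: continuous_periodize.
pose v k := fcos T h k ^+ 2 + fsin T h k ^+ 2.
have v0 k : 0 <= v k by rewrite addr_ge0 ?sqr_ge0.
have -> : (\sum_(k <oo) (linecos T F (uphalf k) ^+ 2 + linesin T F (uphalf k) ^+ 2)%:E = \sum_(k <oo) (v (uphalf k))%:E)%E.
  by apply: eq_eseriesr => k _; rewrite (@linecos_periodize _ A N)// (@linesin_periodize _ A N).
apply: nneseries_subseq => //.
under eq_fun do rewrite series_uphalf.
have H := parseval T0 ch.
rewrite (_ : T * _ = 2 * ((T * \int[mu]_(x in `[0, T]) h x ^+ 2 + fcos T h 0 ^+ 2 + fsin T h 0 ^+ 2) / 2) - v 0%N); last by rewrite /v; lra.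
apply: cvgB; last exact: cvg_cst.
by apply: cvgM; [exact: cvg_cst|rewrite cvg_shiftS; exact: H].
Qed.

End Unfold.

(** * The Gabor energy of a compactly supported function *)

Section GaborEnergy.
Context {R : realType}.
Notation mu := (@lebesgue_measure R).
Implicit Types (phi : R -> R) (T alpha x s t : R) (A j : int) (N k : nat).

Lemma thetaDint s x A : theta s (x + A%:~R) = theta s x.
Proof.
rewrite /theta (_ : (fun k => _) = fun k => gauss s k%:R * cos (k%:R * (2 * pi * x)))//.
by apply/funext => k; rewrite cosDint.
Qed.

Lemma thetaN s x : theta s (- x) = theta s x.
Proof.
rewrite /theta (_ : (fun k => _) = fun k => gauss s k%:R * cos (k%:R * (2 * pi * x)))//.
by apply/funext => k; rewrite !mulrN cosN.
Qed.

(** By Poisson the Gaussian sum is even and periodic, so shifting and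
    reflecting the index does not matter. *)
Lemma gsum_reflect_cvg s x A : 0 < s ->
  series (fun n => gauss s (x + A%:~R - (zenum n)%:~R)) @ \oo --> gsum s x.
Proof.
move=> s0; have := @gsum_cvg R s (- (x + A%:~R)) s0.
rewrite !(poisson _ s0) thetaN thetaDint.
by under [X in series X]eq_fun do rewrite -gaussN opprD opprK.
Qed.

Definition window x : R := 2 `^ 4^-1 * gauss 1 x.

Lemma continuous_window : continuous window.
Proof. by rewrite /window /gauss; cts. Qed.

Lemma distn_sqr (i j : nat) : ((ndist i j)%:R : R) ^+ 2 = (i%:R - j%:R) ^+ 2.
Proof.
case: (leqP i j) => [ij|/ltnW ij].
  by rewrite (eqP ij) add0n natrB// -sqrrN opprB.
by rewrite (eqP ij) addn0 natrB.
Qed.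

(** The parallelogram identity: the product depends on the distance of the two
    centres and on their midpoint, the latter in units of alpha again being an
    integer shift of x / alpha. *)
Lemma window_mul alpha x A (i j : nat) z : alpha != 0 ->
  window (x + (A%:~R * (2 * alpha) + i%:R * (2 * alpha)) - alpha * z) *
  window (x + (A%:~R * (2 * alpha) + j%:R * (2 * alpha)) - alpha * z) =
  Num.sqrt 2 * (gauss (2 * alpha ^+ 2) (ndist i j)%:R *
    gauss (2 * alpha ^+ 2) (x / alpha + (A + A + i%:Z + j%:Z)%:~R - z)).
Proof.
move=> a0; rewrite /window mulrACA -powRD; last by rewrite pnatr_eq0 implybT.
have -> : (4^-1 + 4^-1 : R) = 2^-1 by lra.
rewrite powR12_sqrt//; congr *%R.
rewrite /gauss -!expRD distn_sqr !intrD -!pmulrn; congr expR.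
have [y ->] : exists y, x = alpha * y by exists (x / alpha); rewrite mulrC divfK.
rewrite (mulrAC alpha y) divff// mul1r; ring.
Qed.

Lemma periodize_series alpha phi A N x : 0 < alpha ->
  series (fun n => periodize (2 * alpha) (A%:~R * (2 * alpha)) N
     (fun t => phi t * window (t - alpha * (zenum n)%:~R)) x ^+ 2) @ \oo -->
  Num.sqrt 2 * gsum (2 * alpha ^+ 2) (x / alpha) *
    gform (2 * alpha ^+ 2) N (fun m => phi (x + (A%:~R * (2 * alpha) + m%:R * (2 * alpha)))).
Proof.
move=> a0; have an0 : alpha != 0 by rewrite gt_eqF.
have s0 : 0 < 2 * alpha ^+ 2 by rewrite mulr_gt0// exprn_gt0.
set s := 2 * alpha ^+ 2 in s0 *.
set a := fun m : nat => phi _.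
have E n : periodize (2 * alpha) (A%:~R * (2 * alpha)) N
     (fun t => phi t * window (t - alpha * (zenum n)%:~R)) x ^+ 2 =
   \sum_(i < N) \sum_(j < N) (Num.sqrt 2 * (a i * a j * gauss s (ndist i j)%:R)) *
      gauss s (x / alpha + (A + A + i%:Z + j%:Z)%:~R - (zenum n)%:~R).
  rewrite expr2 /periodize big_distrlr /=; apply: eq_bigr => i _; apply: eq_bigr => j _.
  by rewrite mulrACA window_mul// /a -/s; ring.
under [X in series X]eq_fun do rewrite E.
have -> : series (fun n => \sum_(i < N) \sum_(j < N) (Num.sqrt 2 * (a i * a j * gauss s (ndist i j)%:R)) *
      gauss s (x / alpha + (A + A + i%:Z + j%:Z)%:~R - (zenum n)%:~R)) =
  fun n => \sum_(i < N) \sum_(j < N) (Num.sqrt 2 * (a i * a j * gauss s (ndist i j)%:R)) *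
      series (fun n => gauss s (x / alpha + (A + A + i%:Z + j%:Z)%:~R - (zenum n)%:~R)) n.
  apply/funext => n; rewrite /series /= exchange_big /=; apply: eq_bigr => i _.
  by rewrite exchange_big /=; apply: eq_bigr => j _; rewrite mulr_sumr.
have -> : Num.sqrt 2 * gsum s (x / alpha) * gform s N a =
  \sum_(i < N) \sum_(j < N) (Num.sqrt 2 * (a i * a j * gauss s (ndist i j)%:R)) * gsum s (x / alpha).
  rewrite mulrAC /gform !mulr_sumr mulr_suml; apply: eq_bigr => i _.
  by rewrite !mulr_sumr mulr_suml; apply: eq_bigr => j _.
apply: cvg_big => [|i _]; first exact: add_continuous.
apply: cvg_big => [|j _]; first exact: add_continuous.
by apply: cvgMr; exact: gsum_reflect_cvg.
Qed.

(** The squared modulus of a Gabor coefficient of a real function; it is even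
    in the frequency, so a natural number k is enough. *)
Definition energy alpha T phi j k : R :=
  linecos T (fun t => phi t * window (t - alpha * j%:~R)) k ^+ 2 +
  linesin T (fun t => phi t * window (t - alpha * j%:~R)) k ^+ 2.

Lemma energy_ge0 alpha T phi j k : 0 <= energy alpha T phi j k.
Proof. by rewrite addr_ge0// sqr_ge0. Qed.

(** The frame sum of a real function, over translations [zenum] n and
    frequencies of absolute value [uphalf] k. *)
Definition gabor_energy alpha T phi : \bar R :=
  (\sum_(n <oo) \sum_(k <oo) (energy alpha T phi (zenum n) (uphalf k))%:E)%E.

Lemma gform_ge0 s N a : 0 < s -> 0 <= gform s N a.
Proof.
move=> s0; have si : 0 < s^-1 by rewrite invr_gt0.
have : 0 <= Num.sqrt s * gform s N a.
  rewrite -gform_integral//; apply: Rintegral_ge0 => // x _.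
  by rewrite mulr_ge0 ?gauss_ge0 ?trigsq_ge0.
by rewrite pmulr_rge0// sqrtr_gt0.
Qed.

(** For each translation Parseval gives the energy of the periodization over
    one period, and the sum over the translations is taken under the integral
    sign. *)
Lemma gabor_energyE alpha phi A N : 0 < alpha -> continuous phi ->
  (forall x, ~ `[A%:~R * (2 * alpha), A%:~R * (2 * alpha) + N%:R * (2 * alpha)]%classic x -> phi x = 0) ->
  (gabor_energy alpha (2 * alpha) phi = (2 * alpha)%:E *
   \int[mu]_(x in `[0%R, (2 * alpha)%R]) (Num.sqrt 2 * gsum (2 * alpha ^+ 2) (x / alpha) *
    gform (2 * alpha ^+ 2) N (fun m => phi (x + (A%:~R * (2 * alpha) + m%:R * (2 * alpha)))))%:E)%E.
Proof.
move=> a0 cphi phi0; have T0 : 0 < 2 * alpha by rewrite mulr_gt0.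
set T := 2 * alpha in T0 phi0 *.
pose F (n : nat) t := phi t * window (t - alpha * (zenum n)%:~R).
have cF n : continuous (F n).
  by rewrite /F => x; apply: ct_mul; [exact: cphi|apply: (ct_comp continuous_window)];
     rewrite /continuous_at; apply: cvgB; [exact: cvg_id|exact: cvg_cst].
have cw n := @continuous_periodize R T (A%:~R * T) N _ (cF n).
have cw2 n : continuous (fun x => periodize T (A%:~R * T) N (F n) x ^+ 2).
  by move=> x; apply: ct_sqr; exact: cw.
rewrite /gabor_energy.
have -> : (\sum_(n <oo) \sum_(k <oo) (energy alpha T phi (zenum n) (uphalf k))%:E =
   \sum_(n <oo) (T%:E * \int[mu]_(x in `[0%R, T]) (periodize T (A%:~R * T) N (F n) x ^+ 2)%:E))%E.
  apply: eq_eseriesr => n _.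
  rewrite (@parseval_support _ T A N (F n))//; last by move=> x /phi0 e; rewrite /F e mul0r.
  by rewrite EFinM /Rintegral fineK//; apply: integrable_fin_num => //; exact: (integrable_itv _ _ (cw2 n)).
rewrite nneseriesZl; last by move=> n _; apply: integral_ge0 => x _; rewrite lee_fin sqr_ge0.
congr (_ * _)%E.
rewrite -integral_nneseries//; last 2 first.
- move=> n; apply/measurable_EFinP/measurable_funTS.
  exact: continuous_measurable_fun.
- by move=> n x _; rewrite lee_fin sqr_ge0.
apply: eq_integral => x _; apply: series_nneseries; first by move=> n; rewrite sqr_ge0.
exact: periodize_series.
Qed.

End GaborEnergy.

(** * Density of continuous functions of bounded support in L2 *)

Section SquareIntegrable.
Context {R : realType}.
Notation mu := (@lebesgue_measure R).
Implicit Types (u v w g f : R -> R).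

Definition normsq u : R := \int[mu]_x u x ^+ 2.

Definition L2 u := measurable_fun setT u /\ mu.-integrable setT (EFin \o (fun x => u x ^+ 2)).

Lemma normsq_ge0 u : 0 <= normsq u.
Proof. by apply: Rintegral_ge0 => // x _; exact: sqr_ge0. Qed.

Lemma integrable_bound (D : set R) f g : measurable D -> measurable_fun D f ->
  (forall x, D x -> `|f x| <= g x) -> mu.-integrable D (EFin \o g) -> mu.-integrable D (EFin \o f).
Proof.
move=> mD mf fg; apply: le_integrable => //; first exact/measurable_EFinP.
by move=> x Dx /=; rewrite lee_fin (le_trans (fg _ Dx))// ler_norm.
Qed.

Lemma L2_bound u g : measurable_fun setT u -> L2 g -> (forall x, `|u x| <= `|g x|) -> L2 u.
Proof.
move=> mu_ [mg ig] ug; split => //; apply: integrable_bound ig => //.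
  exact: measurable_funX.
by move=> x _; rewrite ger0_norm ?sqr_ge0// -ler_sqrt ?sqr_ge0// !sqrtr_sqr.
Qed.

Lemma L2_lin u v (a : R) : L2 u -> L2 v -> L2 (fun x => u x + a * v x).
Proof.
move=> [mu_ iu] [mv iv]; split.
  by apply: measurable_funD => //; apply: measurable_funM.
have H : mu.-integrable setT (EFin \o (fun x => 2 * u x ^+ 2 + 2 * a ^+ 2 * v x ^+ 2)).
  rewrite /comp; under eq_fun do rewrite EFinD !EFinM.
  by apply: integrableD => //; apply: integrableZl.
apply: integrable_bound H => //.
  by apply: measurable_funX; apply: measurable_funD => //; apply: measurable_funM.
move=> x _; rewrite ger0_norm ?sqr_ge0//.
have := sqr_ge0 (u x - a * v x); nra.
Qed.

Lemma L2B u v : L2 u -> L2 v -> L2 (fun x => u x - v x).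
Proof.
move=> Lu Lv; have := L2_lin (-1) Lu Lv.
by under eq_fun do rewrite mulN1r.
Qed.

Lemma L2_mul u v : L2 u -> L2 v -> mu.-integrable setT (EFin \o (fun x => u x * v x)).
Proof.
move=> [mu_ iu] [mv iv].
have H : mu.-integrable setT (EFin \o (fun x => u x ^+ 2 + v x ^+ 2)).
  by rewrite /comp; under eq_fun do rewrite EFinD; apply: integrableD.
apply: integrable_bound H => //; first exact: measurable_funM.
move=> x _; rewrite ler_norml; have := sqr_ge0 (u x - v x); have := sqr_ge0 (u x + v x).
by move=> h1 h2; apply/andP; split; nra.
Qed.

Lemma normsq_lin u v (a : R) : L2 u -> L2 v ->
  normsq (fun x => u x + a * v x) = normsq u + 2 * a * (\int[mu]_x (u x * v x)) + a ^+ 2 * normsq v.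
Proof.
move=> Lu Lv; have iuv := L2_mul Lu Lv; case: (Lu) => mu_ iu; case: (Lv) => mv iv.
rewrite /normsq; under eq_Rintegral => x _.
  rewrite (_ : _ ^+ 2 = u x ^+ 2 + 2 * a * (u x * v x) + a ^+ 2 * v x ^+ 2); last by ring.
  over.
have i2 : mu.-integrable setT (EFin \o (fun x => 2 * a * (u x * v x))).
  by rewrite /comp; under eq_fun do rewrite EFinM; apply: integrableZl.
have i3 : mu.-integrable setT (EFin \o (fun x => a ^+ 2 * v x ^+ 2)).
  by rewrite /comp; under eq_fun do rewrite EFinM; apply: integrableZl.
rewrite RintegralD//; last first.
  by rewrite /comp; under eq_fun do rewrite EFinD; apply: integrableD.
by rewrite RintegralD// !RintegralZl.
Qed.

(** With a bound K on the norm of g in place of the norm, so that g = 0 needs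
    no separate treatment. *)
Lemma cauchy_schwarz u g (K : R) : L2 u -> L2 g -> normsq g <= K -> 0 < K ->
  (\int[mu]_x (u x * g x)) ^+ 2 <= K * normsq u.
Proof.
move=> Lu Lg gK K0; set I := \int[mu]_x _.
have := normsq_ge0 (fun x => u x + (- (I / K)) * g x).
rewrite normsq_lin// -/I => H.
have H2 : (I / K) ^+ 2 * normsq g <= (I / K) ^+ 2 * K by rewrite ler_wpM2l ?sqr_ge0.
have E1 : (I / K) ^+ 2 * K = I ^+ 2 / K by field; rewrite gt_eqF.
have E2 : 2 * - (I / K) * I = - 2 * (I ^+ 2 / K) by field; rewrite gt_eqF.
rewrite mulrC -ler_pdivrMr//; move: H H2; rewrite sqrrN E1 E2.
by move: (normsq u) (I ^+ 2 / K) ((I / K) ^+ 2 * normsq g) => a b c; lra.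
Qed.

Lemma normsqB_le u v w : L2 (fun x => u x - v x) -> L2 (fun x => v x - w x) ->
  normsq (fun x => u x - w x) <= 2 * normsq (fun x => u x - v x) + 2 * normsq (fun x => v x - w x).
Proof.
move=> L1 L2'.
have -> : (fun x => u x - w x) = (fun x => (u x - v x) + 1 * (v x - w x)).
  by apply/funext => x; rewrite mul1r; ring.
have := normsq_ge0 (fun x => (u x - v x) + -1 * (v x - w x)).
rewrite !normsq_lin//; lra.
Qed.

Lemma L2_cts_support (phi : R -> R) (M : R) : 0 <= M -> continuous phi -> (forall x, M <= `|x| -> phi x = 0) -> L2 phi.
Proof.
move=> M0 cphi phi0; split; first exact: continuous_measurable_fun.
have c2 : continuous (fun x => phi x ^+ 2) by move=> x; apply: ct_sqr; exact: cphi.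
rewrite (_ : _ \o _ = (EFin \o (fun x => phi x ^+ 2)) \_ `[- M, M]).
  exact: (proj1 (@integrable_mkcond _ _ R mu `[- M, M]%classic (EFin \o (fun x : R => phi x ^+ 2)) (measurable_itv _)) (integrable_itv _ _ c2)).
apply/funext => x; rewrite patchE; case: ifPn => // /negP; rewrite inE /= in_itv /=.
move=> /negP; rewrite -ler_norml -ltNge => /ltW/phi0 -> /=.
by rewrite expr0n.
Qed.

Definition trunc u (N : nat) x := if (`|x| <= N%:R) && (`|u x| <= N%:R) then u x else 0.

Lemma measurable_trunc u N : measurable_fun setT u -> measurable_fun setT (trunc u N).
Proof.
move=> mu_; apply: measurable_fun_ifT => //.
apply: measurable_and; apply: measurable_fun_ler => //; exact: measurableT_comp.
Qed.

Lemma trunc_le u N x : `|trunc u N x| <= `|u x|.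
Proof. by rewrite /trunc; case: ifP => // _; rewrite normr0. Qed.

Lemma trunc_leN u N x : `|trunc u N x| <= N%:R.
Proof. by rewrite /trunc; case: ifP => [/andP[]//|_]; rewrite normr0. Qed.

Lemma trunc_out u N x : N%:R < `|x| -> trunc u N x = 0.
Proof. by move=> Nx; rewrite /trunc leNgt Nx. Qed.

Lemma normsq_trunc_cvg u : L2 u -> (fun N => normsq (fun x => u x - trunc u N x)) @ \oo --> (0 : R).
Proof.
move=> [mu_ iu].
have mt N := measurable_trunc N mu_.
have mB N : measurable_fun setT (fun x => u x - trunc u N x) by exact: measurable_funB mu_ (mt N).
have H : ((fun N => \int[mu]_x ((u x - trunc u N x) ^+ 2)%:E) @ \oo --> 0)%E.
  have H2 := @dominated_cvg _ _ R mu setT measurableT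
    (fun N x => ((u x - trunc u N x) ^+ 2)%:E) (cst 0%E) (fun x => (u x ^+ 2)%:E).
  rewrite -(integral0 mu setT); apply: H2 => //.
  - by move=> N; apply/measurable_EFinP; exact: measurable_funX (mB N).
  - move=> x _; apply: cvg_near_cst; near=> N.
    rewrite /trunc ifT ?subrr ?expr0n//; apply/andP; split; near: N; exact: nbhs_infty_ger.
  - move=> N x _ /=; rewrite lee_fin ger0_norm ?sqr_ge0// /trunc; case: ifP => _.
      by rewrite subrr expr0n sqr_ge0.
    by rewrite subr0.
exact: fine_cvg H.
Unshelve. all: by end_near. Qed.

(** The nearest point of [- M, M], written with absolute values to make its
    continuity evident. *)
Definition clip (M y : R) := (`|y + M| - `|y - M|) / 2.

Lemma clip_le M y : 0 <= M -> `|clip M y| <= M.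
Proof. by rewrite /clip => M0; rewrite ler_norml; case: (ger0P (y + M)) => h1; case: (ger0P (y - M)) => h2; lra. Qed.

Lemma clip_id M y : `|y| <= M -> clip M y = y.
Proof. by rewrite /clip ler_norml => /andP[h1 h2]; rewrite ger0_norm ?ler0_norm; lra. Qed.

Lemma clip_lip M y z : 0 <= M -> `|clip M y - clip M z| <= `|y - z|.
Proof.
rewrite /clip => M0; rewrite ler_norml.
by case: (ger0P (y + M)) => h1; case: (ger0P (y - M)) => h2;
  case: (ger0P (z + M)) => h3; case: (ger0P (z - M)) => h4; case: (ger0P (y - z)) => h5; lra.
Qed.

Lemma clip1_ge y : 1 <= y -> clip 1 y = 1.
Proof. by rewrite /clip => y1; rewrite !ger0_norm; lra. Qed.

Lemma clip1_le y : y <= -1 -> clip 1 y = -1.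
Proof. by rewrite /clip => y1; rewrite !ler0_norm; lra. Qed.

Definition cutoff (M x : R) := (1 + clip 1 (2 * (M + 1 - `|x|) - 1)) / 2.

Lemma cutoff_in M x : `|x| <= M -> cutoff M x = 1.
Proof. by move=> xM; rewrite /cutoff clip1_ge; lra. Qed.

Lemma cutoff_out M x : M + 1 <= `|x| -> cutoff M x = 0.
Proof. by move=> xM; rewrite /cutoff clip1_le; lra. Qed.

Lemma cutoff_01 M x : 0 <= cutoff M x <= 1.
Proof. by have := @clip_le 1 (2 * (M + 1 - `|x|) - 1) ler01; rewrite ler_norml /cutoff; lra. Qed.

(** For functions bounded by N the L2 error is controlled by the L1 error;
    this is why truncation comes first. *)
Lemma clip_cutoff_approx (N y z x : R) : 0 <= N -> `|y| <= N -> (N < `|x| -> y = 0) ->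
  (y - clip N z * cutoff N x) ^+ 2 <= 2 * N * `|y - z|.
Proof.
move=> N0 yN y0.
have cl := clip_lip y z N0; rewrite (clip_id yN) in cl.
have cN := clip_le z N0.
suff H : `|y - clip N z * cutoff N x| <= `|y - z|.
  have h2 : `|y - clip N z * cutoff N x| <= 2 * N.
    apply: le_trans (ler_normB _ _) _; rewrite mulr2n mulrDl mul1r lerD// normrM.
    have /andP[c0 c1] := cutoff_01 N x.
    by rewrite (ger0_norm c0); apply: le_trans cN; rewrite ler_piMr.
  by rewrite -real_normK ?num_real// expr2; apply: ler_pM.
case: (lerP `|x| N) => [/cutoff_in ->|xN]; first by rewrite mulr1.
rewrite (y0 xN) !sub0r !normrN normrM; have /andP[c0 c1] := cutoff_01 N x.
rewrite (ger0_norm c0); rewrite (y0 xN) !sub0r !normrN in cl.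
by apply: le_trans cl; rewrite ler_piMr.
Qed.

Lemma cc_dense_trunc u (N : nat) (e : R) : measurable_fun setT u -> 0 < e ->
  exists phi : R -> R, [/\ continuous phi, forall x, N%:R + 1 <= `|x| -> phi x = 0 &
    normsq (fun x => trunc u N x - phi x) <= e].
Proof.
move=> mu_ e0; set U := trunc u N; have mU : measurable_fun setT U by exact: measurable_trunc.
set E := (`[- (N%:R + 1), N%:R + 1] : set R)%classic.
have iU : mu.-integrable E (EFin \o U).
  apply: (@integrable_bound _ _ (fun=> N%:R)) => //.
  - exact: measurable_itv.
  - exact: measurable_funTS.
  - by move=> x _; exact: trunc_leN.
  - exact: (@integrable_itv R (fun=> N%:R) _ _ (@cst_continuous _ _ _)).
have [g [cg ig gU]] := @approximation_continuous_integrable R E U (measurable_itv _)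
  (compact_finite_measure (@segment_compact _ _ _)) iU.
have e1 : 0 < e / (2 * N%:R + 1) by rewrite divr_gt0// ltr_pwDr// mulr_ge0.
(* The denominator 2 N + 1 instead of 2 N admits N = 0. *)
have [n Hn] : exists n, (\int[mu]_(z in E) `|(U z - g n z)%:E| < (e / (2 * N%:R + 1))%:E)%E.
  have /fine_cvgP[[m _ hm] /cvgr_lt /(_ _ e1)[p _ hp]] := gU.
  exists (m + p)%N; rewrite -[X in (X < _)%E]fineK; last by apply: hm; rewrite /= leq_addr.
  by rewrite lte_fin; apply: hp; rewrite /= leq_addl.
have cc (h : R -> R) : continuous h -> continuous (fun x => clip N%:R (h x) * cutoff N%:R x).
  by move=> ch; rewrite /cutoff /clip; cts.
exists (fun x => clip N%:R (g n x) * cutoff N%:R x); split; first exact: cc.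
- by move=> x xN; rewrite cutoff_out// mulr0.
set phi := fun x => clip N%:R (g n x) * cutoff N%:R x.
have N0 : 0 <= N%:R :> R by [].
have H x : (U x - phi x) ^+ 2 <= 2 * N%:R * `|U x - g n x|.
  by apply: clip_cutoff_approx => //; [exact: trunc_leN|exact: trunc_out].
have mUg : measurable_fun setT (fun x => U x - g n x).
  by apply: measurable_funB => //; exact: continuous_measurable_fun.
have cphi : continuous phi by exact: cc.
have mUp : measurable_fun setT (fun x => (U x - phi x) ^+ 2).
  by apply: measurable_funX; apply: measurable_funB => //; exact: continuous_measurable_fun.
have F1 : (\int[mu]_x ((U x - phi x) ^+ 2)%:E = \int[mu]_(x in E) ((U x - phi x) ^+ 2)%:E)%E.
  rewrite [RHS]integral_mkcond; apply: eq_integral => x _; rewrite patchE.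
  case: ifPn => // /negP; rewrite inE /E /= in_itv /= => /negP.
  rewrite -ler_norml -ltNge => h.
  by rewrite /U trunc_out ?(lt_trans _ h) ?ltrDl// /phi cutoff_out ?(ltW h)// mulr0 subr0 expr0n.
have F2 : (\int[mu]_x ((U x - phi x) ^+ 2)%:E <= (2 * N%:R)%:E * \int[mu]_(x in E) `|(U x - g n x)%:E|)%E.
  rewrite F1 -ge0_integralZl//; last 2 first.
  - exact: measurable_itv.
  - by apply/measurableT_comp => //; apply/measurable_EFinP; exact: measurable_funTS.
  apply: ge0_le_integral => //.
  - exact: measurable_itv.
  - by move=> x _; rewrite lee_fin sqr_ge0.
  - by apply/measurable_EFinP; exact: measurable_funTS.
  - apply: measurable_funeM; apply/measurableT_comp => //; apply/measurable_EFinP; exact: measurable_funTS.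
  - by move=> x _; rewrite -EFinM lee_fin H.
have F3 : (\int[mu]_x ((U x - phi x) ^+ 2)%:E <= e%:E)%E.
  apply: le_trans F2 _; apply: (@le_trans _ _ ((2 * N%:R)%:E * (e / (2 * N%:R + 1))%:E)%E).
    by apply: lee_wpmul2l; [rewrite lee_fin mulr_ge0|exact: ltW].
  by rewrite -EFinM lee_fin mulrA ler_pdivrMr ?ltr_pwDr ?mulr_ge0// mulrC ler_wpM2l ?(ltW e0)// lerDl.
rewrite /normsq /Rintegral -lee_fin fineK// ge0_fin_numE; first exact: le_lt_trans F3 (ltry _).
by apply: integral_ge0 => x _; rewrite lee_fin sqr_ge0.
Qed.

(** Truncation followed by the density of continuous functions in L1 of an
    interval. *)
Lemma cc_dense u : L2 u -> exists phi : nat -> R -> R,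
  [/\ forall p, continuous (phi p),
      forall p, exists N : nat, forall x, N%:R + 1 <= `|x| -> phi p x = 0 &
      (fun p => normsq (fun x => u x - phi p x)) @ \oo --> (0 : R)].
Proof.
move=> Lu; have [mu_ iu] := Lu.
have pos p : 0 < (p.+1%:R^-1 : R) by rewrite invr_gt0.
pose phi p := projT1 (cid (@cc_dense_trunc u p _ mu_ (pos p))).
have hphi p : [/\ continuous (phi p), forall x, p%:R + 1 <= `|x| -> phi p x = 0 &
    normsq (fun x => trunc u p x - phi p x) <= p.+1%:R^-1].
  exact: projT2 (cid (@cc_dense_trunc u p _ mu_ (pos p))).
have Lt p : L2 (trunc u p) by apply: L2_bound Lu _; [exact: measurable_trunc|exact: trunc_le].
have Lp p : L2 (phi p).
  by have [c s _] := hphi p; apply: (L2_cts_support _ c s); rewrite addr_ge0.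
exists phi; split.
- by move=> p; have [] := hphi p.
- by move=> p; exists p; have [] := hphi p.
have T := normsq_trunc_cvg Lu.
have T2 : (fun p => 2 * normsq (fun x => u x - trunc u p x) + 2 * p.+1%:R^-1) @ \oo --> (0 : R).
  rewrite [X in _ --> X](_ : 0 = 2 * 0 + 2 * 0 :> R); last by rewrite mulr0 addr0.
  apply: cvgD; (apply: cvgM; first exact: cvg_cst); [exact: T|].
  exact: cvg_harmonic.
apply: (@squeeze_cvgr _ _ _ _ (fun=> 0) _ _ _ _ (cvg_cst _) T2); apply: nearW => p; rewrite normsq_ge0 /=.
have [_ _ h] := hphi p.
apply: le_trans (normsqB_le (v := trunc u p) _ _) _; try exact: L2B.
by rewrite lerD2l ler_pM2l.
Qed.

End SquareIntegrable.

(** * Frame bounds and their extension to L2 *)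

Section FrameBounds.
Context {R : realType}.
Notation mu := (@lebesgue_measure R).
Implicit Types (phi u v w : R -> R) (alpha T A B L : R).

Definition bounded_support phi := exists N : nat, forall x, N%:R + 1 <= `|x| -> phi x = 0.

Lemma support_itv phi T : 0 < T -> bounded_support phi -> exists (A : int) (N : nat),
  forall x, ~ `[A%:~R * T, A%:~R * T + N%:R * T]%classic x -> phi x = 0.
Proof.
move=> T0 [N hN]; pose K := Num.bound ((N%:R + 1) / T).
have NK : N%:R + 1 <= K%:R * T.
  rewrite -ler_pdivrMr//; apply/ltW/archi_boundP.
  by rewrite divr_ge0 ?addr_ge0// ltW.
exists (- K%:Z), (K + K)%N => x; rewrite /= in_itv /= => h; apply: hN; apply: le_trans NK _.
rewrite leNgt; apply: contra_notN h => /ltW; rewrite ler_norml mulrNz -pmulrn natrD mulrDl mulNr.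
by rewrite addrA addNr add0r.
Qed.

Lemma sqrt_scale alpha : 0 < alpha -> Num.sqrt (2 * alpha ^+ 2) = Num.sqrt 2 * alpha.
Proof. by move=> a0; rewrite sqrtrM// sqrtr_sqr gtr0_norm. Qed.

Lemma sqrt2_gsum alpha x : 0 < alpha ->
  Num.sqrt 2 * gsum (2 * alpha ^+ 2) x = alpha^-1 * theta (2 * alpha ^+ 2)^-1 x.
Proof.
move=> a0; rewrite poisson; last by rewrite mulr_gt0// exprn_gt0.
rewrite sqrt_scale// mulrA; congr (_ * _).
have h : 0 < Num.sqrt 2 :> R by rewrite sqrtr_gt0.
by rewrite invfM mulrA divff ?mul1r// gt_eqF.
Qed.

Lemma normsq_periodize phi (a T : R) (N : nat) : 0 <= T -> continuous phi ->
  (forall x, ~ `[a, a + N%:R * T]%classic x -> phi x = 0) ->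
  \int[mu]_(x in `[0, T]) (\sum_(m < N) phi (x + (a + m%:R * T)) ^+ 2) = normsq phi.
Proof.
move=> T0 cphi phi0; rewrite /normsq.
have c2 : continuous (fun x => phi x ^+ 2) by move=> x; apply: ct_sqr; exact: cphi.
rewrite (@Rintegral_support _ _ `[a, a + N%:R * T]); last by move=> x /phi0 ->; rewrite expr0n.
rewrite (Rintegral_itv_sum _ _ T0 c2) Rintegral_sum// => m.
by apply: integrable_itv; cts.
Qed.

(** The factor 2 is T sqrt 2 / sqrt s; the remaining integral over one period
    of the squares of the samples is the norm. *)
Lemma gabor_energy_bounds alpha phi L L' : 0 < alpha -> continuous phi -> bounded_support phi ->
  0 <= L -> 0 <= L' ->
  (forall x, L <= theta (2 * alpha ^+ 2) x) -> (forall x, L' <= theta (2 * alpha ^+ 2)^-1 x) ->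
  ((2 * (L * L') * normsq phi)%:E <= gabor_energy alpha (2 * alpha) phi <=
   (2 * (theta3 (2 * alpha ^+ 2) * theta3 (2 * alpha ^+ 2)^-1) * normsq phi)%:E)%E.
Proof.
move=> a0 cphi sphi L0 L'0 HL HL'.
have T0 : 0 < 2 * alpha by rewrite mulr_gt0.
have s0 : 0 < 2 * alpha ^+ 2 by rewrite mulr_gt0// exprn_gt0.
have si : 0 < (2 * alpha ^+ 2)^-1 by rewrite invr_gt0.
have [A [N phi0]] := support_itv T0 sphi.
rewrite (gabor_energyE a0 cphi phi0).
set s := 2 * alpha ^+ 2 in s0 si HL HL' *; set T := 2 * alpha in T0 phi0 *.
set a := A%:~R * T in phi0 *.
pose S x := \sum_(m < N) phi (x + (a + m%:R * T)) ^+ 2.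
have cS : continuous S by rewrite /S; cts.
have S0 x : 0 <= S x by apply: sumr_ge0 => m _; exact: sqr_ge0.
pose G x := Num.sqrt 2 * gsum s (x / alpha) * gform s N (fun m => phi (x + (a + m%:R * T))).
have GE x : G x = alpha^-1 * theta s^-1 (x / alpha) * gform s N (fun m => phi (x + (a + m%:R * T))).
  by rewrite /G -/s sqrt2_gsum.
have ai : 0 <= alpha^-1 by rewrite invr_ge0 ltW.
have cth := continuous_theta si.
have cG : continuous G.
  by rewrite (funext GE) /gform; cts.
have mE (f : R -> R) : continuous f -> measurable_fun `[0, T] (EFin \o f).
  by move=> cf; apply/measurable_EFinP; apply: measurable_funTS; exact: continuous_measurable_fun.
have IS c : ((2 * c * normsq phi)%:E = T%:E * \int[mu]_(x in `[0%R, T]) (alpha^-1 * c * S x)%:E)%E.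
  have cc : continuous (fun x => alpha^-1 * c * S x) by cts.
  have -> : (\int[mu]_(x in `[0%R, T]) (alpha^-1 * c * S x)%:E = (alpha^-1 * c * normsq phi)%:E)%E.
    rewrite -(normsq_periodize (ltW T0) cphi phi0) -RintegralZl//; last exact: (integrable_itv _ _ cS).
    by rewrite /Rintegral fineK//; apply: integrable_fin_num => //; exact: (integrable_itv _ _ cc).
  by rewrite -EFinM; congr EFin; rewrite /T; field; rewrite gt_eqF.
have quadB x := @gform_bounds R s L (theta3 s) N (fun m => phi (x + (a + m%:R * T))) s0 HL
   (fun y => theta_le_theta3 y s0).
rewrite !IS; apply/andP; split; apply: lee_wpmul2l; rewrite ?lee_fin ?(ltW T0)//; apply: ge0_le_integral => //.
- by move=> x _; rewrite lee_fin !mulr_ge0.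
- by apply: mE; cts.
- by apply: mE.
- move=> x _; rewrite lee_fin -/(G x) GE -!mulrA ler_wpM2l// mulrA [L * L']mulrC -mulrA; apply: ler_pM => //.
    by rewrite mulr_ge0.
  by have /andP[] := quadB x.
- move=> x _; rewrite lee_fin -/(G x) GE; apply: mulr_ge0; last exact: gform_ge0.
  by apply: mulr_ge0 => //; exact: le_trans L'0 _.
- exact: mE.
- by apply: mE; cts.
- move=> x _; rewrite lee_fin -/(G x) GE -!mulrA ler_wpM2l// mulrA [theta3 s * _]mulrC -mulrA; apply: ler_pM => //.
  + exact: le_trans L'0 _.
  + exact: gform_ge0.
  + exact: theta_le_theta3.
  + by have /andP[] := quadB x.
Qed.

Lemma window_L2 (c : R) : L2 (fun t => window (t - c)) /\ exists2 K : R, 0 < K & normsq (fun t => window (t - c)) <= K.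
Proof.
have cg : continuous (fun t => window (t - c)) by rewrite /window /gauss; cts.
split; last by exists (normsq (fun t => window (t - c)) + 1); rewrite ?lerDl// ltr_wpDl// normsq_ge0.
split; first exact: continuous_measurable_fun.
apply: (@integrable_gauss_le R 1 c _ ((2 `^ 4^-1) ^+ 2) ltr01).
  by move=> x; apply: ct_sqr; exact: cg.
move=> x; rewrite /window ger0_norm ?sqr_ge0// exprMn ler_wpM2l ?sqr_ge0//.
rewrite expr2 ler_piMr ?gauss_ge0// /gauss -[leRHS]expR0 ler_expR lerNl oppr0.
by rewrite mulr1 mulr_ge0 ?sqr_ge0 ?pi_ge0.
Qed.

Lemma window_trig_L2 (c : R) (e : R -> R) : continuous e -> (forall t, `|e t| <= 1) ->
  L2 (fun t => window (t - c) * e t) /\ exists2 K : R, 0 < K & normsq (fun t => window (t - c) * e t) <= K.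
Proof.
move=> ce e1.
have H : L2 (fun t => window (t - c) * e t).
  apply: L2_bound (window_L2 c).1 _.
    by apply: continuous_measurable_fun; rewrite /window /gauss; cts.
  by move=> x; rewrite normrM ler_piMr.
by split=> //; exists (normsq (fun t => window (t - c) * e t) + 1); rewrite ?lerDl// ltr_wpDl// normsq_ge0.
Qed.


Definition pairing u (e : R -> R) := \int[mu]_x (u x * e x).

Lemma pairingB u v (e : R -> R) : L2 u -> L2 v -> L2 e -> pairing (fun x => u x - v x) e = pairing u e - pairing v e.
Proof.
move=> Lu Lv Le; rewrite /pairing -RintegralB//; try exact: L2_mul.
by apply: eq_Rintegral => x _; rewrite mulrBl.
Qed.

Definition window_cos alpha T (j : int) (k : nat) t :=
  window (t - alpha * j%:~R) * cos (k%:R * (2 * pi * (t / T))).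
Definition window_sin alpha T (j : int) (k : nat) t :=
  window (t - alpha * j%:~R) * sin (k%:R * (2 * pi * (t / T))).

Lemma energyE alpha T u j k : energy alpha T u j k =
  pairing u (window_cos alpha T j k) ^+ 2 + pairing u (window_sin alpha T j k) ^+ 2.
Proof.
by congr (_ ^+ 2 + _ ^+ 2); apply: eq_Rintegral => x _; rewrite -mulrA.
Qed.

Lemma window_cos_L2 alpha T j k : L2 (window_cos alpha T j k).
Proof. by apply: (window_trig_L2 _ _ _).1; [cts|move=> t; exact: cos_max]. Qed.

Lemma window_sin_L2 alpha T j k : L2 (window_sin alpha T j k).
Proof. by apply: (window_trig_L2 _ _ _).1; [cts|move=> t; exact: sin_max]. Qed.

Lemma pairing_cvg u (e : R -> R) (phi : nat -> R -> R) : L2 u -> L2 e -> (forall p, L2 (phi p)) ->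
  (fun p => normsq (fun x => u x - phi p x)) @ \oo --> (0 : R) ->
  (fun p => pairing (phi p) e) @ \oo --> pairing u e.
Proof.
move=> Lu Le Lp H; have K0 : 0 < normsq e + 1 by rewrite ltr_wpDl// normsq_ge0.
apply/cvgrPdist_lt => eps eps0.
have e2 : 0 < eps ^+ 2 / (normsq e + 1) by rewrite divr_gt0// exprn_gt0.
near=> p; rewrite -pairingB// -(@ltr_pXn2r _ 2)// ?nnegrE ?(ltW eps0)//.
rewrite real_normK ?num_real//.
apply: le_lt_trans (_ : (normsq e + 1) * normsq (fun x => u x - phi p x) < _).
  by apply: cauchy_schwarz => //; [exact: L2B|rewrite lerDl].
rewrite mulrC -ltr_pdivlMr//.
by near: p; exact: (cvgr_lt _ H).
Unshelve. all: by end_near. Qed.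

Lemma energy_cvg alpha T u (phi : nat -> R -> R) j k : L2 u -> (forall p, L2 (phi p)) ->
  (fun p => normsq (fun x => u x - phi p x)) @ \oo --> (0 : R) ->
  (fun p => energy alpha T (phi p) j k) @ \oo --> energy alpha T u j k.
Proof.
move=> Lu Lp H; rewrite energyE; under eq_fun do rewrite energyE.
have c1 := pairing_cvg Lu (window_cos_L2 alpha T j k) Lp H.
have c2 := pairing_cvg Lu (window_sin_L2 alpha T j k) Lp H.
by apply: cvgD; apply: cvgM.
Qed.

Lemma normsq_cvg u (phi : nat -> R -> R) : L2 u -> (forall p, L2 (phi p)) ->
  (fun p => normsq (fun x => u x - phi p x)) @ \oo --> (0 : R) ->
  (fun p => normsq (phi p)) @ \oo --> normsq u.
Proof.
move=> Lu Lp H; have c := pairing_cvg Lu Lu Lp H.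
have E p : normsq (phi p) = normsq (fun x => u x - phi p x) - normsq u + 2 * pairing (phi p) u.
  have -> : (fun x => u x - phi p x) = (fun x => u x + -1 * phi p x) by apply/funext => x; rewrite mulN1r.
  rewrite normsq_lin// /pairing; under [in RHS]eq_Rintegral do rewrite mulrC.
  by rewrite -/(pairing _ _); ring.
rewrite (funext E).
suff : (fun p => normsq (fun x => u x - phi p x) - normsq u + 2 * pairing (phi p) u) @ \oo --> 0 - normsq u + 2 * pairing u u.
  have -> // : 0 - normsq u + 2 * pairing u u = normsq u.
  by rewrite /pairing /normsq; under [in RHS]eq_Rintegral do rewrite expr2; under eq_Rintegral do rewrite expr2; ring.
by apply: cvgD; [apply: cvgB; [exact: H|exact: cvg_cst]|apply: cvgM; [exact: cvg_cst|exact: c]].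
Qed.

(** Every finite partial sum is continuous for the L2 norm, so the bound
    passes to the closure. *)
Lemma gabor_energy_bessel alpha T B u : 0 <= B -> L2 u ->
  (forall phi, continuous phi -> bounded_support phi -> (gabor_energy alpha T phi <= (B * normsq phi)%:E)%E) ->
  (gabor_energy alpha T u <= (B * normsq u)%:E)%E.
Proof.
move=> B0 Lu HB; have [phi [cphi sphi H]] := cc_dense Lu.
have Lp p : L2 (phi p) by have [N s] := sphi p; apply: (L2_cts_support _ (cphi p) s); rewrite addr_ge0.
have fin n m : \sum_(0 <= i < n) \sum_(0 <= k < m) energy alpha T u (zenum i) (uphalf k) <= B * normsq u.
  have c1 : (fun p => \sum_(0 <= i < n) \sum_(0 <= k < m) energy alpha T (phi p) (zenum i) (uphalf k)) @ \oo -->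
      \sum_(0 <= i < n) \sum_(0 <= k < m) energy alpha T u (zenum i) (uphalf k).
    apply: cvg_big => [|i _]; first exact: add_continuous.
    apply: cvg_big => [|k _]; first exact: add_continuous.
    exact: energy_cvg.
  have c2 : (fun p => B * normsq (phi p)) @ \oo --> B * normsq u.
    by apply: cvgM; [exact: cvg_cst|exact: normsq_cvg].
  apply: ler_cvg_to c1 c2 _; apply: nearW => p.
  rewrite -lee_fin; apply: le_trans (HB _ (cphi p) (sphi p)).
  rewrite -sumEFin; apply: le_trans (nneseries_lim_ge n _); last first.
    by move=> i _ _; apply: nneseries_ge0 => k _ _; rewrite lee_fin energy_ge0.
  apply: lee_sum => i _; rewrite -sumEFin.
  by apply: nneseries_lim_ge => k _; rewrite lee_fin energy_ge0.
have s0 i k : (0 <= (energy alpha T u (zenum i) (uphalf k))%:E)%E by rewrite lee_fin energy_ge0.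
apply: lime_le.
  by apply: is_cvg_nneseries => i _ _; apply: nneseries_ge0.
apply: nearW => n; rewrite -nneseries_sum_nat//.
apply: lime_le; first by apply: is_cvg_nneseries => k _ _; apply: sume_ge0.
apply: nearW => m; rewrite exchange_big /=.
by under eq_bigr do rewrite sumEFin; rewrite sumEFin lee_fin.
Qed.

(** The inequality y^2 <= (1 + eta) x^2 + (1 + 1/eta) (x - y)^2, summed. *)
Lemma gabor_energy_subadd alpha T (eta : R) u v : 0 < eta -> L2 u -> L2 v ->
  (gabor_energy alpha T v <= (1 + eta)%:E * gabor_energy alpha T u +
     (1 + eta^-1)%:E * gabor_energy alpha T (fun x => (u x - v x)%R))%E.
Proof.
move=> e0 Lu Lv.
have sq (x y : R) : y ^+ 2 <= (1 + eta) * x ^+ 2 + (1 + eta^-1) * (x - y) ^+ 2.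
  have : 0 <= eta^-1 * (eta * x + (x - y)) ^+ 2 by rewrite mulr_ge0 ?sqr_ge0// invr_ge0 ltW.
  have -> : eta^-1 * (eta * x + (x - y)) ^+ 2 = eta * x ^+ 2 + 2 * x * (x - y) + eta^-1 * (x - y) ^+ 2.
    by field; rewrite gt_eqF.
  by move: (eta^-1) => z; lra.
have S j k : energy alpha T v j k <= (1 + eta) * energy alpha T u j k + (1 + eta^-1) * energy alpha T (fun x => u x - v x) j k.
  rewrite !energyE !pairingB//; try exact: window_cos_L2; try exact: window_sin_L2.
  by rewrite !mulrDr addrACA; apply: lerD; apply: sq.
have p1 : 0 <= 1 + eta by rewrite addr_ge0// ltW.
have p2 : 0 <= 1 + eta^-1 by rewrite addr_ge0// invr_ge0 ltW.
have s0 w i k : (0 <= (energy alpha T w i k)%:E)%E by rewrite lee_fin energy_ge0.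
rewrite /gabor_energy -!nneseriesZl//; try by move=> *; apply: nneseries_ge0.
rewrite -nneseriesD; last 2 first.
- by move=> i _ _; rewrite mule_ge0 ?lee_fin//; apply: nneseries_ge0.
- by move=> i _ _; rewrite mule_ge0 ?lee_fin//; apply: nneseries_ge0.
apply: lee_nneseries => [i _ _|i _]; first by apply: nneseries_ge0.
rewrite -!nneseriesZl// -nneseriesD; last 2 first.
- by move=> k _ _; apply: mule_ge0; [rewrite lee_fin|exact: s0].
- by move=> k _ _; apply: mule_ge0; [rewrite lee_fin|exact: s0].
by apply: lee_nneseries => [//|k _]; rewrite -!EFinM -EFinD lee_fin.
Qed.

(** The Bessel bound makes the energy of the error small, and eta tends to 0
    after the approximation. *)
Lemma gabor_energy_lower alpha T A B u : 0 <= A -> 0 <= B -> L2 u ->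
  (forall phi, continuous phi -> bounded_support phi ->
    ((A * normsq phi)%:E <= gabor_energy alpha T phi <= (B * normsq phi)%:E)%E) ->
  ((A * normsq u)%:E <= gabor_energy alpha T u)%E.
Proof.
move=> A0 B0 Lu H.
have HB w : L2 w -> (gabor_energy alpha T w <= (B * normsq w)%:E)%E.
  by move=> Lw; apply: gabor_energy_bessel => // phi c s; have /andP[] := H _ c s.
have ge0 w : (0 <= gabor_energy alpha T w)%E.
  by apply: nneseries_ge0 => i _ _; apply: nneseries_ge0 => k _ _; rewrite lee_fin energy_ge0.
have [phi [cphi sphi Hphi]] := cc_dense Lu.
have Lp p : L2 (phi p) by have [N s] := sphi p; apply: (L2_cts_support _ (cphi p) s); rewrite addr_ge0.
have [E EE] : exists E : R, gabor_energy alpha T u = E%:E.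
  exists (fine (gabor_energy alpha T u)); rewrite fineK// ge0_fin_numE//.
  exact: le_lt_trans (HB _ Lu) (ltry _).
have step (eta : R) : 0 < eta -> A * normsq u <= (1 + eta) * E.
  move=> e0.
  have c1 : (fun p => A * normsq (phi p)) @ \oo --> A * normsq u.
    by apply: cvgM; [exact: cvg_cst|exact: normsq_cvg].
  have c2 : (fun p => (1 + eta) * E + (1 + eta^-1) * (B * normsq (fun x => u x - phi p x))) @ \oo --> (1 + eta) * E.
    suff : (fun p => (1 + eta) * E + (1 + eta^-1) * (B * normsq (fun x => u x - phi p x))) @ \oo -->
       (1 + eta) * E + (1 + eta^-1) * (B * 0) by rewrite !mulr0 addr0.
    by apply: cvgD; [exact: cvg_cst|apply: cvgM; [exact: cvg_cst|apply: cvgM; [exact: cvg_cst|exact: Hphi]]].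
  apply: ler_cvg_to c1 c2 _; apply: nearW => p.
  rewrite -lee_fin; apply: (@le_trans _ _ (gabor_energy alpha T (phi p))).
    by have /andP[] := H _ (cphi p) (sphi p).
  apply: le_trans (gabor_energy_subadd _ _ e0 Lu (Lp p)) _.
  rewrite EE; have -> : (((1 + eta) * E + (1 + eta^-1) * (B * normsq (fun x => u x - phi p x)))%R%:E =
    (1 + eta)%:E * E%:E + (1 + eta^-1)%:E * (B * normsq (fun x => u x - phi p x))%R%:E)%E by rewrite -!EFinM -EFinD.
  rewrite leeD2lE//.
  apply: lee_wpmul2l; last by apply: HB; exact: L2B.
  by rewrite lee_fin addr_ge0// invr_ge0 ltW.
rewrite EE lee_fin; have E0 : 0 <= E by rewrite -lee_fin -EE.
apply/ler_addgt0Pr => d d0; have d1 : 0 < d / (E + 1) by rewrite divr_gt0// ltr_wpDl.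
apply: le_trans (step _ d1) _; rewrite mulrDl mul1r lerD2l mulrAC ler_pdivrMr ?ltr_wpDl//.
by rewrite ler_wpM2l ?lerDl// ltW.
Qed.

End FrameBounds.

(** * Alternating test functions *)

Section TestFunction.
Context {R : realType}.
Notation mu := (@lebesgue_measure R).
Implicit Types (w phi : R -> R) (alpha T A s d x : R) (N : nat).

Lemma gform_alternating s N : gform s N (fun m => (-1) ^+ m) =
  \sum_(i < N) \sum_(j < N) (-1) ^+ (ndist i j) * gauss s (ndist i j)%:R.
Proof.
apply: eq_bigr => i _; apply: eq_bigr => j _; congr (_ * _).
rewrite -exprD; have [m ->] : exists m, (i + j = ndist i j + 2 * m)%N.
  by case: (leqP i j) => ij; [exists i|exists j]; lia.
by rewrite exprD exprM sqrrN !expr1n mulr1.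
Qed.

(** The alternating vector tests the symbol at 1/2. *)
Lemma gform_alternating_mean s : 0 < s ->
  (fun n => n.+1%:R^-1 * gform s n.+1 (fun m => (-1) ^+ m)) @ \oo --> theta4 s.
Proof.
move=> s0; under eq_fun do rewrite gform_alternating.
have H : series (fun k => (-1) ^+ k * gauss s k%:R) @ \oo --> (theta4 s + 1) / 2.
  have := @theta_cvg R s 2^-1 s0; rewrite -/(theta4 s).
  rewrite (_ : (fun k => _) = fun k => (-1) ^+ k * gauss s k%:R)//.
  apply/funext => k; rewrite mulrC; congr (_ * _).
  exact: cos_pi_nat.
have := toeplitz_mean H.
by rewrite expr0 mul1r /gauss expr0n mulr0 oppr0 expR0 (_ : 2 * _ - 1 = theta4 s)//; lra.
Qed.

Definition tent (c d x : R) := (1 - `|x - c| / d + `|1 - `|x - c| / d|) / 2.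

Lemma continuous_tent c d : continuous (tent c d).
Proof. by rewrite /tent; cts. Qed.

Lemma tent_out c d x : 0 < d -> d <= `|x - c| -> tent c d x = 0.
Proof.
move=> d0 h; rewrite /tent; have : 1 <= `|x - c| / d by rewrite ler_pdivlMr// mul1r.
by move: (`|x - c| / d) => z z1; rewrite ler0_norm; lra.
Qed.

Lemma tent_half c d x : 0 < d -> `|x - c| <= d / 2 -> 2^-1 <= tent c d x.
Proof.
move=> d0 h; rewrite /tent; have : `|x - c| / d <= 2^-1 by rewrite ler_pdivrMr// mulrC.
by move: (`|x - c| / d) => z z1; rewrite ger0_norm; lra.
Qed.

Lemma integral_tent_gt0 (a b c d : R) : 0 < d -> a <= c - d -> c + d <= b ->
  0 < \int[mu]_(x in `[a, b]) tent c d x ^+ 2.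
Proof.
move=> d0 ac cb; have ct := @continuous_tent c d.
have c2 : continuous (fun x => tent c d x ^+ 2) by move=> x; apply: ct_sqr; exact: ct.
apply: (@lt_le_trans _ _ (\int[mu]_(x in `[c - d / 2, c + d / 2]) 4^-1)).
  by rewrite Rintegral_cst// fine_mu_itv; lra.
apply: (@le_trans _ _ (\int[mu]_(x in `[c - d / 2, c + d / 2]) tent c d x ^+ 2)).
  apply: le_Rintegral => //; first exact: (@integrable_itv R (fun=> 4^-1) _ _ (@cst_continuous _ _ _)).
    exact: (integrable_itv _ _ c2).
  move=> x /=; rewrite in_itv /= => xc.
  have h : 2^-1 <= tent c d x by apply: tent_half => //; rewrite ler_norml; lra.
  by rewrite (_ : 4^-1 = 2^-1 * 2^-1 :> R); [rewrite expr2; apply: ler_pM|lra].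
have i1 := integrable_itv a b c2; have i2 := integrable_itv (c - d / 2) (c + d / 2) c2.
rewrite /Rintegral fine_le//; [exact: integrable_fin_num|exact: integrable_fin_num|].
apply: ge0_subset_integral => //.
- by case/integrableP : i1.
- by move=> x _; rewrite lee_fin sqr_ge0.
- by move=> x /=; rewrite !in_itv /= => /andP[h1 h2]; apply/andP; split; lra.
Qed.

Definition alternating w T N x := \sum_(m < N) (-1) ^+ m * w (x - m%:R * T).

Lemma alternating_shift w T N (m : nat) x : (m < N)%N -> 0 < T ->
  (forall x, x <= 0 \/ T <= x -> w x = 0) -> x \in `[0, T] ->
  alternating w T N (x + m%:R * T) = (-1) ^+ m * w x.
Proof.
move=> mN T0 w0; rewrite in_itv /= => /andP[x0 xT].
rewrite /alternating (bigD1 (Ordinal mN)) //= addrK big1 ?addr0// => i im.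
rewrite w0 ?mulr0//; have {}im : (i != m :> nat) by [].
case: (ltngtP i m) im => // h _; [right|left].
- have : i%:R + 1 <= m%:R :> R by rewrite natr1 ler_nat.
  by move=> /(ler_wpM2r (ltW T0)) hh; lra.
- have : m%:R + 1 <= i%:R :> R by rewrite natr1 ler_nat.
  by move=> /(ler_wpM2r (ltW T0)) hh; lra.
Qed.

Lemma alternating_support w T N x : 0 < T -> (forall x, x <= 0 \/ T <= x -> w x = 0) ->
  ~ `[0, N%:R * T]%classic x -> alternating w T N x = 0.
Proof.
move=> T0 w0 h; rewrite /alternating big1// => i _; rewrite w0 ?mulr0//.
case: (ltP x 0) => [x0|x0].
  by left; rewrite subr_le0 (le_trans (ltW x0))// mulr_ge0 ?(ltW T0).
right; rewrite lerBrDr; have : N%:R * T < x.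
  by rewrite ltNge; apply: contra_notN h => xN; rewrite /= in_itv /= x0.
move/ltW; apply: le_trans; rewrite -{1}[T]mul1r -mulrDl ler_wpM2r ?(ltW T0)//.
by rewrite addrC natr1 ler_nat.
Qed.

(** For alternating copies of a bump the samples at distance T are w(x) times
    the alternating vector, so the energy factors. The number of copies tends
    to infinity first, which yields theta4 s; then the bump shrinks to alpha /
    2, where the Gaussian sum takes the value of theta (1/s) at 1/2. *)
Lemma lower_bound_le alpha A : 0 < alpha ->
  (forall phi, continuous phi -> bounded_support phi ->
     ((A * normsq phi)%:E <= gabor_energy alpha (2 * alpha) phi)%E) ->
  A <= 2 * (theta4 (2 * alpha ^+ 2) * theta4 (2 * alpha ^+ 2)^-1).
Proof.
move=> a0 HA; have T0 : 0 < 2 * alpha by rewrite mulr_gt0.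
have s0 : 0 < 2 * alpha ^+ 2 by rewrite mulr_gt0// exprn_gt0.
have si : 0 < (2 * alpha ^+ 2)^-1 by rewrite invr_gt0.
set s := 2 * alpha ^+ 2 in s0 si *.
(* The factor sqrt 2 G(x / alpha) of the energy density, in terms of the
   symbol at 1/s. *)
pose f x := alpha^-1 * theta s^-1 (x / alpha).
have ccs := continuous_theta si.
have cf : continuous f by rewrite /f; cts.
suff main e : 0 < e -> A <= 2 * alpha * (theta4 s * (f (alpha / 2) + e)).
  have t4 := theta4_gt0 s0.
  have e4 : f (alpha / 2) = alpha^-1 * theta4 s^-1.
    by rewrite /f /theta4 (_ : alpha / 2 / alpha = 2^-1)//; field; rewrite gt_eqF.
  apply/ler_addgt0Pr => e e0.
  have e1 : 0 < e / (2 * alpha * theta4 s) by rewrite divr_gt0// mulr_gt0.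
  apply: le_trans (main _ e1) _; rewrite e4 le_eqVlt; apply/orP; left; apply/eqP.
  by move: (theta4 s^-1) (theta4 s) t4 => z y y0; field; rewrite !gt_eqF.
move=> e0.
have [d [d0 da hd]] : exists d, [/\ 0 < d, d <= alpha / 2 &
    forall x, `|x - alpha / 2| < d -> f x <= f (alpha / 2) + e].
  have /cvgrPdist_lt /(_ e e0) := cf (alpha / 2).
  move=> /nbhs_ballP[r /= r0 hr].
  exists (Num.min r (alpha / 2)); split; first by rewrite lt_min r0 divr_gt0.
    by rewrite ge_min lexx orbT.
  move=> x; rewrite lt_min => /andP[xr _].
  have := hr x; rewrite /ball /= distrC => /(_ xr); rewrite ltr_norml => /andP[h _]; lra.
pose w := tent (alpha / 2) d.
have cw : continuous w by exact: continuous_tent.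
have w0 x : x <= 0 \/ 2 * alpha <= x -> w x = 0.
  move=> h; apply: tent_out => //; case: h => h.
    by rewrite distrC ger0_norm; lra.
  by rewrite ger0_norm; lra.
have cw2 : continuous (fun x => w x ^+ 2) by move=> x; apply: ct_sqr; exact: cw.
pose W := \int[mu]_(x in `[0, 2 * alpha]) w x ^+ 2.
have W0 : 0 < W by apply: integral_tent_gt0 => //; lra.
pose V := \int[mu]_(x in `[0, 2 * alpha]) (f x * w x ^+ 2).
have VW : V <= (f (alpha / 2) + e) * W.
  rewrite /V /W -RintegralZl//; last exact: (integrable_itv _ _ cw2).
  have c1 : continuous (fun x => f x * w x ^+ 2) by cts.
  have c2 : continuous (fun x => (f (alpha / 2) + e) * w x ^+ 2) by cts.
  apply: le_Rintegral => //; [exact: (integrable_itv _ _ c1)|exact: (integrable_itv _ _ c2)|].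
  move=> x _; case: (ltP `|x - alpha / 2| d) => h.
    by rewrite ler_wpM2r ?sqr_ge0// hd.
  by rewrite /w tent_out// expr0n !mulr0.
have step n : A * W <= 2 * alpha * (n.+1%:R^-1 * gform s n.+1 (fun m => (-1) ^+ m) * V).
  pose phi := alternating w (2 * alpha) n.+1.
  have cphi : continuous phi by rewrite /phi /alternating; cts.
  have phi0 x : ~ `[(0 : int)%:~R * (2 * alpha), (0 : int)%:~R * (2 * alpha) + n.+1%:R * (2 * alpha)]%classic x -> phi x = 0.
    by rewrite mul0r add0r; exact: alternating_support.
  have sphi : bounded_support phi.
    exists (Num.bound (n.+1%:R * (2 * alpha))) => x hx; apply: phi0; rewrite mul0r add0r /= in_itv /= => /andP[h1 h2].
    move: hx; rewrite ger0_norm// leNgt => /negP; apply.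
    apply: le_lt_trans h2 _; apply: lt_le_trans (archi_boundP _) _; last by rewrite lerDl.
    by rewrite mulr_ge0// ltW.
  have sh x (m : nat) : (m < n.+1)%N -> x \in `[0, 2 * alpha] ->
      phi (x + ((0 : int)%:~R * (2 * alpha) + m%:R * (2 * alpha))) = (-1) ^+ m * w x.
    by move=> mn xT; rewrite mul0r add0r /phi (alternating_shift mn T0).
  have := HA _ cphi sphi; rewrite (gabor_energyE a0 cphi phi0) -(normsq_periodize (ltW T0) cphi phi0).
  have -> : \int[mu]_(x in `[0, 2 * alpha]) (\sum_(m < n.+1) phi (x + ((0 : int)%:~R * (2 * alpha) + m%:R * (2 * alpha))) ^+ 2) = n.+1%:R * W.
    rewrite /W -RintegralZl//; last exact: (integrable_itv _ _ cw2).
    apply: eq_Rintegral => x; rewrite inE /= => xT.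
    rewrite (eq_bigr (fun=> w x ^+ 2)); first by rewrite sumr_const card_ord mulr_natl.
    by move=> m _; rewrite sh// exprMn sqrr_sign mul1r.
  set q := gform s _ _.
  have -> : (\int[mu]_(x in `[0%R, (2 * alpha)%R]) (Num.sqrt 2 * gsum (2 * alpha ^+ 2) (x / alpha) *
      gform (2 * alpha ^+ 2) n.+1 (fun m => phi (x + ((0 : int)%:~R * (2 * alpha) + m%:R * (2 * alpha)))))%:E = (q * V)%:E)%E.
    have c1 : continuous (fun x => f x * w x ^+ 2) by cts.
    have c2 : continuous (fun x => q * (f x * w x ^+ 2)) by cts.
    rewrite /V -RintegralZl//; last exact: (integrable_itv _ _ c1).
    rewrite /Rintegral fineK; last by apply: integrable_fin_num => //; exact: (integrable_itv _ _ c2).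
    apply: eq_integral => x; rewrite inE /= => xT; congr EFin.
    rewrite sqrt2_gsum// -/s -/(f x) [q * _]mulrCA; congr (_ * _).
    rewrite [q * _]mulrC /q /gform mulr_sumr; apply: eq_bigr => i _; rewrite mulr_sumr; apply: eq_bigr => j _.
    by rewrite !sh//; ring.
  rewrite -EFinM lee_fin => h.
  have n0 : 0 < n.+1%:R :> R by [].
  rewrite -(ler_pM2l n0); apply: le_trans (_ : A * (n.+1%:R * W) <= _); first by rewrite mulrCA.
  apply: le_trans h _; rewrite le_eqVlt; apply/orP; left; apply/eqP.
  by rewrite [RHS]mulrCA; congr (_ * _); rewrite -mulrA mulVKf// gt_eqF.
have lim : A * W <= 2 * alpha * (theta4 s * V).
  have c : (fun n => 2 * alpha * (n.+1%:R^-1 * gform s n.+1 (fun m => (-1) ^+ m) * V)) @ \oo -->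
      2 * alpha * (theta4 s * V).
    by apply: cvgM; [exact: cvg_cst|apply: cvgM; [exact: gform_alternating_mean|exact: cvg_cst]].
  by apply: cvgr_to_ge c _; exact: nearW.
rewrite -(ler_pM2r W0); apply: le_trans lim _.
rewrite -!mulrA !ler_pM2l//; exact: theta4_gt0.
Qed.

End TestFunction.

(** * From complex to real functions *)

Section ComplexReduction.
Context {R : realType}.
Notation mu := (@lebesgue_measure R).
Implicit Types (f : R -> R[i]) (u v : R -> R) (alpha T A : R) (j k : int).

Lemma cabs_sqr (a b : R) : cabs (Complex a b) ^+ 2 = a ^+ 2 + b ^+ 2.
Proof. by rewrite /cabs /= sqr_sqrtr// addr_ge0// sqr_ge0. Qed.

Lemma cabsE (z : R[i]) : cabs z ^+ 2 = complex.Re z ^+ 2 + complex.Im z ^+ 2.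
Proof. by case: z => a b; rewrite cabs_sqr. Qed.

Lemma nneseries_odd_eq (a b : nat -> \bar R) : (forall n, 0 <= a n)%E -> (forall n, 0 <= b n)%E ->
  (forall n, \sum_(0 <= i < n.*2.+1) a i = \sum_(0 <= i < n.*2.+1) b i)%E ->
  (\sum_(n <oo) a n = \sum_(n <oo) b n)%E.
Proof.
move=> a0 b0 ab.
have sub (c : nat -> \bar R) : (forall n, 0 <= c n)%E ->
    ((fun n => \sum_(0 <= i < n.*2.+1) c i) @ \oo --> \sum_(n <oo) c n)%E.
  move=> c0; have cc : cvgn (fun n => \sum_(0 <= i < n) c i)%E by apply: is_cvg_nneseries.
  by have := cvg_subseq_double true cc; rewrite /=; under eq_fun do rewrite add1n.
have sa := sub _ a0; have := sub _ b0; rewrite -(funext ab) => sb.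
exact: (cvg_unique _ sa sb).
Qed.

Definition int_sign k : R := if k is Negz _ then -1 else 1.

Lemma cos_freq k (x : R) : cos (k%:~R * x) = cos (`|k|%N%:R * x).
Proof.
by case: k => n //; rewrite NegzE abszN mulrNz mulNr cosN.
Qed.

Lemma sin_freq k (x : R) : sin (k%:~R * x) = int_sign k * sin (`|k|%N%:R * x).
Proof.
case: k => n; first by rewrite mul1r.
by rewrite /int_sign NegzE abszN mulrNz mulNr sinN mulN1r.
Qed.

Lemma int_sign_sqr k : int_sign k ^+ 2 = 1.
Proof. by case: k => n; rewrite /int_sign ?sqrrN expr1n. Qed.

Lemma g0E (t : R) : g0 t = Complex (window t) 0.
Proof. by rewrite /g0 /window /gauss mulr1. Qed.

Lemma inner_tfshift f alpha T j k : L2 (fun t => complex.Re (f t)) -> L2 (fun t => complex.Im (f t)) ->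
  inner f (tfshift (alpha * j%:~R, T^-1 * k%:~R) g0) =
  Complex
    (pairing (fun t => complex.Re (f t)) (window_cos alpha T j `|k|%N) +
       int_sign k * pairing (fun t => complex.Im (f t)) (window_sin alpha T j `|k|%N))
    (pairing (fun t => complex.Im (f t)) (window_cos alpha T j `|k|%N) -
       int_sign k * pairing (fun t => complex.Re (f t)) (window_sin alpha T j `|k|%N)).
Proof.
set u := fun t => complex.Re (f t); set v := fun t => complex.Im (f t) => Lu Lv.
pose c := window_cos alpha T j `|k|%N; pose s := window_sin alpha T j `|k|%N.
have E t : f t * conjc (tfshift (alpha * j%:~R, T^-1 * k%:~R) g0 t) =
    Complex (u t * c t + int_sign k * (v t * s t)) (v t * c t - int_sign k * (u t * s t)).
  rewrite (_ : tfshift _ _ t = cis (2 * pi * (T^-1 * k%:~R) * t) * Complex (window (t - alpha * j%:~R)) 0); last first.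
    by rewrite -g0E.
  rewrite /cis; have -> : 2 * pi * (T^-1 * k%:~R) * t = k%:~R * (2 * pi * (t / T)) by ring.
  rewrite cos_freq sin_freq /c /s /window_cos /window_sin /u /v.
  case: (f t) => a b /=; congr Complex; ring.
have Lc : L2 c by exact: window_cos_L2.
have Ls : L2 s by exact: window_sin_L2.
have iZ (h : R -> R) (a : R) : mu.-integrable setT (EFin \o h) -> mu.-integrable setT (EFin \o (fun t => a * h t)).
  by move=> ih; rewrite /comp; under eq_fun do rewrite EFinM; apply: integrableZl.
have iuc := L2_mul Lu Lc; have ius := L2_mul Lu Ls.
have ivc := L2_mul Lv Lc; have ivs := L2_mul Lv Ls.
rewrite /inner /cintegral; congr Complex.
  under eq_Rintegral do rewrite E /=.
  by rewrite RintegralD//; [rewrite RintegralZl|exact: iZ].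
under eq_Rintegral do rewrite E /=.
by rewrite RintegralB//; [rewrite RintegralZl|exact: iZ].
Qed.

Lemma abs_zenum n : `|zenum n|%N = uphalf n.
Proof.
apply/eqP; rewrite -(@eqr_nat R); apply/eqP; rewrite -zenum_uphalf.
by case: (zenum n) => m; rewrite ?NegzE ?abszN ?mulrNz ?normrN ger0_norm.
Qed.

Lemma pairing_sin0 u alpha T j : pairing u (window_sin alpha T j 0) = 0.
Proof.
rewrite /pairing (_ : (fun x => _) = fun=> 0); first by rewrite Rintegral_cst// mul0r.
by apply/funext => x; rewrite /window_sin mul0r sin0 !mulr0.
Qed.

(** The mixed term Z changes sign with the frequency, so it cancels in every
    partial sum over the frequencies from - n to n. *)
Lemma inner_energy f alpha T j : L2 (fun t => complex.Re (f t)) -> L2 (fun t => complex.Im (f t)) ->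
  (\sum_(n <oo) ((cabs (inner f (tfshift (alpha * j%:~R, T^-1 * (zenum n)%:~R) g0))) ^+ 2)%:E =
   \sum_(n <oo) (energy alpha T (fun t => complex.Re (f t)) j (uphalf n) +
                 energy alpha T (fun t => complex.Im (f t)) j (uphalf n))%:E)%E.
Proof.
move=> Lu Lv; apply: nneseries_odd_eq.
- by move=> n; rewrite lee_fin sqr_ge0.
- by move=> n; rewrite lee_fin addr_ge0// energy_ge0.
set u := fun t => complex.Re (f t) in Lu *; set v := fun t => complex.Im (f t) in Lv *.
(* The mixed term at the frequency of absolute value m. *)
pose Z m := 2 * (pairing u (window_cos alpha T j m) * pairing v (window_sin alpha T j m) -
   pairing v (window_cos alpha T j m) * pairing u (window_sin alpha T j m)).
have Z0 : Z 0%N = 0 by rewrite /Z !pairing_sin0 !mulr0 subrr mulr0.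
pose Y m := energy alpha T u j m + energy alpha T v j m.
have E n : cabs (inner f (tfshift (alpha * j%:~R, T^-1 * (zenum n)%:~R) g0)) ^+ 2 =
    Y (uphalf n) + int_sign (zenum n) * Z (uphalf n).
  rewrite (inner_tfshift _ _ _ _ Lu Lv) cabs_sqr -/u -/v abs_zenum /Y !energyE /Z.
  have := int_sign_sqr (zenum n); move: (int_sign (zenum n)) => e e2.
  rewrite !sqrrD sqrrN !exprMn e2; ring.
elim=> [|n IH].
  by rewrite !big_nat1 E Z0 mulr0 addr0.
rewrite doubleS !(big_nat_recr n.*2.+2)//= !(big_nat_recr n.*2.+1)//= IH -!addeA; congr (_ + _)%E.
rewrite -!EFinD; congr EFin; rewrite !E.
have -> : zenum n.*2.+1 = Negz n by rewrite /zenum /= odd_double /= uphalf_double.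
have -> : zenum n.*2.+2 = Posz n.+1 by rewrite /zenum /= odd_double /= doubleK.
by rewrite /= doubleK uphalf_double /Y /=; ring.
Qed.

Lemma esum_rect_lattice (a b : R) (F : R * R -> R) : a != 0 -> b != 0 -> (forall l, 0 <= F l) ->
  (\esum_(l in rect_lattice a b) (F l)%:E =
   \sum_(n <oo) \sum_(k <oo) (F (a * (zenum n)%:~R, b * (zenum k)%:~R))%:E)%E.
Proof.
move=> a0 b0 F0.
have bij : set_bij ([set: nat] `*`` (fun=> [set: nat])) (rect_lattice a b)
    (fun p : nat * nat => (a * (zenum p.1)%:~R, b * (zenum p.2)%:~R)).
  split.
  - by move=> p _; exists (zenum p.1), (zenum p.2).
  - move=> [n m] [n' m'] _ _ /= [] /(mulfI a0) h /(mulfI b0) h'.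
    by move: h h' => /intr_inj/zenum_inj -> /intr_inj/zenum_inj ->.
  - move=> l [j [k ->]]; have [n <-] := zenum_surj j; have [m <-] := zenum_surj k.
    by exists (n, m).
rewrite (@reindex_esum R _ _ _ _ _ (fun l => (F l)%:E) bij).
rewrite -(@esum_esum R nat nat setT (fun=> setT) (fun n k : nat => (F (a * (zenum n)%:~R, b * (zenum k)%:~R))%:E)); last first.
  by move=> n k _ _; rewrite lee_fin.
rewrite nneseries_esumT; last by move=> n; apply: nneseries_ge0 => k _ _; rewrite lee_fin.
by apply: eq_esum => n _; rewrite nneseries_esumT// => k; rewrite lee_fin.
Qed.

Lemma frame_sum_split f alpha T : alpha != 0 -> T != 0 ->
  L2 (fun t => complex.Re (f t)) -> L2 (fun t => complex.Im (f t)) ->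
  (frame_sum g0 (rect_lattice alpha T^-1) f =
   gabor_energy alpha T (fun t => complex.Re (f t)) + gabor_energy alpha T (fun t => complex.Im (f t)))%E.
Proof.
move=> a0 T0 Lu Lv; rewrite /frame_sum.
rewrite (esum_rect_lattice (F := fun l => cabs (inner f (tfshift l g0)) ^+ 2)) ?invr_eq0//; last by move=> l; exact: sqr_ge0.
have s0 u j (k : nat) : (0 <= (energy alpha T u j k)%:E)%E by rewrite lee_fin energy_ge0.
rewrite /gabor_energy -nneseriesD; last 2 first.
- by move=> *; apply: nneseries_ge0.
- by move=> *; apply: nneseries_ge0.
apply: eq_eseriesr => n _; rewrite inner_energy// -nneseriesD//.
Qed.

Lemma inL2_components f : inL2 f ->
  [/\ L2 (fun t => complex.Re (f t)), L2 (fun t => complex.Im (f t)) &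
    L2normsq f = (normsq (fun t => complex.Re (f t)) + normsq (fun t => complex.Im (f t)))%:E].
Proof.
move=> [mr mi fin].
have E : (fun t => (cabs (f t) ^+ 2)%:E) = (fun t => (complex.Re (f t) ^+ 2 + complex.Im (f t) ^+ 2)%:E).
  by apply/funext => t; rewrite cabsE.
move: fin; rewrite /L2normsq E => fin.
have msum : measurable_fun setT (fun t => complex.Re (f t) ^+ 2 + complex.Im (f t) ^+ 2).
  by apply: measurable_funD; apply: measurable_funX.
have isum : mu.-integrable setT (EFin \o (fun t => complex.Re (f t) ^+ 2 + complex.Im (f t) ^+ 2)).
  apply/integrableP; split; first exact/measurable_EFinP.
  apply: le_lt_trans fin; rewrite le_eqVlt; apply/orP; left; apply/eqP.
  by apply: eq_integral => t _; rewrite /= ger0_norm// addr_ge0// sqr_ge0.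
have Lr : L2 (fun t => complex.Re (f t)).
  split=> //; apply: (integrable_bound _ _ _ isum) => //; first exact: measurable_funX.
  by move=> t _; rewrite ger0_norm ?sqr_ge0// lerDl sqr_ge0.
have Li : L2 (fun t => complex.Im (f t)).
  split=> //; apply: (integrable_bound _ _ _ isum) => //; first exact: measurable_funX.
  by move=> t _; rewrite ger0_norm ?sqr_ge0// lerDr sqr_ge0.
split=> //; rewrite /normsq -RintegralD//; [|by case: Lr|by case: Li].
by rewrite /Rintegral fineK//; exact: integrable_fin_num.
Qed.

Lemma Aopt_ge alpha A B : 0 < alpha -> 0 <= A -> 0 <= B ->
  (forall phi, continuous phi -> bounded_support phi ->
    ((A * normsq phi)%:E <= gabor_energy alpha (2 * alpha) phi <= (B * normsq phi)%:E)%E) ->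
  (A%:E <= Aopt alpha (2 * alpha)^-1)%E.
Proof.
move=> a0 A0 B0 H; apply: ereal_sup_ubound; exists A => // f Lf.
have [Lu Lv ->] := inL2_components Lf.
rewrite frame_sum_split//; [|by rewrite gt_eqF|by rewrite gt_eqF// mulr_gt0].
by rewrite -EFinM mulrDr EFinD; apply: leeD; apply: (gabor_energy_lower A0 B0).
Qed.

Lemma Aopt_le alpha : 0 < alpha ->
  (Aopt alpha (2 * alpha)^-1 <= (2 * (theta4 (2 * alpha ^+ 2) * theta4 (2 * alpha ^+ 2)^-1))%:E)%E.
Proof.
move=> a0; apply: ge_ereal_sup => _ [A HA <-]; rewrite lee_fin.
apply: lower_bound_le => // phi cphi [N sphi].
pose f t := Complex (phi t) 0.
have Lphi : L2 phi by apply: (L2_cts_support _ cphi sphi); rewrite addr_ge0.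
have z0 : normsq (fun=> 0 : R) = 0 by rewrite /normsq expr0n/= Rintegral_cst// mul0r.
have L0 : L2 (fun=> 0 : R).
  by apply: L2_bound Lphi _ => // x; rewrite normr0.
have Lf : inL2 f.
  split; [by case: Lphi|exact: measurable_cst|].
  have -> : L2normsq f = (\int[mu]_t (phi t ^+ 2)%:E)%E.
    by apply: eq_integral => t _; rewrite cabs_sqr expr0n addr0.
  have i2 := Lphi.2; have := integrable_fin_num measurableT i2.
  by rewrite ge0_fin_numE// integral_ge0// => t _; rewrite lee_fin sqr_ge0.
have := HA f Lf; have [_ _ ->] := inL2_components Lf.
rewrite frame_sum_split//; [|by rewrite gt_eqF|by rewrite gt_eqF// mulr_gt0].
rewrite z0 addr0 -EFinM.
have -> : (gabor_energy alpha (2 * alpha) (fun t => complex.Im (f t)) = 0)%E.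
  apply: eseries0 => n _ _; apply: eseries0 => k _ _.
  have c0 (e : R -> R) : pairing (fun t => complex.Im (f t)) e = 0.
    rewrite /pairing (_ : (fun x => _) = fun=> 0); first by rewrite Rintegral_cst// mul0r.
    by apply/funext => x; rewrite mul0r.
  by rewrite energyE !c0 expr0n addr0.
by rewrite adde0.
Qed.

End ComplexReduction.

(** * The ambiguity function of the Gaussian *)

Section Ambiguity.
Context {R : realType}.
Notation mu := (@lebesgue_measure R).
Implicit Types (a b s x w : R).

(** Completing the square: the product is a Gaussian around x / 2. *)
Lemma g0_mul x t : g0 t * conjc (g0 (t - x)) =
  Complex (Num.sqrt 2 * gauss 2^-1 x * gauss 2 (t - x / 2)) 0 :> R[i].
Proof.
rewrite !g0E; transitivity (Complex (window t * window (t - x)) 0); first by rewrite /=; congr Complex; ring.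
congr Complex; rewrite /window mulrACA -powRD; last by rewrite pnatr_eq0 implybT.
have -> : (4^-1 + 4^-1 : R) = 2^-1 by lra.
rewrite powR12_sqrt// -mulrA; congr (_ * _).
by rewrite /gauss -!expRD; congr expR; field.
Qed.

(** The real and imaginary parts are the same integral with phases that differ
    by pi / 2. *)
Lemma stft_gauss x w : cabs (stft g0 g0 (x, w)) = gauss 2^-1 x * gauss 2^-1 w :> R.
Proof.
pose K := Num.sqrt 2 * gauss 2^-1 x.
have I e : \int[mu]_t (K * (gauss 2 (t - x / 2) * cos (2 * pi * w * (t - x / 2) + e))) =
    cos e * (gauss 2^-1 x * gauss 2^-1 w).
  rewrite RintegralZl//; last first.
    apply: (@integrable_gauss_le R 2 (x / 2) _ 1) => //.
      by rewrite /gauss; cts.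
    by move=> t; rewrite normrM ger0_norm ?gauss_ge0// mulrC ler_wpM2r ?gauss_ge0// cos_max.
  rewrite (@gauss_ft R 2 (x / 2) e) ?ltr0n// /K.
  have h : 0 < Num.sqrt 2 :> R by rewrite sqrtr_gt0.
  by move: (gauss _ x) (gauss _ w) => y z; field; rewrite gt_eqF.
have E : stft g0 g0 (x, w) = Complex (cos (pi * w * x) * (gauss 2^-1 x * gauss 2^-1 w))
    (- sin (pi * w * x) * (gauss 2^-1 x * gauss 2^-1 w)).
  rewrite /stft /cintegral; congr Complex.
    rewrite -I; apply: eq_Rintegral => t _.
    rewrite g0_mul /cis /= mul0r subr0 cosN -/K -[LHS]mulrA; congr (_ * (_ * cos _)); by field.
  rewrite -cosDpihalf -I; apply: eq_Rintegral => t _.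
  rewrite g0_mul /cis /= mul0r addr0 -/K -[LHS]mulrA sinN -cosDpihalf; congr (_ * (_ * cos _)); by field.
rewrite E /cabs /= !exprMn sqrrN -mulrDl cos2Dsin2 mul1r -exprMn sqrtr_sqr ger0_norm//.
by rewrite mulr_ge0 ?gauss_ge0.
Qed.

Lemma nneseries_gauss s : 0 < s -> (\sum_(n <oo) (gauss s (zenum n)%:~R)%:E = (theta3 s)%:E)%E.
Proof.
move=> s0; apply: series_nneseries; first by move=> n; exact: gauss_ge0.
rewrite /theta3 -gsum_cs0//; have := @gsum_cvg R s 0 s0.
by under [X in series X]eq_fun do rewrite add0r.
Qed.

Lemma BtildeE a b : 0 < a -> 0 < b ->
  (Btilde a b = (theta3 (2 * b ^+ 2)^-1 * theta3 (2 * a ^+ 2)^-1)%:E)%E.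
Proof.
move=> a0 b0; rewrite /Btilde /adjoint_lattice.
have c0 (l : R * R) : 0 <= cabs (stft g0 g0 l).
  by case: l => x w; rewrite stft_gauss mulr_ge0 ?gauss_ge0.
have pos c : 0 < c -> 0 < (2 * c ^+ 2)^-1 :> R.
  by move=> h; rewrite invr_gt0 mulr_gt0// exprn_gt0.
have sc c z : gauss 2^-1 (c^-1 * z) = gauss (2 * c ^+ 2)^-1 z :> R.
  by rewrite /gauss exprMn (invfM 2 (c ^+ 2)) exprVn !mulrA.
rewrite esum_rect_lattice ?invr_eq0 ?gt_eqF//.
have -> : (\sum_(n <oo) \sum_(k <oo) (cabs (stft g0 g0 ((b^-1 * (zenum n)%:~R)%R, (a^-1 * (zenum k)%:~R)%R)))%:E =
   \sum_(n <oo) ((theta3 (2 * a ^+ 2)^-1)%:E * (gauss (2 * b ^+ 2)^-1 (zenum n)%:~R)%:E))%E.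
  apply: eq_eseriesr => n _.
  rewrite -(nneseries_gauss (pos _ a0)) muleC -nneseriesZl; last by move=> k _; rewrite lee_fin gauss_ge0.
  by apply: eq_eseriesr => k _; rewrite stft_gauss !sc EFinM.
rewrite nneseriesZl; last by move=> k _; rewrite lee_fin gauss_ge0.
by rewrite (nneseries_gauss (pos _ b0)) -EFinM mulrC.
Qed.

End Ambiguity.

(** * The two extremal problems *)

Section Main.
Context {R : realType}.
Implicit Types alpha beta : R.

(** Here s = 1/s = 1, so that a single minimum is needed. *)
Lemma Aopt_square : ((2 * theta4 1 ^+ 2)%:E <= Aopt (1 / Num.sqrt 2) (1 / Num.sqrt 2 : R))%E.
Proof.
have h : 0 < Num.sqrt 2 :> R by rewrite sqrtr_gt0.
have h2 : Num.sqrt 2 ^+ 2 = 2 :> R by rewrite sqr_sqrtr.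
set a := 1 / Num.sqrt 2; have a0 : 0 < a by rewrite divr_gt0.
have s1 : 2 * a ^+ 2 = 1 by rewrite /a div1r exprVn h2 divff.
have -> : Aopt a a = Aopt a (2 * a)^-1.
  by congr Aopt; rewrite /a; field: h2; rewrite gt_eqF.
have t4 : 0 <= theta4 1 :> R by apply/ltW/theta4_gt0.
have t3 : 0 <= theta3 1 :> R by apply/ltW/theta3_gt0.
apply: (@Aopt_ge R a _ (2 * (theta3 1 * theta3 1))) => //; try by rewrite !mulr_ge0.
move=> phi cphi sphi.
have := gabor_energy_bounds a0 cphi sphi t4 t4; rewrite s1 invr1 expr2; apply; exact: theta4_1_min.
Qed.

Lemma theta4_mul_le (s : R) : 0 < s -> theta4 s * theta4 s^-1 <= theta4 1 ^+ 2.
Proof.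
move=> s0; have [->|s1] := eqVneq s 1; first by rewrite invr1 expr2.
by rewrite ltW// theta4_mul_lt.
Qed.

Lemma sigma_eq1 alpha beta : 0 < alpha -> (alpha * beta)^-1 = 2 -> 2 * alpha ^+ 2 = 1 ->
  alpha = 1 / Num.sqrt 2 /\ beta = 1 / Num.sqrt 2.
Proof.
move=> a0 ab s1; have h : 0 < Num.sqrt 2 :> R by rewrite sqrtr_gt0.
have aE : alpha = 1 / Num.sqrt 2.
  have : Num.sqrt (2 * alpha ^+ 2) = 1 by rewrite s1 sqrtr1.
  rewrite sqrt_scale// => e; apply: (mulfI (lt0r_neq0 h)); rewrite e div1r divff ?gt_eqF//.
split=> //; rewrite -aE; have := ab; move/(congr1 (fun z => z^-1)); rewrite invrK => e.
apply: (mulfI (lt0r_neq0 a0)); rewrite e -expr2; lra.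
Qed.

End Main.

Theorem theorem1p1 (R : realType) (alpha beta : R)
    (alpha_gt0 : 0 < alpha) (beta_gt0 : 0 < beta)
    (red2 : (alpha * beta)^-1 = 2) :
  ((forall t : R, 0 < t ->
      (Btilde (t / Num.sqrt 2) (t / Num.sqrt 2)
         <= Btilde (t * alpha) (t * beta))%E) ->
    (Aopt (1 / Num.sqrt 2) (1 / Num.sqrt 2) >= Aopt alpha beta)%E)
  /\ (forall t : R, 0 < t ->
        Btilde (t / Num.sqrt 2) (t / Num.sqrt 2)
          = Btilde (t * alpha) (t * beta) ->
        alpha = 1 / Num.sqrt 2 /\ beta = 1 / Num.sqrt 2)
  /\ (Aopt (1 / Num.sqrt 2) (1 / Num.sqrt 2) = Aopt alpha beta ->
        alpha = 1 / Num.sqrt 2 /\ beta = 1 / Num.sqrt 2).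
Proof.
have s0 : 0 < 2 * alpha ^+ 2 by rewrite mulr_gt0// exprn_gt0.
have sq0 : 0 < Num.sqrt 2 :> R by rewrite sqrtr_gt0.
have bE : beta = (2 * alpha)^-1.
  by rewrite -red2; field; rewrite !gt_eqF.
have upper : (Aopt alpha beta <= (2 * (theta4 (2 * alpha ^+ 2) * theta4 (2 * alpha ^+ 2)^-1))%:E)%E.
  by rewrite bE; exact: Aopt_le.
split; [move=> _|split=> [t t0 e|e]].
- apply: le_trans upper _; apply: le_trans Aopt_square.
  by rewrite lee_fin ler_pM2l//; exact: theta4_mul_le.
- apply: (sigma_eq1 alpha_gt0 red2).
  have [//|s1] := eqVneq (2 * alpha ^+ 2) 1.
  have c0 : 0 < t ^- 2 by rewrite invr_gt0 exprn_gt0.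
  have := theta3_mul_lt c0 s0 s1.
  move: e; rewrite !BtildeE ?divr_gt0 ?mulr_gt0// => -[].
  have -> : (2 * (t / Num.sqrt 2) ^+ 2)^-1 = t ^- 2.
    by rewrite exprMn exprVn sqr_sqrtr// mulrCA divff// mulr1.
  have -> : (2 * (t * beta) ^+ 2)^-1 = t ^- 2 * (2 * alpha ^+ 2).
    by rewrite bE; field; rewrite !gt_eqF.
  have -> : (2 * (t * alpha) ^+ 2)^-1 = t ^- 2 / (2 * alpha ^+ 2).
    by field; rewrite !gt_eqF.
  by move=> e; rewrite (expr2 (theta3 _)) e ltxx.
- apply: (sigma_eq1 alpha_gt0 red2).
  have [//|s1] := eqVneq (2 * alpha ^+ 2) 1.
  have := le_trans Aopt_square (le_trans (_ : _ <= Aopt alpha beta)%E upper).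
  rewrite e lexx => /(_ isT); rewrite lee_fin ler_pM2l// leNgt.
  by rewrite theta4_mul_lt.
Qed.
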